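(* Let $n\ge1$ and $\alpha\in(0,1)$. The inclusion $S^{\alpha,1}(\mathbb R^n)\subset BV^\alpha(\mathbb R^n)$ is strict, i.e. $BV^\alpha(\mathbb R^n)\setminus S^{\alpha,1}(\mathbb R^n)\neq\varnothing$.
   Context: For $\alpha\in(0,1)$ let $\mu_{n,\alpha}:=2^\alpha\pi^{-n/2}\,\Gamma\big(\tfrac{n+\alpha+1}{2}\big)/\Gamma\big(\tfrac{1-\alpha}{2}\big)$. For $\varphi\in C^\infty_c(\mathbb R^n;\mathbb R^n)$ the fractional $\alpha$-divergence is $$\mathrm{div}^\alpha\varphi(x):=\mu_{n,\alpha}\int_{\mathbb R^n}\frac{(y-x)\cdot(\varphi(y)-\varphi(x))}{|y-x|^{n+\alpha+1}}\,dy,$$ which is a function in $L^1(\mathbb R^n)\cap L^\infty(\mathbb R^n)$. $BV^\alpha(\mathbb R^n)$ is the space of $f\in L^1(\mathbb R^n)$ with $\sup\big\{\int_{\mathbb R^n}f\,\mathrm{div}^\alpha\varphi\,dx:\ \varphi\in C^\infty_c(\mathbb R^n;\mathbb R^n),\ \|\varphi\|_{L^\infty}\le1\big\}<+\infty$. $S^{\alpha,1}(\mathbb R^n)$ is the space of $f\in L^1(\mathbb R^n)$ for which there exists $g\in L^1(\mathbb R^n;\mathbb R^n)$ (the weak $\alpha$-gradient $\nabla^\alpha_wf$) such that $\int_{\mathbb R^n}f\,\mathrm{div}^\alpha\varphi\,dx=-\int_{\mathbb R^n}g\cdot\varphi\,dx$ for all $\varphi\in C^\infty_c(\mathbb R^n;\mathbb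 R^n)$. *)

(* Defs.v *)
From HB Require Import structures.
From mathcomp Require Import all_boot all_order all_algebra.
From mathcomp Require Import all_classical all_reals all_analysis.

Set Implicit Arguments.
Unset Strict Implicit.
Unset Printing Implicit Defensive.
Import Order.TTheory GRing.Theory Num.Theory.
Import numFieldNormedType.Exports.

Local Open Scope classical_set_scope.
Local Open Scope ring_scope.

(* R^n is the type of row vectors 'rV[R]_n.  Its library norm `|x| is the
   sup norm, which is only used through the topology it induces; the
   Euclidean norm is enorm below. *)

Definition rV_display : measure_display -> measure_display.
Proof. exact. Qed.

Section measurable_rV.
Context {R : realType} {n : nat}.

Definition rV_coord (i : 'I_n) (x : 'rV[R]_n) : measurableTypeR R := x ord0 i.

Let rV_set0 : g_sigma_preimage rV_coord set0.
Proof. exact: sigma_algebra0. Qed.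

Let rV_setC A : g_sigma_preimage rV_coord A -> g_sigma_preimage rV_coord (~` A).
Proof. exact: sigma_algebraC. Qed.

Let rV_bigcup (F : _^nat) : (forall i, g_sigma_preimage rV_coord (F i)) ->
  g_sigma_preimage rV_coord (\bigcup_i (F i)).
Proof. exact: sigma_algebra_bigcup. Qed.

(* The Borel sigma-algebra of R^n, as the sigma-algebra generated by the
   coordinate functions (as the library does for n.-tuple T). *)
HB.instance Definition _ := @isMeasurable.Build
  (rV_display default_measure_display)
  'rV[R]_n (g_sigma_preimage rV_coord) rV_set0 rV_setC rV_bigcup.

Lemma measurable_rV_coord (i : 'I_n) : measurable_fun [set: 'rV[R]_n] (rV_coord i).
Proof.
move=> _ Y mY; rewrite setTI; apply: sub_sigma_algebra => /=.
rewrite -bigcup_seq/=; exists i => /=; first by rewrite mem_index_enum.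
by exists Y => //; rewrite setTI.
Qed.

Lemma measurable_fun_rVP d (T : measurableType d) (f : T -> 'rV[R]_n) :
  (forall i, measurable_fun [set: T] (rV_coord i \o f)) ->
  measurable_fun [set: T] f.
Proof.
move=> mf _ A; rewrite setTI.
pose G : set (set 'rV[R]_n) := [set B | measurable (f @^-1` B)].
suff : g_sigma_preimage rV_coord `<=` G by move=> + mA => /(_ A mA).
apply: smallest_sub.
  split; rewrite /G /=.
  - by rewrite preimage_set0.
  - by move=> B mB; rewrite setTD preimage_setC; exact: measurableC.
  - by move=> F mF; rewrite preimage_bigcup; exact: bigcupT_measurable.
rewrite -bigcup_seq => B /= [i _ [C mC <-]].
rewrite setTI /G /= -comp_preimage.
by rewrite -[X in measurable X]setTI; exact: mf.
Qed.

End measurable_rV.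

Section lebesgue_rV.
Variable R : realType.

Definition rV_cons n (p : measurableTypeR R * 'rV[R]_n) : 'rV[R]_n.+1 :=
  row_mx (p.1%:M : 'M[R]_1) p.2.

Lemma measurable_rV_cons n :
  measurable_fun [set: measurableTypeR R * 'rV[R]_n] (@rV_cons n).
Proof.
apply: measurable_fun_rVP => i.
case: (@split_ordP 1 n i) => j ->.
- rewrite (_ : _ \o _ = fst); first exact: measurable_fst.
  apply/funext => p /=; rewrite /rV_coord /rV_cons.
  rewrite (row_mxEl (p.1%:M : 'M[R]_1) p.2) !ord1.
  by rewrite mxE eqxx mulr1n.
- rewrite (_ : _ \o _ = rV_coord j \o snd).
    by apply: measurableT_comp; [exact: measurable_rV_coord|exact: measurable_snd].
  apply/funext => p /=; rewrite /rV_coord /rV_cons.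
  by rewrite (row_mxEr (p.1%:M : 'M[R]_1) p.2).
Qed.

Definition rV_uncons n (x : 'rV[R]_n.+1) : measurableTypeR R * 'rV[R]_n :=
  (x ord0 ord0, rsubmx (x : 'rV[R]_(1 + n))).

Lemma rV_consK n : cancel (@rV_cons n) (@rV_uncons n).
Proof.
move=> [a x]; rewrite /rV_uncons /rV_cons/= row_mxKr; congr (_, _).
rewrite (_ : ord0 = lshift n (ord0 : 'I_1)); last exact/val_inj.
by rewrite (row_mxEl (a%:M : 'M[R]_1) x) mxE eqxx mulr1n.
Qed.

Lemma measurable_rV_uncons n : measurable_fun [set: 'rV[R]_n.+1] (@rV_uncons n).
Proof.
apply: measurable_fun_pair => /=; first exact: (measurable_rV_coord ord0).
apply: measurable_fun_rVP => i.
rewrite (_ : _ \o _ = rV_coord (rshift 1 i)); first exact: measurable_rV_coord.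
by apply/funext => x; rewrite /rV_coord/= mxE.
Qed.

Section lebesgue_cons.
Context n (m : {sigma_finite_measure set 'rV[R]_n -> \bar R}).

Definition lebesgue_cons : set 'rV[R]_n.+1 -> \bar R :=
  pushforward (@lebesgue_measure R \x m)%E (@rV_cons n).

Let measurable_preim (A : set 'rV[R]_n.+1) :
  measurable A -> measurable (@rV_cons n @^-1` A).
Proof. by move=> mA; rewrite -[X in measurable X]setTI; exact: measurable_rV_cons. Qed.

Let lebesgue_cons0 : lebesgue_cons set0 = 0%E.
Proof. by rewrite /lebesgue_cons /pushforward preimage_set0 measure0. Qed.

Let lebesgue_cons_ge0 A : (0 <= lebesgue_cons A)%E.
Proof. by rewrite /lebesgue_cons /pushforward; apply: measure_ge0. Qed.

Let lebesgue_cons_sigma_additive : semi_sigma_additive lebesgue_cons.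
Proof.
move=> F mF tF mUF; rewrite /lebesgue_cons /pushforward preimage_bigcup.
apply: measure_semi_sigma_additive.
- by move=> k; exact: measurable_preim.
- apply/trivIsetP => /= i j _ _ ij; rewrite -preimage_setI.
  by move/trivIsetP : tF => /(_ _ _ _ _ ij) ->//; rewrite preimage_set0.
- by rewrite -preimage_bigcup; exact: measurable_preim.
Qed.

HB.instance Definition _ := isMeasure.Build _ _ _ lebesgue_cons
  lebesgue_cons0 lebesgue_cons_ge0 lebesgue_cons_sigma_additive.

Let lebesgue_cons_sigma_finite : sigma_finite setT lebesgue_cons.
Proof.
have [F FT Foo] : sigma_finite setT (@lebesgue_measure R \x m)%E.
  have /sigma_finiteP[F [TF ndF Foo]] := sigma_finiteT (@lebesgue_measure R).
  have /sigma_finiteP[G [TG ndG Goo]] := sigma_finiteT m.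
  exists (fun k => F k `*` G k).
    rewrite -setXTT TF TG predeqE => -[x y]; split => /=.
      move=> [[i _ Fix] [j _ Gjy]]; exists (maxn i j) => //; split.
        exact: (subsetPset _ _ (ndF _ _ (leq_maxl i j))).
      exact: (subsetPset _ _ (ndG _ _ (leq_maxr i j))).
    by move=> [k _ [Fkx Gky]]; split; exists k.
  move=> k; have [mFk Fkoo] := Foo k; have [mGk Gkoo] := Goo k.
  split; first exact: measurableX.
  by rewrite product_measure1E// lte_mul_pinfty// ge0_fin_numE.
exists (fun k => @rV_uncons n @^-1` F k).
  by rewrite -preimage_bigcup -FT preimage_setT.
move=> k; have [mFk Fkoo] := Foo k; split.
  by rewrite -[X in measurable X]setTI; exact: measurable_rV_uncons.
rewrite /lebesgue_cons /pushforward -comp_preimage.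
rewrite (_ : _ \o _ = id) ?preimage_id//; exact/funext/rV_consK.
Qed.

HB.instance Definition _ := Measure_isSigmaFinite.Build _ _ _ lebesgue_cons
  lebesgue_cons_sigma_finite.

End lebesgue_cons.

(* n-dimensional Lebesgue measure: the n-fold product of the Lebesgue measure
   on R; lebesgue_rV_box states that it is the volume on boxes. *)
Fixpoint lebesgue_rV n : {sigma_finite_measure set 'rV[R]_n -> \bar R} :=
  match n with
  | 0 => dirac (0 : 'rV[R]_0)
  | n'.+1 => lebesgue_cons (lebesgue_rV n')
  end.

Lemma lebesgue_rV_box n (I : 'I_n -> interval R) :
  lebesgue_rV n [set x | forall i, x ord0 i \in I i] =
  (\prod_(i < n) lebesgue_measure ([set` I i] : set R))%E.
Proof.
elim: n I => [|n IHn] I.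
  by rewrite big_ord0 /= diracE mem_set// => -[].
rewrite big_ord_recl -IHn /= /lebesgue_cons /pushforward.
rewrite -[RHS]product_measure1E//; first last.
  rewrite (_ : (fun x => _) = \bigcap_(i in [set: 'I_n])
    (rV_coord i @^-1` [set` I (lift ord0 i)])).
    apply: fin_bigcap_measurable => [|i _]; first exact: finite_finset.
    rewrite -[X in measurable X]setTI; exact: measurable_rV_coord.
  by apply/seteqP; split => x /= xI i; [move=> _|]; exact: xI.
congr ((_ \x _)%E _); apply/seteqP; split => -[a x] /=.
  move=> axI; split.
    have := axI ord0; rewrite /rV_cons.
    rewrite (_ : ord0 = lshift n (ord0 : 'I_1)); last exact/val_inj.
    by rewrite (row_mxEl (a%:M : 'M[R]_1) x) mxE eqxx mulr1n.
  move=> i; have := axI (lift ord0 i); rewrite /rV_cons.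
  rewrite (_ : lift ord0 i = rshift 1 i); last exact/val_inj.
  by rewrite (row_mxEr (a%:M : 'M[R]_1) x).
move=> [aI xI] i; rewrite /rV_cons; case: (@split_ordP 1 n i) => j ->.
  rewrite (row_mxEl (a%:M : 'M[R]_1) x) !ord1 mxE eqxx mulr1n.
  by rewrite (_ : lshift n 0 = ord0)//; exact/val_inj.
rewrite (row_mxEr (a%:M : 'M[R]_1) x).
by rewrite (_ : rshift 1 j = lift ord0 j)//; exact/val_inj.
Qed.

End lebesgue_rV.

Section fractional.
Variables (R : realType) (n : nat).
Implicit Types (x y : 'rV[R]_n) (f : 'rV[R]_n -> R) (phi g : 'rV[R]_n -> 'rV[R]_n).

Local Notation leb := (lebesgue_rV R n).

Definition dot x y : R := \sum_(i < n) x ord0 i * y ord0 i.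

Definition enorm x : R := Num.sqrt (dot x x).

Definition basis_vec (i : 'I_n) : 'rV[R]_n := delta_mx ord0 i.

Definition iter_partial (s : seq 'I_n) phi : 'rV[R]_n -> 'rV[R]_n :=
  foldr (fun i psi x => 'D_(basis_vec i) psi x) phi s.

(* C^oo: all iterated partial derivatives exist everywhere and are
   continuous ('D_v is total, so existence is a separate requirement). *)
Definition smooth phi : Prop := forall s : seq 'I_n,
  continuous (iter_partial s phi) /\
  forall (i : 'I_n) x, derivable (iter_partial s phi) x (basis_vec i).

Definition compact_support phi : Prop :=
  compact (closure [set x | phi x != 0]).

Definition Cc_smooth : set ('rV[R]_n -> 'rV[R]_n) :=
  [set phi | smooth phi /\ compact_support phi].

Definition Linfty_norm phi : \bar R :=
  'N[leb]_+oo%E [(fun x => (enorm (phi x))%:E)]%E.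

Definition Gamma (s : R) : R :=
  \int[lebesgue_measure]_(t in `]0, +oo[) (t `^ (s - 1) * expR (- t)).

Definition frac_const (alpha : R) : R :=
  2 `^ alpha * pi `^ (- (n%:R / 2)) *
  Gamma ((n%:R + alpha + 1) / 2) / Gamma ((1 - alpha) / 2).

Definition frac_div (alpha : R) phi x : R :=
  frac_const alpha *
  \int[leb]_y (dot (y - x) (phi y - phi x) /
               enorm (y - x) `^ (n%:R + alpha + 1)).

Definition L1 : set ('rV[R]_n -> R) :=
  [set f | leb.-integrable setT (EFin \o f)].

Definition L1_vec : set ('rV[R]_n -> 'rV[R]_n) :=
  [set g | forall i : 'I_n, L1 (fun x => g x ord0 i)].

(* Elements of BV and S are (Borel) functions rather than a.e.-classes; both
   predicates only depend on the class, and every class of Lebesgue measurable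
   functions has a Borel representative. *)
Definition BV_frac (alpha : R) : set ('rV[R]_n -> R) :=
  [set f | L1 f /\
    (ereal_sup [set (\int[leb]_x (f x * frac_div alpha phi x))%:E | phi in
       [set phi | Cc_smooth phi /\ (Linfty_norm phi <= 1)%E]] < +oo)%E].

Definition weak_frac_gradient (alpha : R) f g : Prop :=
  forall phi, Cc_smooth phi ->
    \int[leb]_x (f x * frac_div alpha phi x) =
    - \int[leb]_x dot (g x) (phi x).

Definition S_frac (alpha : R) : set ('rV[R]_n -> R) :=
  [set f | L1 f /\ exists2 g, L1_vec g & weak_frac_gradient alpha f g].

End fractional.

Arguments BV_frac {R} n alpha _.
Arguments S_frac {R} n alpha _.

(* Main.v *)
Require Import Defs.
From HB Require Import structures.
From mathcomp Require Import all_boot all_order all_algebra.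
From mathcomp Require Import all_classical all_reals all_analysis.
From mathcomp Require Import measurable_realfun ess_sup_inf.
From mathcomp Require Import lra.

Set Implicit Arguments.
Unset Strict Implicit.
Unset Printing Implicit Defensive.
Import Order.TTheory GRing.Theory Num.Theory.
Import numFieldNormedType.Exports.

Local Open Scope classical_set_scope.
Local Open Scope ring_scope.

(**
Write k(z) = z / |z|^(n+alpha+1), so that up to a positive constant the
fractional divergence is the sum over i of the integral of
k_i(z) (phi_i(x+z) - phi_i(x)).  If v is Lipschitz with compact support then,
on sin(N x_e) v(x), this operator acts like the multiplication by a factor
gamma(N) followed by the change of sine into cosine: integrating by parts,
the pairing of sin(N x_e) v with the fractional divergence of phi equals
- gamma(N) times the integral of cos(N x_e) v phi_e, up to an error bounded
independently of N (oddness of k kills every other term).  Moreover gamma is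
unbounded.

Hence a Riesz product mu_k = w prod_(j < k) (1 + cos(N_j x_e)), with w a bump
and with frequencies N_j chosen inductively and fast enough, is reached by a
function: f = sum_k gamma(N_k)^-1 sin(N_k x_e) mu_k converges uniformly, and
its fractional gradient is lim mu_k - mu_0 in the direction e plus a small
error.  The mu_k are nonnegative with bounded mass, so f has finite fractional
variation.  But the pairing of f with the fractional divergence of the field
cos(N_j x_e) w in the direction e stays away from 0 for all j, whereas averages of these test functions tend to 0 boundedly in L^2, which
is impossible when the fractional gradient is an integrable function.
*)

(** * Invariance and measurability on row vectors *)

(** The factor gamma(N) is the integral of k_e(z) sin(N z_e), of order N^alpha by homogeneity. The
    error on sin(N x_e) v is a commutator: it involves only the increments of v, so its bound does
    not see N, and after division by gamma(N) it is as small as desired. This is what lets stage k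
    cost at most eps / 2^k. The match with the Riesz product is the identity mu_(k+1) - mu_k =
    cos(N_k x_e) mu_k: the cosine produced by the k-th term of f is exactly the increment of mu, so
    the sum telescopes. Since mu_k <= 2^k, asking for gamma(N_k) >= 4^k gives the uniform
    convergence of f. The obstruction to integrability is of Riemann-Lebesgue type: the factor 1 +
    cos(N_j x_e) correlates with cos(N_j x_e) with mean 1/2, and later factors hardly change this,
    so the coefficients of the limit at the frequencies N_j do not tend to 0. It is used in
    quantitative form: the cosines are almost orthogonal, so the sum of J of them has L^2 norm of
    order sqrt J, while its pairing with the gradient would grow like J. *)

Lemma lebesgue_measure_shift (R : realType) (a : R) (A : set R) : measurable A ->
  pushforward lebesgue_measure ((fun t => t + a) : _ -> measurableTypeR R) A =
  lebesgue_measure A.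
Proof.
have ms : measurable_fun [set: R] (fun t => t + a) by exact: measurable_funD.
move=> mA; apply/esym/lebesgue_measure_unique => //= _ [[x y]] _ <-.
rewrite /pushforward (_ : _ @^-1` _ = `]x - a, y - a]%classic); last first.
  by apply/seteqP; split => t /=; rewrite !in_itv/= ltrBlDr lerBrDr.
rewrite !lebesgue_measure_itv/= !lte_fin ltrD2r.
by case: ifP => // _; rewrite -!EFinB opprD addrACA subrr addr0.
Qed.

(* Covers at once translations and changes of sign of coordinates. *)
Definition lebesgue_preserving (R : realType) (h : R -> R) :=
  measurable_fun [set: R] h /\
  forall G : R -> \bar R, measurable_fun [set: R] G -> (forall x, 0 <= G x)%E ->
    (\int[lebesgue_measure]_x G (h x) = \int[lebesgue_measure]_x G x)%E.

Lemma lebesgue_preserving_push (R : realType) (h : R -> R) :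
  measurable_fun [set: R] h ->
  (forall A : set R, measurable A ->
     pushforward lebesgue_measure (h : _ -> measurableTypeR R) A =
       lebesgue_measure A) ->
  lebesgue_preserving h.
Proof.
move=> mh hE; split=> // G mG G0.
transitivity (\int[pushforward lebesgue_measure
    (h : _ -> measurableTypeR R)]_x G x)%E.
  by rewrite ge0_integral_pushforward.
by apply: eq_measure_integral => A mA _; exact: hE.
Qed.

Lemma lebesgue_preserving_shift (R : realType) (a : R) :
  lebesgue_preserving (fun t => t + a).
Proof.
apply: lebesgue_preserving_push; last exact: lebesgue_measure_shift.
exact: measurable_funD.
Qed.

Lemma lebesgue_preserving_opp (R : realType) : lebesgue_preserving (@GRing.opp R).
Proof.
apply: lebesgue_preserving_push; last exact: lebesgue_measureN.
exact: oppr_measurable.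
Qed.

Lemma lebesgue_preserving_id (R : realType) : lebesgue_preserving (@id R).
Proof. by split. Qed.

Section rV_invariance.
Variable R : realType.

Definition rV_map n (h : 'I_n -> R -> R) (x : 'rV[R]_n) : 'rV[R]_n :=
  \row_i h i (x ord0 i).

Lemma measurable_rV_map n (h : 'I_n -> R -> R) :
  (forall i, measurable_fun [set: R] (h i)) -> measurable_fun setT (rV_map h).
Proof.
move=> mh; apply: measurable_fun_rVP => i.
rewrite (_ : _ \o _ = h i \o rV_coord i); last first.
  by apply/funext => x; rewrite /rV_coord/= mxE.
exact: (measurableT_comp (mh i) (@measurable_rV_coord R n i)).
Qed.

Lemma rV_cons_ord0 n (p : R * 'rV[R]_n) : rV_cons p ord0 ord0 = p.1.
Proof. exact: (congr1 fst (rV_consK p)). Qed.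

Lemma rV_cons_lift n (p : R * 'rV[R]_n) j :
  rV_cons p ord0 (lift ord0 j) = p.2 ord0 j.
Proof.
rewrite -[in RHS](congr1 snd (rV_consK p)) [RHS]mxE.
by rewrite (_ : lift ord0 j = rshift 1 j)//; exact/val_inj.
Qed.

Lemma rV_map_cons n (h : 'I_n.+1 -> R -> R) a (x : 'rV[R]_n) :
  rV_map h (rV_cons (a, x)) =
  rV_cons (h ord0 a, rV_map (fun i => h (lift ord0 i)) x).
Proof.
apply/rowP => i; rewrite mxE; case: (unliftP ord0 i) => [j ->|->].
  by rewrite !rV_cons_lift mxE.
by rewrite !rV_cons_ord0.
Qed.

Lemma integral_lebesgue_cons n (F : 'rV[R]_n.+1 -> \bar R) :
  measurable_fun setT F -> (forall x, 0 <= F x)%E ->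
  (\int[lebesgue_rV R n.+1]_x F x =
   \int[lebesgue_measure]_a \int[lebesgue_rV R n]_x F (rV_cons (a, x)))%E.
Proof.
move=> mF F0 /=; rewrite /lebesgue_cons ge0_integral_pushforward//; last first.
  exact: measurable_rV_cons.
rewrite (fubini_tonelli1 (F \o @rV_cons R n)) => [//||p]; last exact: F0.
by apply: measurableT_comp => //; exact: measurable_rV_cons.
Qed.

(** By induction on the dimension. Tonelli isolates the first coordinate; the induction hypothesis
    removes the maps on the other coordinates, and the invariance for [h ord0] is then applied to
    the inner integral as a function of the first coordinate. *)
Lemma ge0_integral_rV_map n (h : 'I_n -> R -> R) (F : 'rV[R]_n -> \bar R) :
  (forall i, lebesgue_preserving (h i)) ->
  measurable_fun setT F -> (forall x, 0 <= F x)%E ->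
  (\int[lebesgue_rV R n]_x F (rV_map h x) = \int[lebesgue_rV R n]_x F x)%E.
Proof.
elim: n h F => [|n IH] h F hp mF F0.
  by apply: eq_integral => x _; congr F; apply/rowP => -[].
have mFh : measurable_fun setT (F \o rV_map h).
  by apply: measurableT_comp => //; apply: measurable_rV_map => i; have [] := hp i.
have mFa a : measurable_fun setT (fun x : 'rV[R]_n => F (rV_cons (a, x))).
  apply: (measurableT_comp mF).
  apply: (measurableT_comp (@measurable_rV_cons R n)).
  exact: pair1_measurable.
rewrite !integral_lebesgue_cons//.
transitivity (\int[lebesgue_measure]_a
    \int[lebesgue_rV R n]_x F (rV_cons (h ord0 a, x)))%E.
  apply: eq_integral => a _.
  rewrite -(IH _ (fun x => F (rV_cons (h ord0 a, x)))
    (fun i => hp (lift ord0 i)) (mFa _))//.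
  by apply: eq_integral => x _; rewrite rV_map_cons.
have [_ hG] := hp ord0.
apply: (hG (fun a => \int[lebesgue_rV R n]_x F (rV_cons (a, x)))%E).
  apply: (@measurable_fun_fubini_tonelli_F _ _ _ _ _ (lebesgue_rV R n)
    (F \o @rV_cons R n)) => //.
  exact: (measurableT_comp mF (@measurable_rV_cons R n)).
- by move=> p; exact: F0.
- by move=> a; apply: integral_ge0 => x _; exact: F0.
Qed.

Lemma integral_rV_map n (h : 'I_n -> R -> R) (F : 'rV[R]_n -> \bar R) :
  (forall i, lebesgue_preserving (h i)) -> measurable_fun setT F ->
  (\int[lebesgue_rV R n]_x F (rV_map h x) = \int[lebesgue_rV R n]_x F x)%E.
Proof.
move=> hp mF; rewrite [LHS]integralE [RHS]integralE.
congr (_ - _)%E.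
  rewrite -(ge0_integral_rV_map hp (measurable_funepos mF) (funepos_ge0 F)).
  by apply: eq_integral => x _; rewrite !funeposE.
rewrite -(ge0_integral_rV_map hp (measurable_funeneg mF) (funeneg_ge0 F)).
by apply: eq_integral => x _; rewrite !funenegE.
Qed.

Lemma integral_shift n (F : 'rV[R]_n -> \bar R) (v : 'rV[R]_n) :
  measurable_fun setT F ->
  (\int[lebesgue_rV R n]_x F (x + v)%R = \int[lebesgue_rV R n]_x F x)%E.
Proof.
move=> mF.
rewrite -(integral_rV_map (fun i => lebesgue_preserving_shift (v ord0 i)) mF).
by apply: eq_integral => x _; congr F; apply/rowP => i; rewrite !mxE.
Qed.

Lemma Rintegral_shift n (F : 'rV[R]_n -> R) (v : 'rV[R]_n) :
  measurable_fun setT F ->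
  \int[lebesgue_rV R n]_x F (x + v) = \int[lebesgue_rV R n]_x F x.
Proof.
move=> mF; congr fine; apply: (integral_shift (F := EFin \o F)).
exact/measurable_EFinP.
Qed.

Lemma Rintegral_oppv n (F : 'rV[R]_n -> R) :
  measurable_fun setT F ->
  \int[lebesgue_rV R n]_x F (- x) = \int[lebesgue_rV R n]_x F x.
Proof.
move=> mF; congr fine.
have mEF : measurable_fun setT (EFin \o F) by exact/measurable_EFinP.
rewrite -(integral_rV_map (fun i => @lebesgue_preserving_opp R) mEF).
by apply: eq_integral => x _; congr (F _)%:E; apply/rowP => i; rewrite !mxE.
Qed.

Definition flip_coord n (j : 'I_n) (x : 'rV[R]_n) : 'rV[R]_n :=
  \row_i (if i == j then - x ord0 i else x ord0 i).

Lemma Rintegral_flip n j (F : 'rV[R]_n -> R) :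
  measurable_fun setT F ->
  \int[lebesgue_rV R n]_x F (flip_coord j x) = \int[lebesgue_rV R n]_x F x.
Proof.
move=> mF; congr fine.
have mEF : measurable_fun setT (EFin \o F) by exact/measurable_EFinP.
have hp (i : 'I_n) : lebesgue_preserving (fun t : R => if i == j then - t else t).
  by case: (i == j);
    [exact: lebesgue_preserving_opp|exact: lebesgue_preserving_id].
by rewrite -(integral_rV_map hp mEF).
Qed.

Lemma integrable_shift n (F : 'rV[R]_n -> R) (v : 'rV[R]_n) :
  (lebesgue_rV R n).-integrable setT (EFin \o F) ->
  (lebesgue_rV R n).-integrable setT (EFin \o (fun x => F (x + v))).
Proof.
move=> /integrableP[mF Fi]; apply/integrableP; split.
  apply: (measurableT_comp mF).
  rewrite (_ : (fun x => x + v) = rV_map (fun i t => t + v ord0 i)).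
    by apply: measurable_rV_map => i; exact: measurable_funD.
  by apply/funext => x; apply/rowP => i; rewrite !mxE.
rewrite (integral_shift (F := fun x => `|(EFin \o F) x|%E))//.
exact: measurableT_comp.
Qed.

End rV_invariance.

Section rV_norm.
Variables (R : realType) (n : nat).
Implicit Types x y : 'rV[R]_n.

Lemma ler_coord_norm x i : `|x ord0 i| <= `|x|.
Proof.
rewrite [leRHS]/Num.norm /= mx_normrE; apply/bigmax_geP; right.
by exists (ord0, i).
Qed.

Lemma rV_norm_ler x r : 0 <= r -> (forall i, `|x ord0 i| <= r) -> `|x| <= r.
Proof.
move=> r0 xr; rewrite [leLHS]/Num.norm /= mx_normrE.
by apply/bigmax_leP; split => // -[i j] _; rewrite ord1; exact: xr.
Qed.

Lemma measurable_rV_coordr (i : 'I_n) :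
  measurable_fun [set: 'rV[R]_n] (fun x => x ord0 i : R).
Proof. exact: (@measurable_rV_coord R n i). Qed.

Definition rat_box (p : 'rV[rat]_n * nat) : set 'rV[R]_n :=
  [set x | forall i, `|x ord0 i - ratr (p.1 ord0 i)| < p.2.+1%:R^-1].

Lemma measurable_rat_box p : measurable (rat_box p).
Proof.
rewrite (_ : rat_box p = \bigcap_(i in [set: 'I_n])
    ((fun x : 'rV[R]_n => x ord0 i) @^-1`
       (ball (ratr (p.1 ord0 i) : R) p.2.+1%:R^-1))).
  apply: fin_bigcap_measurable => [|i _]; first exact: finite_finset.
  rewrite -[X in measurable X]setTI; apply: measurable_rV_coordr => //.
  exact: measurable_ball.
apply/seteqP; split=> x /= xp i; [move=> _|]; last have := xp i I.
  by rewrite -ball_normE /= distrC; exact: xp.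
by rewrite -ball_normE /= distrC.
Qed.

(** The sigma-algebra is generated by the coordinates, so an open set has to be reached through
    countably many boxes: it is the union of the [rat_box] sets that it contains. *)
Lemma open_measurable_rV (U : set 'rV[R]_n) : open U -> measurable U.
Proof.
move=> oU.
rewrite (_ : U = \bigcup_p (if `[< rat_box p `<=` U >] then rat_box p else set0)).
  apply: countable_bigcupT_measurable => [|p].
    exact: countableP.
  by case: ifP => _ //; exact: measurable_rat_box.
apply/seteqP; split => [x Ux|x [p _]]; last first.
  by case: ifPn => // /asboolP + px; exact.
have [e /= e0 xeU] : exists2 e : R, 0 < e & ball x e `<=` U.
  by apply/nbhs_ballP; exact: (open_nbhs_nbhs (conj oU Ux)).
(* Two points of a box of radius 1/(m+1) are at distance at most 2/(m+1), which is less than [e]. *)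
have [m me] : exists m : nat, m.+1%:R^-1 < e / 2.
  have [m _ hm] := near_infty_natSinv_lt (PosNum (divr_gt0 e0 (ltr0n R 2))).
  by exists m; exact: (hm m (leqnn m)).
have m0 : 0 < m.+1%:R^-1 :> R by rewrite invr_gt0.
have hq i : {q : rat | `|x ord0 i - ratr q| < m.+1%:R^-1}.
  apply: cid.
  have xm : x ord0 i - m.+1%:R^-1 < x ord0 i by rewrite ltrBlDr ltrDl.
  have [q] := rat_in_itvoo xm.
  rewrite in_itv /= => /andP[q1 q2]; exists q.
  by rewrite ger0_norm ?subr_ge0 1?ltW// ltrBlDr -ltrBlDl.
pose q := \row_i sval (hq i).
exists (q, m) => //; case: ifPn => [_ i|/asboolP []] /=.
  by rewrite mxE; case: (hq i).
move=> y yq; apply: xeU; rewrite mx_norm_ball /ball_ /=.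
apply: (@le_lt_trans _ _ (m.+1%:R^-1 *+ 2)); last first.
  by rewrite mulr2n [ltRHS]splitr ltrD.
apply: rV_norm_ler => [|i]; first by rewrite mulrn_wge0// ltW.
rewrite !mxE mulr2n; have := yq i; rewrite /= mxE; case: (hq i) => r /= xr yr.
rewrite (le_trans (ler_distD (ratr r) _ _))// lerD// ltW// distrC//.
Qed.

Lemma continuous_measurable_rV (f : 'rV[R]_n -> R) :
  continuous f -> measurable_fun setT f.
Proof.
move=> /continuousP cf; apply: (measurability _ (RGenOInfty.measurableE R)).
move=> _ [_ [a ->] <-]; rewrite setTI; apply: open_measurable_rV.
by apply: cf; exact: interval_open.
Qed.

Lemma measurable_rV_norm : measurable_fun setT (fun x : 'rV[R]_n => `|x|).
Proof. by apply: continuous_measurable_rV => x; exact: norm_continuous. Qed.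

End rV_norm.

(** * Dyadic integrability criterion *)

Section cover_bounds.
Local Open Scope ereal_scope.
Context d (T : measurableType d) (R : realType).
Variable mu : {measure set T -> \bar R}.

(** The function is below the sum of the [c j] times the indicators of the [A j]; the sets may
    overlap, which is why balls can replace shells below. *)
Lemma ge0_integral_le_cover (A : nat -> set T) (c : nat -> R) (f : T -> \bar R) :
  (forall j, measurable (A j)) -> (forall j, (0 <= c j)%R) ->
  measurable_fun setT f -> (forall x, 0 <= f x) ->
  (forall x, f x = 0 \/ exists2 j, A j x & f x <= (c j)%:E) ->
  \int[mu]_x f x <= \sum_(j <oo) ((c j)%:E * mu (A j)).
Proof.
move=> mA c0 mf f0 fA.
have g0 j x : 0 <= (c j)%:E * (\1_(A j) x)%:E :> \bar R.
  by rewrite mule_ge0 ?lee_fin ?indicE.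
have mg j : measurable_fun setT (fun x => (c j)%:E * (\1_(A j) x)%:E).
  apply: emeasurable_funM => //; apply/measurable_EFinP.
  exact: measurable_indic.
apply: (@le_trans _ _
    (\int[mu]_x \sum_(j <oo) ((c j)%:E * (\1_(A j) x)%:E))).
  apply: ge0_le_integral => //.
  - by apply: (ge0_emeasurable_sum (P := xpredT)) => // k x _ _; exact: g0.
  - move=> x _; case: (fA x) => [->|[j Ajx fx]]; first exact: nneseries_ge0.
    apply: (le_trans fx); rewrite [leRHS](@nneseriesD1 _ _ j)// indicE mem_set//.
    by rewrite mule1 leeDl// nneseries_ge0.
rewrite integral_nneseries//; apply: lee_nneseries => [j _ _|j _].
  by rewrite integral_ge0.
rewrite ge0_integralZl_EFin//; first by rewrite integral_indic// setIT.
by apply/measurable_EFinP; exact: measurable_indic.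
Qed.

Lemma nneseries_geometric_lty (u : nat -> \bar R) (K z : R) :
  (0 <= K)%R -> (0 < z < 1)%R ->
  (forall j, 0 <= u j) -> (forall j, u j <= (K * z ^+ j)%:E) ->
  \sum_(j <oo) u j < +oo.
Proof.
move=> K0 /andP[z0 z1] u0 uz.
apply: (@le_lt_trans _ _ (K / (1 - z))%:E); last exact: ltry.
apply: lime_le; first exact: is_cvg_nneseries.
apply: nearW => n; apply: (@le_trans _ _ (series (geometric K z) n)%:E).
  rewrite /series /= -sumEFin; apply: lee_sum => i _; exact: uz.
by rewrite lee_fin geometric_le_lim// ger0_norm// ltW.
Qed.

End cover_bounds.

Section dyadic.
Context (R : realType).

Lemma pow2_bracket (x : R) : 1 <= x -> exists j : nat, 2 ^+ j <= x < 2 ^+ j.+1.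
Proof.
move=> x1; have ex : exists j : nat, x < 2 ^+ j.+1.
  exists (Num.bound x); apply: (lt_le_trans (archi_boundP (le_trans ler01 x1))).
  by rewrite -natrX ler_nat ltnW// ltnW// ltn_expl.
case: (ex_minnP ex) => -[|j] xj jmin; first by exists 0%N; rewrite expr0 x1.
exists j.+1; rewrite xj andbT leNgt; apply/negP => /jmin; by rewrite ltnn.
Qed.

(** On a dyadic shell a power is comparable to its value at the outer radius; the factor 2^|p|
    serves both signs of [p]. *)
Lemma powR_half_le (q v p : R) : 0 < q -> q / 2 <= v <= q ->
  v `^ p <= 2 `^ `|p| * q `^ p.
Proof.
move=> q0 /andP[qv vq].
have v0 : 0 < v by rewrite (lt_le_trans _ qv)// divr_gt0.
have [p0|p0] := leP 0 p.
  rewrite (@le_trans _ _ (q `^ p))//.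
    by rewrite ge0_ler_powR// nnegrE ltW.
  by rewrite ler_peMl ?powR_ge0// -[leLHS](powRr0 2) ler_powR ?ler1n.
rewrite ltr0_norm//; have [t tE] : exists t, p = - t by exists (- p); rewrite opprK.
have t0 : 0 <= t by rewrite -oppr_le0 -tE ltW.
rewrite tE opprK !powRN ler_pdivlMr ?powR_gt0// mulrC.
rewrite ler_pdivrMr ?powR_gt0// -powRM ?(ltW v0)//.
rewrite ge0_ler_powR ?nnegrE ?mulr_ge0 ?(ltW v0) ?(ltW q0)//.
by rewrite mulrC -ler_pdivrMr.
Qed.

Context d (T : measurableType d) (mu : {measure set T -> \bar R}).
Variables (nu : T -> R) (C dim : R).
Hypothesis mnu : measurable_fun setT nu.
Hypothesis nu0 : forall x, 0 <= nu x.
Hypothesis C0 : 0 <= C.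
Hypothesis nuC : forall r, 0 < r ->
  (mu [set x | nu x <= r]%R <= (C * r `^ dim)%:E)%E.

Let mA (q : R) : measurable [set x | nu x <= q].
Proof.
rewrite (_ : [set _ | _] = nu @^-1` `]-oo, q]%classic).
  by rewrite -[X in measurable X]setTI; apply: mnu => //; exact: measurable_itv.
by apply/seteqP; split => x /=; rewrite in_itv.
Qed.

(** The shell of outer radius 2^(sg j) lies in a ball of measure at most C 2^(sg j * dim), on which
    [f] is of order 2^(sg j * p). The hypothesis on [z] makes the sum of these contributions
    geometric. The sequence [sg] decreases for the shells near the origin and increases for those at
    infinity. *)
Let dyadic_lty (sg : nat -> R) (p K z : R) (f : T -> R) : 0 <= K ->
  0 < z < 1 -> (forall j, 2 `^ (sg j * (p + dim)) <= z ^+ j) ->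
  measurable_fun setT f -> (forall x, 0 <= f x) ->
  (forall x, f x = 0 \/
     (f x <= K * nu x `^ p /\ exists j, 2 `^ sg j / 2 <= nu x <= 2 `^ sg j)) ->
  (\int[mu]_x (f x)%:E < +oo)%E.
Proof.
move=> K0 z01 sgz mf f0 fp.
have q0 j : 0 < 2 `^ sg j :> R by rewrite powR_gt0.
apply: (@le_lt_trans _ _ (\sum_(j <oo)
    ((K * (2 `^ `|p| * (2 `^ sg j) `^ p))%:E * mu [set x | (nu x <= 2 `^ sg j)%R]))%E).
  apply: ge0_integral_le_cover => //.
  - by move=> j; rewrite !mulr_ge0// powR_ge0.
  - exact/measurable_EFinP.
  - move=> x; case: (fp x) => [->|[fx [j jx]]]; first by left.
    right; exists j; first by case/andP: jx.
    by rewrite lee_fin (le_trans fx)// ler_wpM2l// powR_half_le.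
apply: (@nneseries_geometric_lty _ _ (K * 2 `^ `|p| * C) z) => //.
- by rewrite !mulr_ge0// powR_ge0.
- by move=> j; rewrite mule_ge0// lee_fin !mulr_ge0// powR_ge0.
- move=> j; apply: (@le_trans _ _
    ((K * (2 `^ `|p| * (2 `^ sg j) `^ p))%:E * (C * (2 `^ sg j) `^ dim)%:E))%E.
    by rewrite lee_wpmul2l ?nuC// lee_fin !mulr_ge0// powR_ge0.
  rewrite -EFinM lee_fin.
  apply: (@le_trans _ _ (K * 2 `^ `|p| * C * 2 `^ (sg j * (p + dim)))).
    rewrite mulrDr powRD; last by rewrite pnatr_eq0 implybT.
    rewrite !powRrM; lra.
  by rewrite ler_wpM2l// !mulr_ge0// powR_ge0.
Qed.

(** Stated for a gauge [nu] whose balls have measure of order r^dim, so that it applies both to the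
    fractional kernel in R^n and to the Gamma integrand on the line. *)
Lemma dyadic_integrable (f : T -> R) (K s1 s2 : R) : 0 <= K -> 0 < s1 -> 0 < s2 ->
  measurable_fun setT f -> (forall x, 0 <= f x) ->
  (forall x, nu x = 0 -> f x = 0) ->
  (forall x, 0 < nu x <= 1 -> f x <= K * nu x `^ (s1 - dim)) ->
  (forall x, 1 < nu x -> f x <= K * nu x `^ (- s2 - dim)) ->
  mu.-integrable setT (EFin \o f).
Proof.
move=> K0 s10 s20 mf f0 fz fnear ffar.
have z01 (s : R) : 0 < s -> (0 : R) < 2 `^ (- s) < 1.
  move=> s0; rewrite powR_gt0//= powRN invf_lt1 ?powR_gt0//.
  have := @gt0_ltr_powR R _ s0 1 2; rewrite powR1; apply; rewrite ?nnegrE//.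
  by rewrite ltr1n.
have mle1 : measurable [set x | nu x <= 1] by exact: mA.
pose f1 x := f x * \1_[set x | nu x <= 1] x.
pose f2 x := f x * \1_(~` [set x | nu x <= 1]) x.
have mf1 : measurable_fun setT f1.
  by apply: measurable_funM => //; exact: measurable_indic.
have mf2 : measurable_fun setT f2.
  by apply: measurable_funM => //; apply: measurable_indic; exact: measurableC.
have f1_ge0 x : 0 <= f1 x by rewrite mulr_ge0// indicE.
have f2_ge0 x : 0 <= f2 x by rewrite mulr_ge0// indicE.
apply/integrableP; split; first exact/measurable_EFinP.
rewrite (eq_integral (fun x => (f1 x)%:E + (f2 x)%:E)%E); last first.
  move=> x _; rewrite /= ger0_norm// -EFinD /f1 /f2 !indicE in_setC.
  by case: (x \in _); rewrite /= !(mulr0, mulr1, addr0, add0r).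
rewrite ge0_integralD//; first last.
- exact/measurable_EFinP.
- by move=> x _; rewrite lee_fin.
- exact/measurable_EFinP.
- by move=> x _; rewrite lee_fin.
apply: lte_add_pinfty.
  apply: (@dyadic_lty (fun j => - j%:R) (s1 - dim) K (2 `^ (- s1))) => //.
  - exact: z01.
  - by move=> j; rewrite /= subrK mulNr -mulrN mulrC powRrM powR_mulrn// powR_ge0.
  - move=> x; have := nu0 x; rewrite le_eqVlt => /orP[/eqP nx|nx].
      by left; rewrite /f1 fz ?mul0r.
    have [n1|n1] := leP (nu x) 1; last first.
      by left; rewrite /f1 indicE memNset ?mulr0//= leNgt n1.
    right; rewrite /f1 indicE mem_set// mulr1; split.
      by apply: fnear; rewrite nx.
    have [|j /andP[j1 j2]] := @pow2_bracket (nu x)^-1; first by rewrite invf_ge1.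
    exists j; rewrite powRN powR_mulrn// -invfM -exprSr; apply/andP; split.
      by rewrite -[leRHS]invrK lef_pV2 ?posrE ?exprn_gt0 ?invr_gt0// ltW.
    by rewrite -[leLHS]invrK lef_pV2 ?posrE ?exprn_gt0 ?invr_gt0.
(* Since 2^j <= nu x < 2^(j+1), the outer radius of the j-th shell is 2^(j+1); the extra factor [z]
   is at most 1. *)
apply: (@dyadic_lty (fun j => j.+1%:R) (- s2 - dim) K (2 `^ (- s2))) => //.
- exact: z01.
- move=> j; rewrite /= subrK mulrC powRrM powR_mulrn ?powR_ge0//.
  by rewrite exprS ler_piMl ?exprn_ge0 ?powR_ge0// ltW//; case/andP: (z01 _ s20).
- move=> x; have [n1|n1] := leP (nu x) 1.
    by left; rewrite /f2 indicE memNset ?mulr0//= => /(_ n1).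
  right; rewrite /f2 indicE mem_set//=; last by apply/negP; rewrite -ltNge.
  rewrite mulr1; split; first exact: ffar.
  have [|j /andP[j1 j2]] := @pow2_bracket (nu x); first exact: ltW.
  exists j; rewrite powR_mulrn//; apply/andP; split; last exact: ltW.
  by rewrite exprSr mulfK// pnatr_eq0.
Qed.

End dyadic.

(** * The fractional kernel and the Gamma function *)

Section kernel.
Variables (R : realType) (n : nat).
Local Notation leb := (lebesgue_rV R n).
Implicit Types z : 'rV[R]_n.

Lemma lebesgue_rV_ball (r : R) : 0 <= r ->
  leb [set x | `|x| <= r] = ((2 * r) ^+ n)%:E.
Proof.
move=> r0; rewrite (_ : [set x | `|x| <= r] = [set x : 'rV[R]_n | forall i, x ord0 i \in `[- r, r]]).
  rewrite lebesgue_rV_box.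
  rewrite (eq_bigr (fun=> (2 * r)%:E)); last first.
    move=> i _; rewrite lebesgue_measure_itv/= lte_fin; case: ifPn => [_|].
      by rewrite -EFinB opprK mulr2n mulrDl mul1r.
    rewrite -leNgt => rr; have -> : r = 0 by lra.
    by rewrite mulr0.
  by rewrite prodEFin prodr_const card_ord.
apply/seteqP; split => x /= xr.
  by move=> i; rewrite in_itv/= -ler_norml (le_trans (ler_coord_norm _ _)).
apply: rV_norm_ler => // i.
by have := xr i; rewrite in_itv/= -ler_norml.
Qed.

Lemma dot_ge0 z : 0 <= dot z z.
Proof. by apply: sumr_ge0 => i _; rewrite -expr2 sqr_ge0. Qed.

Lemma norm_le_enorm z : `|z| <= enorm z.
Proof.
apply: rV_norm_ler => [|i]; first exact: sqrtr_ge0.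
rewrite -sqrtr_sqr ler_sqrt ?dot_ge0// /dot (bigD1 i)//= -expr2.
by rewrite lerDl; apply: sumr_ge0 => j _; rewrite -expr2 sqr_ge0.
Qed.

Lemma enorm_le_norm z : enorm z <= n%:R * `|z|.
Proof.
rewrite -[leRHS]ger0_norm ?mulr_ge0// -sqrtr_sqr ler_sqrt ?sqr_ge0//.
apply: (@le_trans _ _ (\sum_(i < n) `|z| ^+ 2)).
  apply: ler_sum => i _; rewrite -expr2 -[leLHS]ger0_norm ?sqr_ge0// normrX.
  by rewrite lerXn2r ?nnegrE// ler_coord_norm.
rewrite sumr_const card_ord exprMn -[leLHS]mulr_natl ler_wpM2r ?sqr_ge0//.
by rewrite -natrX ler_nat; case: (n) => // m; rewrite expnS leq_pmulr// expn_gt0.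
Qed.

Lemma measurable_enorm : measurable_fun setT (@enorm R n).
Proof.
have ms : measurable_fun [set: R] (@Num.sqrt R).
  by apply: continuous_measurable_fun => x; exact: sqrt_continuous.
suff md : measurable_fun setT (fun z : 'rV[R]_n => dot z z).
  exact: (measurableT_comp ms md).
rewrite /dot; apply: measurable_sum => i.
by apply: measurable_funM; exact: measurable_rV_coordr.
Qed.

Lemma enormN z : enorm (- z) = enorm z.
Proof. by congr Num.sqrt; apply: eq_bigr => i _; rewrite !mxE mulrNN. Qed.

Lemma enorm_flip_coord j z : enorm (flip_coord j z) = enorm z.
Proof.
by congr Num.sqrt; apply: eq_bigr => i _; rewrite !mxE; case: ifP;
  rewrite ?mulrNN.
Qed.

Variable alpha : R.
Hypothesis halpha : 0 < alpha < 1.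

Definition frac_kern (i : 'I_n) z : R := z ord0 i / enorm z `^ (n%:R + alpha + 1).

(* Majorant of [min 1 `|z| * `|frac_kern i z|]. *)
Definition kmaj z : R := Num.min 1 `|z| * `|z| `^ (- (n%:R + alpha)).

Lemma measurable_kern i : measurable_fun setT (frac_kern i).
Proof.
apply: measurable_funM; first exact: measurable_rV_coordr.
rewrite (_ : (fun x => _) = (fun x => enorm x `^ (- (n%:R + alpha + 1)))).
  by apply: (measurableT_comp (measurable_powR _)); exact: measurable_enorm.
by apply/funext => x; rewrite powRN.
Qed.

Lemma measurable_kmaj : measurable_fun setT kmaj.
Proof.
apply: measurable_funM.
  by apply: measurable_minr => //; exact: measurable_rV_norm.
by apply: (measurableT_comp (measurable_powR _)); exact: measurable_rV_norm.
Qed.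

Lemma kmaj_ge0 z : 0 <= kmaj z.
Proof. by rewrite mulr_ge0 ?powR_ge0// le_min ler01 normr_ge0. Qed.

Lemma kernN i z : frac_kern i (- z) = - frac_kern i z.
Proof. by rewrite /frac_kern enormN mxE mulNr. Qed.

Lemma kern_le_powR i z : `|frac_kern i z| <= `|z| `^ (- (n%:R + alpha)).
Proof.
have [z0|z0] := eqVneq `|z| 0.
  rewrite (_ : frac_kern i z = 0) ?normr0 ?powR_ge0//.
  by rewrite /frac_kern (normr0_eq0 z0) mxE mul0r.
have zp : 0 < `|z| by rewrite lt_neqAle eq_sym z0 normr_ge0.
have ez : 0 < enorm z := lt_le_trans zp (norm_le_enorm z).
have na : 0 <= n%:R + alpha + 1.
  by case/andP: halpha => ? ?; rewrite !addr_ge0// ltW.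
rewrite /frac_kern normrM normfV (ger0_norm (powR_ge0 _ _)).
rewrite ler_pdivrMr ?powR_gt0//.
apply: (@le_trans _ _ (`|z| `^ (- (n%:R + alpha)) * `|z| `^ (n%:R + alpha + 1))).
  rewrite -powRD ?z0 ?implybT// addKr powRr1//; exact: ler_coord_norm.
by rewrite ler_wpM2l ?powR_ge0// ge0_ler_powR ?nnegrE ?(ltW ez)// norm_le_enorm.
Qed.

Lemma kern_kmaj i z : Num.min 1 `|z| * `|frac_kern i z| <= kmaj z.
Proof. by rewrite ler_wpM2l ?kern_le_powR// le_min ler01 normr_ge0. Qed.

(** Each bound on [alpha] serves at one end: near the origin the majorant is |z|^((1 - alpha) - n),
    at infinity it is |z|^(- alpha - n). *)
Lemma integrable_kmaj : leb.-integrable setT (EFin \o kmaj).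
Proof.
case/andP: halpha => a0 a1.
apply: (@dyadic_integrable R _ _ leb (fun x => `|x|) (2 ^+ n) n%:R
  _ _ _ _ kmaj 1 (1 - alpha) alpha) => //.
- exact: measurable_rV_norm.
- move=> r r0; rewrite powR_mulrn ?(ltW r0)// -exprMn.
  by rewrite -(lebesgue_rV_ball (ltW r0)).
- by rewrite subr_gt0.
- exact: measurable_kmaj.
- exact: kmaj_ge0.
- by move=> x x0; rewrite /kmaj x0 minElt ltr10 mul0r.
- move=> x /andP[x0 x1]; rewrite mul1r /kmaj (min_idPr x1).
  rewrite -{1}(powRr1 (ltW x0)) -powRD ?(gt_eqF x0) ?implybT//.
  by rewrite opprD addrA addrAC.
- move=> x x1; rewrite mul1r /kmaj (min_idPl (ltW x1)) mul1r.
  by rewrite opprD addrC.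
Qed.

End kernel.

Section gamma.
Variable R : realType.

Lemma expR_ge_pow (m : nat) (t : R) : 0 <= t -> (t / m.+1%:R) ^+ m.+1 <= expR t.
Proof.
have tE : t = t / m.+1%:R * m.+1%:R by rewrite divfK ?pnatr_eq0.
move=> t0; rewrite [in leRHS]tE expRM_natr.
rewrite lerXn2r ?nnegrE ?expR_ge0 ?divr_ge0//.
by rewrite (le_trans _ (expR_ge1Dx _))// lerDr.
Qed.

(** A real-valued integral takes the default value 0 when the extended one is infinite, so
    convergence of the Gamma integral has to be established before it can be bounded below by its
    part over [1, 2]. *)
Lemma Gamma_gt0 (s : R) : 0 < s -> 0 < Gamma s.
Proof.
move=> s0.
pose f (t : R) := \1_(`]0, +oo[%classic : set R) t * (t `^ (s - 1) * expR (- t)).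
have mf : measurable_fun setT f.
  apply: measurable_funM; first by apply: measurable_indic; exact: measurable_itv.
  apply: measurable_funM; first exact: measurable_powR.
  by apply: (measurableT_comp (@measurable_expR R)); exact: oppr_measurable.
have f0 t : 0 <= f t by rewrite !mulr_ge0 ?powR_ge0 ?expR_ge0// indicE.
have -> : Gamma s = \int[lebesgue_measure]_t f t.
  rewrite /Gamma Rintegral_mkcond; apply: eq_Rintegral => t _.
  by rewrite /f patchE indicE; case: (_ \in _); rewrite ?mul1r ?mul0r.
(* With s + 1 <= m + 1, for t > 1 one has t^(s+1) <= t^(m+1) <= (m+1)^(m+1) e^t, so the integrand
   decays like t^(-2). *)
pose m := Num.bound (s + 1).
have sm : s + 1 <= m.+1%:R.
  have sm : s + 1 < m%:R by apply: archi_boundP; rewrite addr_ge0 ?ltW.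
  by rewrite (le_trans (ltW sm))// ler_nat.
have fi : lebesgue_measure.-integrable setT (EFin \o f).
  apply: (@dyadic_integrable R _ _ lebesgue_measure (fun t => `|t|) 2 1
     _ _ _ _ f (m.+1%:R ^+ m.+1) s 1) => //.
  - exact: normr_measurable.
  - move=> r r0.
    have lr : lebesgue_measure (`[- r, r]%classic : set R) = (2 * r)%:E.
      rewrite lebesgue_measure_itv/= lte_fin gtrN//.
      by rewrite -EFinB opprK mulr2n mulrDl mul1r.
    rewrite powRr1 ?(ltW r0)// -lr.
    rewrite (_ : [set x | `|x| <= r] = `[- r, r]%classic)//.
    by apply/seteqP; split=> x /=; rewrite in_itv/= ler_norml.
  - by move=> t /normr0_eq0 ->; rewrite /f indicE memNset ?mul0r//= in_itv/= ltxx.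
  - move=> t /andP[t0 t1]; rewrite /f indicE.
    have [tp|] := boolP (t \in _); last by rewrite mul0r mulr_ge0 ?powR_ge0.
    move: tp; rewrite inE /= in_itv/= andbT => tp; rewrite mul1r gtr0_norm//.
    rewrite mulrC ler_wpM2r ?powR_ge0//.
    rewrite (@le_trans _ _ 1)// ?exprn_ege1 ?ler1n//.
    by rewrite -expR0 ler_expR oppr_le0 ltW.
  - move=> t t1; rewrite /f indicE.
    have [tp|] := boolP (t \in _); last by rewrite mul0r mulr_ge0 ?powR_ge0.
    move: tp; rewrite inE /= in_itv/= andbT => tp; rewrite mul1r gtr0_norm//.
    rewrite gtr0_norm// in t1.
    have -> : s - 1 = - 1 - 1 + (s + 1) by lra.
    rewrite powRD; last by rewrite (gt_eqF tp) implybT.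
    rewrite -mulrA mulrC ler_wpM2r ?powR_ge0// expRN ler_pdivrMr ?expR_gt0//.
    apply: (@le_trans _ _ (t ^+ m.+1)).
      by rewrite -powR_mulrn ?(ltW tp)// ler_powR// ltW.
    have := expR_ge_pow m (ltW tp).
    by rewrite expr_div_n ler_pdivrMr ?exprn_gt0// mulrC.
(* On [1, 2], e^(-t) >= e^(-2) and t^(s-1) >= t^(-1) >= 1/2 because s > 0. *)
have f12 t : 1 <= t <= 2 -> expR (-2) / 2 <= f t.
  move=> /andP[t1 t2]; have tp : 0 < t by exact: lt_le_trans t1.
  rewrite /f indicE mem_set/= ?in_itv/= ?tp// mul1r mulrC.
  rewrite ler_pM ?expR_ge0 ?invr_ge0 ?ler_expR ?lerN2//.
  rewrite (@le_trans _ _ (t `^ (-1)))//; last by rewrite ler_powR// lerBDr addrC subrr ltW.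
  by rewrite powR_inv1 ?(ltW tp)// lef_pV2 ?posrE.
have m12 : measurable (`[1, 2]%classic : set R) by exact: measurable_itv.
have c0 : 0 < expR (-2) / 2 :> R by rewrite divr_gt0 ?expR_gt0.
pose g := fun t : R => (expR (-2) / 2 : R) * \1_(`[1, 2]%classic : set R) t.
have l12 : lebesgue_measure (`[1, 2]%classic : set R) = 1%E.
  by rewrite lebesgue_measure_itv/= lte_fin ltr1n -EFinB; congr EFin; lra.
have gE : (\int[lebesgue_measure]_t (g t)%:E = (expR (-2) / 2)%:E)%E.
  rewrite /g; under eq_integral do rewrite EFinM.
  rewrite ge0_integralZl_EFin ?(ltW c0)//.
    by rewrite integral_indic// setIT -[RHS]mule1 -l12.
  by apply/measurable_EFinP; exact: measurable_indic.
rewrite /Rintegral -lte_fin fineK; last exact: integrable_fin_num.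
apply: (@lt_le_trans _ _ (expR (-2) / 2)%:E); first by rewrite lte_fin.
rewrite -gE; apply: ge0_le_integral => //.
- by move=> t _; rewrite lee_fin mulr_ge0 ?(ltW c0)// indicE.
- apply/measurable_EFinP; apply: measurable_funM => //; exact: measurable_indic.
- exact/measurable_EFinP.
- move=> t _; rewrite lee_fin /g indicE.
  have [|_] := boolP (t \in _); last by rewrite mulr0.
  by rewrite inE /= in_itv /= mulr1 => /f12.
Qed.

End gamma.

(** * Lipschitz functions with compact support *)

Section dominated.
Context d (T : measurableType d) (R : realType) (mu : {measure set T -> \bar R}).
Implicit Types f g : T -> R.

Lemma integrable_dom f g : measurable_fun setT f ->
  mu.-integrable setT (EFin \o g) -> (forall x, `|f x| <= g x) ->
  mu.-integrable setT (EFin \o f).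
Proof.
move=> mf ig fg; apply: (le_integrable measurableT _ _ ig) => /=.
  exact/measurable_EFinP.
by move=> x _; rewrite lee_fin (le_trans (fg x))// ler_norm.
Qed.

Lemma le_Rintegral_dom f g : measurable_fun setT f ->
  mu.-integrable setT (EFin \o g) -> (forall x, `|f x| <= g x) ->
  `|\int[mu]_x f x| <= \int[mu]_x g x.
Proof.
move=> mf ig fg; have if_ := integrable_dom mf ig fg.
rewrite (le_trans (le_normr_Rintegral measurableT if_))//.
by apply: le_Rintegral => //; exact: integrable_norm.
Qed.

Lemma integrable_scale (c : R) f : mu.-integrable setT (EFin \o f) ->
  mu.-integrable setT (EFin \o (fun x => c * f x)).
Proof.
move=> if_; rewrite (_ : _ \o _ = fun x => (c%:E * (EFin \o f) x)%E).
  exact: integrableZl.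
by apply/funext => x /=; rewrite EFinM.
Qed.

Lemma integrable_add f g : mu.-integrable setT (EFin \o f) ->
  mu.-integrable setT (EFin \o g) ->
  mu.-integrable setT (EFin \o (fun x => f x + g x)).
Proof.
move=> if_ ig; rewrite (_ : _ \o _ = ((EFin \o f) \+ (EFin \o g))%E).
  exact: integrableD.
by apply/funext => x /=; rewrite EFinD.
Qed.

Lemma integrable_sub f g : mu.-integrable setT (EFin \o f) ->
  mu.-integrable setT (EFin \o g) ->
  mu.-integrable setT (EFin \o (fun x => f x - g x)).
Proof.
move=> if_ ig; rewrite (_ : _ \o _ = ((EFin \o f) \- (EFin \o g))%E).
  exact: integrableB.
by apply/funext => x /=; rewrite EFinB.
Qed.

Lemma integrable_big_sum (I : Type) (s : seq I) (f : I -> T -> R) :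
  (forall i, mu.-integrable setT (EFin \o f i)) ->
  mu.-integrable setT (EFin \o (fun x => \sum_(i <- s) f i x)).
Proof.
move=> if_; elim: s => [|i s IH].
  rewrite (_ : _ \o _ = cst 0%E); first exact: integrable0.
  by apply/funext => x /=; rewrite big_nil.
rewrite (_ : _ \o _ = EFin \o (fun x => f i x + \sum_(i <- s) f i x)).
  exact: integrable_add.
by apply/funext => x /=; rewrite big_cons.
Qed.

Lemma Rintegral_big_sum (I : Type) (s : seq I) (f : I -> T -> R) :
  (forall i, mu.-integrable setT (EFin \o f i)) ->
  \int[mu]_x (\sum_(i <- s) f i x) = \sum_(i <- s) \int[mu]_x f i x.
Proof.
move=> if_; elim: s => [|i s IH].
  rewrite big_nil; under eq_Rintegral do rewrite big_nil.
  by rewrite /Rintegral integral0.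
rewrite big_cons -IH -RintegralD//; last exact: integrable_big_sum.
by apply: eq_Rintegral => x _; rewrite big_cons.
Qed.

End dominated.

Section trigo_lipschitz.
Variable R : realType.

Lemma lipschitz_of_derive (f df : R -> R) (M : R) :
  (forall x : R, is_derive x (1 : R) f (df x)) -> (forall x, `|df x| <= M) ->
  forall a b, `|f a - f b| <= M * `|a - b|.
Proof.
move=> fd dfM; have fd' a b : a <= b -> `|f b - f a| <= M * (b - a).
  rewrite le_eqVlt => /orP[/eqP->|ab]; first by rewrite !subrr normr0 mulr0.
  have [|c _ ->] := MVT ab (fun x _ => fd x).
    apply: derivable_within_continuous => x _; exact: (@ex_derive _ _ _ _ _ _ _ (fd x)).
  by rewrite normrM (gtr0_norm (_ : 0 < b - a)) ?subr_gt0// ler_wpM2r ?dfM ?subr_ge0 ?ltW.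
move=> a b; have [ab|ba] := leP a b; last by rewrite (ger0_norm (_ : 0 <= a - b)) ?subr_ge0 ?fd' ?ltW.
by rewrite distrC (distrC a) (ger0_norm (_ : 0 <= b - a)) ?subr_ge0 ?fd'.
Qed.

Lemma sin_lipschitz (a b : R) : `|sin a - sin b| <= `|a - b|.
Proof.
rewrite -[leRHS]mul1r; apply: (lipschitz_of_derive (f := @sin R) (df := @cos R)) => x.
by rewrite ler_norml cos_geN1 cos_le1.
Qed.

Lemma cos_lipschitz (a b : R) : `|cos a - cos b| <= `|a - b|.
Proof.
rewrite -[leRHS]mul1r.
apply: (lipschitz_of_derive (f := @cos R) (df := fun x => - sin x)) => x.
by rewrite normrN ler_norml sin_geN1 sin_le1.
Qed.

End trigo_lipschitz.

Section lipschitz.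
Variables (R : realType) (n : nat).
Local Notation leb := (lebesgue_rV R n).
Implicit Types (x z : 'rV[R]_n) (f g : 'rV[R]_n -> R).

(** Boundedness is included because it makes the class stable under products. *)
Definition BLip f := exists L B, [/\ 0 <= L, 0 <= B,
  forall x y, `|f x - f y| <= L * `|x - y| & forall x, `|f x| <= B].

Definition csupp f := exists2 r, 0 <= r & forall x, r < `|x| -> f x = 0.

Definition LipC f := BLip f /\ csupp f.

Lemma BLipM f g : BLip f -> BLip g -> BLip (fun x => f x * g x).
Proof.
move=> [L [B [L0 B0 fL fB]]] [L' [B' [L'0 B'0 gL gB]]].
exists (B * L' + B' * L), (B * B'); split; rewrite ?addr_ge0 ?mulr_ge0//.
  move=> x y; rewrite (_ : _ - _ = f x * (g x - g y) + g y * (f x - f y)); last lra.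
  rewrite (le_trans (ler_normD _ _))// !normrM mulrDl -!mulrA.
  by rewrite lerD// ler_pM.
by move=> x; rewrite normrM ler_pM.
Qed.

Lemma BLipD f g : BLip f -> BLip g -> BLip (fun x => f x + g x).
Proof.
move=> [L [B [L0 B0 fL fB]]] [L' [B' [L'0 B'0 gL gB]]].
exists (L + L'), (B + B'); split; rewrite ?addr_ge0//.
  move=> x y; rewrite (_ : _ - _ = (f x - f y) + (g x - g y)); last lra.
  by rewrite (le_trans (ler_normD _ _))// mulrDl lerD.
by move=> x; rewrite (le_trans (ler_normD _ _))// lerD.
Qed.

Lemma BLip_cst (c : R) : BLip (fun=> c).
Proof.
by exists 0, `|c|; split => // x y; rewrite subrr normr0 mul0r.
Qed.

Lemma BLip_comp_coord (h : R -> R) (N : R) i :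
  (forall a b, `|h a - h b| <= `|a - b|) -> (forall a, `|h a| <= 1) ->
  BLip (fun x => h (N * x ord0 i)).
Proof.
move=> hL h1; exists `|N|, 1; split => // x y.
rewrite (le_trans (hL _ _))// -mulrBr normrM ler_wpM2l//.
by have := ler_coord_norm (x - y) i; rewrite !mxE.
Qed.

Lemma BLip_sin (N : R) i : BLip (fun x => sin (N * x ord0 i)).
Proof.
apply: BLip_comp_coord; first exact: sin_lipschitz.
by move=> a; rewrite ler_norml sin_geN1 sin_le1.
Qed.

Lemma BLip_cos (N : R) i : BLip (fun x => cos (N * x ord0 i)).
Proof.
apply: BLip_comp_coord; first exact: cos_lipschitz.
by move=> a; rewrite ler_norml cos_geN1 cos_le1.
Qed.

Lemma BLip_continuous f : BLip f -> continuous f.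
Proof.
move=> [L [B [L0 _ fL _]]] x; apply/(@cvgrPdist_le _ _ _ (nbhs x)) => e e0.
apply/nbhs_ballP; exists (e / (L + 1)) => /=.
  by rewrite divr_gt0// ltr_wpDl.
move=> y; rewrite mx_norm_ball /ball_/= => /ltW xy.
rewrite (le_trans (fL _ _))//; move: xy.
rewrite ler_pdivlMr ?ltr_wpDl// => /(le_trans _); apply.
by rewrite mulrC ler_wpM2l// lerDl.
Qed.

Lemma BLip_measurable f : BLip f -> measurable_fun setT f.
Proof. by move=> /BLip_continuous; exact: continuous_measurable_rV. Qed.

Lemma csuppMl f g : csupp f -> csupp (fun x => f x * g x).
Proof. by move=> [r r0 fr]; exists r => // x /fr ->; rewrite mul0r. Qed.

Lemma csuppMr f g : csupp g -> csupp (fun x => f x * g x).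
Proof. by move=> [r r0 fr]; exists r => // x /fr ->; rewrite mulr0. Qed.

Lemma LipCMl f g : LipC f -> BLip g -> LipC (fun x => f x * g x).
Proof. by move=> [fL fc] gL; split; [exact: BLipM|exact: csuppMl]. Qed.

Lemma LipCMr f g : BLip f -> LipC g -> LipC (fun x => f x * g x).
Proof. by move=> fL [gL gc]; split; [exact: BLipM|exact: csuppMr]. Qed.

Lemma LipC_measurable f : LipC f -> measurable_fun setT f.
Proof. by case=> /BLip_measurable. Qed.

Definition ind_ball (r : R) x : R := (if `|x| <= r then 1 else 0).

Lemma ind_ball_ge0 r x : 0 <= ind_ball r x.
Proof. by rewrite /ind_ball; case: ifP. Qed.

Lemma ind_ball_le1 r x : ind_ball r x <= 1.
Proof. by rewrite /ind_ball; case: ifP; rewrite ?ler01. Qed.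

Lemma measurable_normball r : measurable [set x : 'rV[R]_n | `|x| <= r].
Proof.
rewrite (_ : [set x : 'rV[R]_n | `|x| <= r] =
    (fun x : 'rV[R]_n => `|x|) @^-1` `]-oo, r]%classic).
  rewrite -[X in measurable X]setTI.
  exact: (measurable_rV_norm measurableT (measurable_itv _)).
by apply/seteqP; split => x /=; rewrite in_itv.
Qed.

Lemma ind_ballE r : ind_ball r = \1_[set x : 'rV[R]_n | `|x| <= r].
Proof.
apply/funext => x; rewrite indicE /ind_ball; case: ifPn => xr.
  by rewrite mem_set.
by rewrite memNset//; exact/negP.
Qed.

Lemma measurable_ind_ball r : measurable_fun setT (ind_ball r).
Proof. by rewrite ind_ballE; apply: measurable_indic; exact: measurable_normball. Qed.

Lemma integral_ind_ball r : 0 <= r ->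
  (\int[leb]_x (ind_ball r x)%:E = ((2 * r) ^+ n)%:E)%E.
Proof.
move=> r0; have mB := @measurable_normball r.
by rewrite ind_ballE integral_indic// setIT; exact: lebesgue_rV_ball.
Qed.

Lemma integrable_ind_ball r : 0 <= r ->
  leb.-integrable setT (EFin \o ind_ball r).
Proof.
move=> r0; apply/integrableP; split.
  apply/measurable_EFinP; exact: measurable_ind_ball.
rewrite (eq_integral (fun x => (ind_ball r x)%:E)).
  by rewrite integral_ind_ball// ltry.
by move=> x _; rewrite /= ger0_norm// ind_ball_ge0.
Qed.

Lemma csupp_integrable f B : measurable_fun setT f ->
  (forall x, `|f x| <= B) -> csupp f -> leb.-integrable setT (EFin \o f).
Proof.
move=> mf fB [r r0 fr].
apply: (integrable_dom mf (integrable_scale B (integrable_ind_ball r0))) => x.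
rewrite /ind_ball; have [xr|xr] := leP `|x| r; first by rewrite mulr1.
by rewrite fr// normr0 mulr0.
Qed.

Lemma LipC_integrable f : LipC f -> leb.-integrable setT (EFin \o f).
Proof.
move=> [fL fc]; have mf := BLip_measurable fL.
by case: fL => L [B [_ _ _ fB]]; exact: (csupp_integrable mf fB).
Qed.

(** The Lipschitz bound gives the factor |z|, the uniform bound gives the factor 1, and the
    increment vanishes unless [x] or [x + z] lies in the support. Multiplied by the kernel, the
    right-hand side becomes integrable in (x, z) jointly. *)
Lemma LipC_diff f : LipC f -> exists C r, [/\ 0 <= C, 0 <= r &
  forall x z, `|f (x + z) - f x| <=
    C * Num.min 1 `|z| * (ind_ball r x + ind_ball r (x + z))].
Proof.
move=> [[L [B [L0 B0 fL fB]]] [r r0 fr]].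
exists (L + B *+ 2), r; split => //; first by rewrite addr_ge0// mulrn_wge0.
move=> x z; have C0 : 0 <= (L + B *+ 2) * Num.min 1 `|z|.
  by rewrite mulr_ge0 ?addr_ge0 ?mulrn_wge0// le_min ler01 normr_ge0.
have fC : `|f (x + z) - f x| <= (L + B *+ 2) * Num.min 1 `|z|.
  have [z1|z1] := leP `|z| 1.
    rewrite (le_trans (fL _ _))// addrC addKr ler_wpM2r// lerDl mulrn_wge0//.
  rewrite mulr1 (le_trans (ler_normB _ _))// (le_trans (lerD (fB _) (fB _)))//.
  by rewrite -mulr2n lerDr.
rewrite /ind_ball.
have [xr|xr] := leP `|x| r; first by rewrite (le_trans fC)// ler_peMr// lerDl; case: ifP.
have [xzr|xzr] := leP `|x + z| r; first by rewrite (le_trans fC)// ler_peMr// lerDr.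
by rewrite !fr// subrr normr0 addr0 mulr0.
Qed.

Lemma measurable_shift (v : 'rV[R]_n) : measurable_fun setT (fun x : 'rV[R]_n => x + v).
Proof.
rewrite (_ : (fun x => x + v) = rV_map (fun i t => t + v ord0 i)).
  by apply: measurable_rV_map => i; exact: measurable_funD.
by apply/funext => x; apply/rowP => i; rewrite !mxE.
Qed.

Lemma measurable_add2 :
  measurable_fun setT (fun p : 'rV[R]_n * 'rV[R]_n => p.1 + p.2).
Proof.
apply: measurable_fun_rVP => i.
rewrite (_ : _ \o _ = fun p : 'rV[R]_n * 'rV[R]_n => p.1 ord0 i + p.2 ord0 i).
  apply: measurable_funD.
    exact: (measurableT_comp (@measurable_rV_coordr R n i) measurable_fst).
  exact: (measurableT_comp (@measurable_rV_coordr R n i) measurable_snd).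
by apply/funext => p; rewrite /rV_coord/= mxE.
Qed.

End lipschitz.

(** * Fubini and integration by parts for the fractional operator *)

Section Rfubini.
Context d1 d2 (T1 : measurableType d1) (T2 : measurableType d2) (R : realType).
Variable m1 : {sigma_finite_measure set T1 -> \bar R}.
Variable m2 : {sigma_finite_measure set T2 -> \bar R}.
Variable G : T1 * T2 -> R.
Hypothesis iG : (m1 \x m2)%E.-integrable setT (EFin \o G).
Hypothesis iG1 : forall x, m2.-integrable setT (EFin \o (fun y => G (x, y))).
Hypothesis iG2 : forall y, m1.-integrable setT (EFin \o (fun x => G (x, y))).

(** Because the sections are integrable for every point, and not only almost everywhere, the partial
    integrals are finite everywhere and the real-valued and extended-valued iterated integrals can
    be exchanged freely. *)
Let fubini_FE : fubini_F m2 (EFin \o G) = EFin \o (fun x => \int[m2]_y G (x, y)).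
Proof.
apply/funext => x; rewrite /= /Rintegral fineK//.
exact: (integrable_fin_num _ (iG1 x)).
Qed.

Let fubini_GE : fubini_G m1 (EFin \o G) = EFin \o (fun y => \int[m1]_x G (x, y)).
Proof.
apply/funext => y; rewrite /= /Rintegral fineK//.
exact: (integrable_fin_num _ (iG2 y)).
Qed.

Lemma Rfubini_integrable : m1.-integrable setT (EFin \o (fun x => \int[m2]_y G (x, y))).
Proof. by rewrite -fubini_FE; exact: integrable_fubini_F. Qed.

Lemma Rfubini_integrable2 :
  m2.-integrable setT (EFin \o (fun y => \int[m1]_x G (x, y))).
Proof.
have mG : measurable_fun setT (EFin \o G) by case/integrableP: iG.
rewrite -fubini_GE; apply/integrableP; split; first exact: (measurable_fubini_G iG).
have /integrable21ltyP := iG => /(_ mG); apply: le_lt_trans.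
apply: ge0_le_integral => //.
- by apply: measurableT_comp => //; exact: (measurable_fubini_G iG).
- apply: (measurable_fun_fubini_tonelli_G (abse \o (EFin \o G))) => [|p].
    exact: measurableT_comp.
  exact: abse_ge0.
- move=> y _; apply: le_abse_integral => //.
  by apply: (measurable_int m1); exact: iG2.
Qed.

Lemma Rfubini : \int[m1]_x \int[m2]_y G (x, y) = \int[m2]_y \int[m1]_x G (x, y).
Proof.
rewrite /Rintegral; congr fine.
have := Fubini iG; rewrite -/(fubini_F m2 (EFin \o G)).
transitivity (\int[m1]_x fubini_F m2 (EFin \o G) x)%E.
  by rewrite fubini_FE.
rewrite [LHS](Fubini iG).
by rewrite -/(fubini_G m1 (EFin \o G)) fubini_GE.
Qed.

End Rfubini.

Section fractional_operator.
Variables (R : realType) (n : nat) (alpha : R).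
Hypothesis halpha : 0 < alpha < 1.
Local Notation leb := (lebesgue_rV R n).
Local Notation V := ('rV[R]_n).
Local Notation km := (@kmaj R n alpha).
Local Notation kern := (frac_kern alpha).
Local Notation ib := (@ind_ball R n).
Implicit Types (x z : V) (f g : V -> R).

Definition kmass : R := \int[leb]_z km z.

Let kdom (C r : R) (p : V * V) : R := C * km p.2 * (ib r p.1 + ib r (p.1 + p.2)).

Let kdom_ge0 C r p : 0 <= C -> 0 <= kdom C r p.
Proof.
by move=> C0; rewrite !mulr_ge0 ?kmaj_ge0// addr_ge0 ?ind_ball_ge0.
Qed.

Let measurable_kdom C r : measurable_fun setT (kdom C r).
Proof.
apply: measurable_funM.
  apply: measurable_funM => //.
  exact: (measurableT_comp (@measurable_kmaj R n alpha) measurable_snd).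
apply: measurable_funD.
  exact: (measurableT_comp (@measurable_ind_ball R n r) measurable_fst).
exact: (measurableT_comp (@measurable_ind_ball R n r) (@measurable_add2 R n)).
Qed.

Let kdom_int1 C r x : 0 <= C ->
  leb.-integrable setT (EFin \o (fun z => kdom C r (x, z))).
Proof.
move=> C0; apply: (integrable_dom _
  (integrable_scale (2 * C) (integrable_kmaj n halpha))).
  exact: (measurableT_comp (measurable_kdom C r) (pair1_measurable x)).
move=> z; rewrite ger0_norm ?kdom_ge0// /kdom/= -(mulrA 2) (mulrC 2).
rewrite ler_wpM2l ?mulr_ge0 ?kmaj_ge0//.
by rewrite [leRHS](_ : 2 = 1 + 1)// lerD ?ind_ball_le1.
Qed.

Let kdom_int2 C r z : 0 <= C -> 0 <= r ->
  leb.-integrable setT (EFin \o (fun x => kdom C r (x, z))).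
Proof.
move=> C0 r0; have ii := @integrable_ind_ball R n _ r0.
exact: (integrable_scale (C * km z) (integrable_add ii (integrable_shift z ii))).
Qed.

Let kdom_intE C r z : 0 <= C -> 0 <= r ->
  \int[leb]_x kdom C r (x, z) = 2 * (2 * r) ^+ n * C * km z.
Proof.
move=> C0 r0; rewrite /kdom/=.
have ii := @integrable_ind_ball R n _ r0.
have iis := integrable_shift z ii.
rewrite RintegralZl//; last exact: integrable_add.
rewrite RintegralD// (Rintegral_shift z (@measurable_ind_ball R n r)).
by rewrite /Rintegral integral_ind_ball//=; lra.
Qed.

Let kdom_int C r : 0 <= C -> 0 <= r ->
  (leb \x leb)%E.-integrable setT (EFin \o kdom C r).
Proof.
move=> C0 r0; apply/integrable21ltyP; first exact/measurable_EFinP.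
rewrite (eq_integral (fun z => (2 * (2 * r) ^+ n * C * km z)%:E)).
  have /integrableP[_] := integrable_scale (2 * (2 * r) ^+ n * C) (integrable_kmaj n halpha).
  apply: le_lt_trans; apply: ge0_le_integral => //.
  - move=> z _; rewrite lee_fin !mulr_ge0 ?exprn_ge0 ?mulr_ge0 ?kmaj_ge0//.
  - apply/measurable_EFinP; apply: measurable_funM => //; exact: measurable_kmaj.
  - apply: measurableT_comp => //.
    apply/measurable_EFinP; apply: measurable_funM => //; exact: measurable_kmaj.
  - by move=> z _; rewrite /= lee_fin ler_norm.
move=> z _; rewrite -kdom_intE// /Rintegral fineK; last first.
  exact: (integrable_fin_num _ (kdom_int2 z C0 r0)).
by apply: eq_integral => x _; rewrite /= ger0_norm// kdom_ge0.
Qed.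

(** Integrating the majorant first in [x] leaves a multiple of [kmaj], which is integrable in [z].
    The last bound depends on [G] only through [C] and [r]; this is the source of the estimates
    uniform in the frequency. *)
Lemma kern_fubini (G : V * V -> R) C r : 0 <= C -> 0 <= r ->
  measurable_fun setT G ->
  (forall x z, `|G (x, z)| <= C * km z * (ib r x + ib r (x + z))) ->
  [/\ forall x, leb.-integrable setT (EFin \o (fun z => G (x, z))),
      leb.-integrable setT (EFin \o (fun x => \int[leb]_z G (x, z))),
      leb.-integrable setT (EFin \o (fun z => \int[leb]_x G (x, z))),
      \int[leb]_x \int[leb]_z G (x, z) = \int[leb]_z \int[leb]_x G (x, z) &
      \int[leb]_x `|\int[leb]_z G (x, z)| <= 2 * (2 * r) ^+ n * C * kmass].
Proof.
move=> C0 r0 mG GC.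
have iG1 x : leb.-integrable setT (EFin \o (fun z => G (x, z))).
  apply: (integrable_dom _ (kdom_int1 r x C0)) => [|z]; last exact: GC.
  exact: (measurableT_comp mG (pair1_measurable x)).
have iG2 z : leb.-integrable setT (EFin \o (fun x => G (x, z))).
  apply: (integrable_dom _ (kdom_int2 z C0 r0)) => [|x]; last exact: GC.
  exact: (measurableT_comp mG (pair2_measurable z)).
have iG : (leb \x leb)%E.-integrable setT (EFin \o G).
  by apply: (integrable_dom mG (kdom_int C0 r0)) => -[x z]; exact: GC.
have iF := Rfubini_integrable iG iG1.
split => //; [exact: Rfubini_integrable2|exact: Rfubini|].
have kd1 x := kdom_int1 r x C0.
have kd2 z := kdom_int2 z C0 r0.
rewrite /kmass -RintegralZl//; last exact: integrable_kmaj.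
have <- : \int[leb]_z \int[leb]_x kdom C r (x, z) =
    \int[leb]_z (2 * (2 * r) ^+ n * C * km z).
  by apply: eq_Rintegral => z _; exact: kdom_intE.
rewrite -(Rfubini (kdom_int C0 r0))//.
apply: le_Rintegral => //.
- exact: integrable_norm.
- exact: Rfubini_integrable (kdom_int C0 r0) _.
- move=> x _; apply: le_Rintegral_dom => [|//|z]; last exact: GC.
  exact: (measurableT_comp mG (pair1_measurable x)).
Qed.

End fractional_operator.

Section fractional_operator2.
Variables (R : realType) (n : nat) (alpha : R).
Hypothesis halpha : 0 < alpha < 1.
Local Notation leb := (lebesgue_rV R n).
Local Notation V := ('rV[R]_n).
Local Notation km := (@kmaj R n alpha).
Local Notation kern := (frac_kern alpha).
Local Notation ib := (@ind_ball R n).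
Implicit Types (x z : V) (f g : V -> R) (i : 'I_n).

Definition frac_partial i f x : R := \int[leb]_z (kern i z * (f (x + z) - f x)).

Lemma kern_diff f i : LipC f -> exists C r, [/\ 0 <= C, 0 <= r &
  forall x z, `|kern i z * (f (x + z) - f x)| <=
    C * km z * (ib r x + ib r (x + z))].
Proof.
move=> /LipC_diff[C [r [C0 r0 fC]]]; exists C, r; split => // x z.
rewrite normrM (le_trans (ler_wpM2l (normr_ge0 _) (fC x z)))//.
rewrite mulrA ler_wpM2r ?addr_ge0 ?ind_ball_ge0// mulrCA ler_wpM2l// mulrC.
exact: kern_kmaj.
Qed.

Lemma measurable_kern_snd i :
  measurable_fun setT (fun p : V * V => kern i p.2).
Proof. exact: (measurableT_comp (@measurable_kern R n alpha i) measurable_snd). Qed.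

Lemma measurable_fst_of f : measurable_fun setT f ->
  measurable_fun setT (fun p : V * V => f p.1).
Proof. by move=> mf; exact: (measurableT_comp mf measurable_fst). Qed.

Lemma measurable_add_of f : measurable_fun setT f ->
  measurable_fun setT (fun p : V * V => f (p.1 + p.2)).
Proof. by move=> mf; exact: (measurableT_comp mf (@measurable_add2 R n)). Qed.

Lemma measurable_shift_of f (v : V) : measurable_fun setT f ->
  measurable_fun setT (fun x => f (x + v)).
Proof. by move=> mf; exact: (measurableT_comp mf (@measurable_shift R n v)). Qed.

Lemma measurable_kern_diff f i : measurable_fun setT f ->
  measurable_fun setT (fun p : V * V => kern i p.2 * (f (p.1 + p.2) - f p.1)).
Proof.
move=> mf; apply: measurable_funM; first exact: measurable_kern_snd.
by apply: measurable_funB; [exact: measurable_add_of|exact: measurable_fst_of].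
Qed.

Lemma frac_partial_integrand_integrable i f x : LipC f ->
  leb.-integrable setT (EFin \o (fun z => kern i z * (f (x + z) - f x))).
Proof.
move=> fl; have [C [r [C0 r0 fC]]] := kern_diff i fl.
have mG := measurable_kern_diff i (LipC_measurable fl).
have [iD _ _ _ _] := kern_fubini halpha C0 r0 mG fC; exact: iD.
Qed.

Lemma frac_partial_integrable i f : LipC f -> leb.-integrable setT (EFin \o frac_partial i f).
Proof.
move=> fl; have [C [r [C0 r0 fC]]] := kern_diff i fl.
have mG := measurable_kern_diff i (LipC_measurable fl).
by have [_ iD _ _ _] := kern_fubini halpha C0 r0 mG fC.
Qed.

Lemma bounded_integrableM f g B : measurable_fun setT f ->
  (forall x, `|f x| <= B) -> leb.-integrable setT (EFin \o g) ->
  leb.-integrable setT (EFin \o (fun x => f x * g x)).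
Proof.
move=> mf fB ig; have /integrable_norm ing := ig.
apply: (integrable_dom _ (integrable_scale B ing)).
  by apply: measurable_funM => //; apply/measurable_EFinP; case/integrableP: ig.
by move=> x; rewrite normrM ler_wpM2r.
Qed.

(** Fubini moves the kernel outside the integral in [x], where only the correlation of [f] with the
    increments of [g] remains. *)
Let half_by_parts i f g : LipC f -> LipC g ->
  leb.-integrable setT (EFin \o (fun z => kern i z *
    \int[leb]_x (f x * (g (x + z) - g x)))) /\
  \int[leb]_x (f x * frac_partial i g x) =
  \int[leb]_z (kern i z * \int[leb]_x (f x * (g (x + z) - g x))).
Proof.
move=> fl gl; have [C [r [C0 r0 gC]]] := kern_diff i gl.
have mf := LipC_measurable fl; have mg := LipC_measurable gl.
have [_ [B [_ B0 _ fB]]] := fl.1.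
pose G (p : V * V) := f p.1 * (kern i p.2 * (g (p.1 + p.2) - g p.1)).
have mG : measurable_fun setT G.
  by apply: measurable_funM; [exact: measurable_fst_of|exact: measurable_kern_diff].
have GC x z : `|G (x, z)| <= (B * C) * km z * (ib r x + ib r (x + z)).
  by rewrite normrM -!(mulrA B) ler_pM//=; exact: gC.
have [iG1 iGx iGz GE _] := kern_fubini halpha (mulr_ge0 B0 C0) r0 mG GC.
have inner1 x : \int[leb]_z G (x, z) = f x * frac_partial i g x.
  by rewrite /G/= RintegralZl//; exact: frac_partial_integrand_integrable.
have inner2 z : \int[leb]_x G (x, z) =
    kern i z * \int[leb]_x (f x * (g (x + z) - g x)).
  rewrite -RintegralZl//.
    by apply: eq_Rintegral => x _; rewrite /G/= mulrCA.
  apply: (bounded_integrableM mf fB).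
  have ig := LipC_integrable gl.
  exact: (integrable_sub (integrable_shift z ig) ig).
split.
  rewrite (_ : (fun z => _) = (fun z => \int[leb]_x G (x, z)))//.
  by apply/funext => z; rewrite inner2.
transitivity (\int[leb]_x \int[leb]_z G (x, z)).
  by apply: eq_Rintegral => x _; rewrite inner1.
by rewrite GE; apply: eq_Rintegral => z _; exact: inner2.
Qed.

(* After Fubini the sum of the two sides is the integral of the odd function
   [kern i] against an even one. *)
Lemma frac_partial_by_parts i f g : LipC f -> LipC g ->
  \int[leb]_x (f x * frac_partial i g x) = - \int[leb]_x (g x * frac_partial i f x).
Proof.
move=> fl gl.
have [i1 ->] := half_by_parts i fl gl; have [i2 ->] := half_by_parts i gl fl.
have mf := LipC_measurable fl; have mg := LipC_measurable gl.
have [_ [Bf [_ Bf0 _ fB]]] := fl.1; have [_ [Bg [_ Bg0 _ gB]]] := gl.1.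
pose a z := \int[leb]_x (f x * g (x + z)).
pose b := \int[leb]_x (f x * g x).
have ig := LipC_integrable gl; have if_ := LipC_integrable fl.
have ifg z : leb.-integrable setT (EFin \o (fun x => f x * g (x + z))).
  by apply: (bounded_integrableM mf fB); exact: integrable_shift.
have igf z : leb.-integrable setT (EFin \o (fun x => g x * f (x + z))).
  by apply: (bounded_integrableM mg gB); exact: integrable_shift.
have ifg0 : leb.-integrable setT (EFin \o (fun x => f x * g x)).
  exact: (bounded_integrableM mf fB).
have aN z : \int[leb]_x (g x * f (x + z)) = a (- z).
  rewrite /a -(@Rintegral_shift R n (fun x => f x * g (x - z)) z).
    by apply: eq_Rintegral => x _; rewrite addrK mulrC.
  by apply: measurable_funM => //; exact: measurable_shift_of.
have c1 z : \int[leb]_x (f x * (g (x + z) - g x)) = a z - b.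
  rewrite -RintegralB//; apply: eq_Rintegral => x _; by rewrite mulrBr.
have c2 z : \int[leb]_x (g x * (f (x + z) - f x)) = a (- z) - b.
  rewrite -aN -RintegralB//; apply: eq_Rintegral => x _; by rewrite mulrBr (mulrC (g x) (f x)).
apply/eqP; rewrite -addr_eq0 -RintegralD//; apply/eqP.
pose h z := kern i z * (a z + a (- z) - b *+ 2).
rewrite (_ : Rintegral _ _ _ = \int[leb]_z h z); last first.
  by apply: eq_Rintegral => z _; rewrite c1 c2 -mulrDr /h mulr2n opprD addrACA.
have mh : measurable_fun setT h.
  have := measurable_int _ (integrable_add i1 i2) => /measurable_EFinP.
  apply: eq_measurable_fun => z _.
  by rewrite /= c1 c2 -mulrDr /h mulr2n opprD addrACA.
have : \int[leb]_z h z = - \int[leb]_z h z.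
  rewrite -{1}(Rintegral_oppv mh) -mulN1r -RintegralZl//.
    by apply: eq_Rintegral => z _; rewrite /h kernN opprK mulN1r mulNr (addrC (a _)).
  have := integrable_add i1 i2; apply: eq_integrable => // z _.
  by rewrite /= c1 c2 -mulrDr /h mulr2n opprD addrACA.
lra.
Qed.

End fractional_operator2.

(** * Action on fast oscillations *)

Section oscillation.
Variables (R : realType) (n : nat) (alpha : R).
Hypothesis halpha : 0 < alpha < 1.
Local Notation leb := (lebesgue_rV R n).
Local Notation V := ('rV[R]_n).
Local Notation km := (@kmaj R n alpha).
Local Notation kern := (frac_kern alpha).
Local Notation ib := (@ind_ball R n).
Local Notation Dk := (frac_partial alpha).
Variable e : 'I_n.
Implicit Types (x z : V) (f g v : V -> R) (i : 'I_n).

(** For [i = e] this is the factor gamma(N) of the overview: [e] is the direction of oscillation,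
    [i] that of the kernel. *)
Definition sine_moment i (N : R) : R := \int[leb]_z (kern i z * sin (N * z ord0 e)).

(** The bound 2 on [h] accommodates both sin and cos - 1. As [h] vanishes at 0, it compensates the
    singularity of the kernel at the origin. *)
Lemma kern_lip_integrable i (h : R -> R) (N : R) : h 0 = 0 ->
  (forall a b, `|h a - h b| <= `|a - b|) -> (forall a, `|h a| <= 2) ->
  measurable_fun setT h ->
  leb.-integrable setT (EFin \o (fun z => kern i z * h (N * z ord0 e))).
Proof.
move=> h0 hL h2 mh.
apply: (integrable_dom _
  (integrable_scale (2 + `|N|) (integrable_kmaj n halpha))).
  apply: measurable_funM; first exact: measurable_kern.
  apply: (measurableT_comp mh).
  by apply: measurable_funM => //; exact: measurable_rV_coordr.
move=> z; rewrite normrM.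
have hz : `|h (N * z ord0 e)| <= (2 + `|N|) * Num.min 1 `|z|.
  have [z1|z1] := leP `|z| 1; last by rewrite mulr1 (le_trans (h2 _))// lerDl.
  rewrite -[h _]subr0 -h0 (le_trans (hL _ _))// subr0 normrM.
  by rewrite ler_pM ?ler_coord_norm// lerDr.
rewrite (le_trans (ler_wpM2l (normr_ge0 _) hz))// mulrCA ler_wpM2l// mulrC.
exact: kern_kmaj.
Qed.

Lemma measurable_sinR : measurable_fun setT (@sin R).
Proof. by apply: continuous_measurable_fun => x; exact: continuous_sin. Qed.

Lemma measurable_cosR : measurable_fun setT (@cos R).
Proof. by apply: continuous_measurable_fun => x; exact: continuous_cos. Qed.

Lemma kern_sin_integrable i N :
  leb.-integrable setT (EFin \o (fun z => kern i z * sin (N * z ord0 e))).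
Proof.
apply: (@kern_lip_integrable i (@sin R)); [exact: sin0|exact: sin_lipschitz| |].
  by move=> a; rewrite (le_trans (sin_max a))// ler1n.
exact: measurable_sinR.
Qed.

Lemma kern_cos_integrable i N :
  leb.-integrable setT (EFin \o (fun z => kern i z * (cos (N * z ord0 e) - 1))).
Proof.
apply: (@kern_lip_integrable i (fun t => cos t - 1)).
- by rewrite cos0 subrr.
- by move=> a b; rewrite opprB addrA subrK cos_lipschitz.
- move=> a; rewrite (le_trans (ler_normB _ _))// normr1.
  by rewrite [leRHS](_ : 2 = 1 + 1)// lerD// cos_max.
- by apply: measurable_funB => //; exact: measurable_cosR.
Qed.

(** Reversing the sign of the coordinate [i] changes the sign of the kernel but leaves the
    coordinate [e], hence the sine, alone. *)
Lemma sine_moment_neq i N : i != e -> sine_moment i N = 0.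
Proof.
move=> ie; have mh := measurable_int _ (kern_sin_integrable i N).
have {}mh : measurable_fun setT (fun z => kern i z * sin (N * z ord0 e)).
  exact/measurable_EFinP.
have : sine_moment i N = - sine_moment i N.
  rewrite {1}/sine_moment -{1}(Rintegral_flip i mh) -mulN1r -RintegralZl//.
    apply: eq_Rintegral => z _; rewrite mulN1r -mulNr; congr (_ * sin (_ * _)).
      by rewrite /frac_kern enorm_flip_coord mxE eqxx mulNr.
    by rewrite mxE eq_sym (negbTE ie).
  exact: kern_sin_integrable.
lra.
Qed.

Lemma kern_cos_eq0 i N :
  \int[leb]_z (kern i z * (cos (N * z ord0 e) - 1)) = 0.
Proof.
have ic := kern_cos_integrable i N.
have mh : measurable_fun setT (fun z => kern i z * (cos (N * z ord0 e) - 1)).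
  by apply/measurable_EFinP; exact: (measurable_int _ ic).
set I := (LHS); have : I = - I.
  rewrite {1}/I -(Rintegral_oppv mh) -[- I]mulN1r /I -RintegralZl//.
  by apply: eq_Rintegral => z _; rewrite kernN mxE mulrN cosN mulN1r mulNr.
lra.
Qed.

(** After integration by parts the operator acts on F = sin(N x_e) v. The increment of F splits into
    F(x) (cos(N z_e) - 1), which an odd kernel annihilates, cos(N x_e) v(x) sin(N z_e), which
    produces [sine_moment], and sin(N (x + z)_e) times the increment of v, whose contribution is
    bounded independently of N because the sine is at most 1. *)
Lemma frac_partial_sin i v : LipC v -> exists2 M, 0 <= M & forall N g, LipC g ->
  (forall x, `|g x| <= 1) ->
  `|\int[leb]_x (sin (N * x ord0 e) * v x * Dk i g x) +
     sine_moment i N * \int[leb]_x (cos (N * x ord0 e) * v x * g x)| <= M.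
Proof.
move=> vl; have [C [r [C0 r0 vC]]] := kern_diff halpha i vl.
exists (2 * (2 * r) ^+ n * C * kmass n alpha).
  rewrite !mulr_ge0 ?exprn_ge0 ?mulr_ge0// /kmass.
  by apply: Rintegral_ge0 => z _; exact: kmaj_ge0.
move=> N g gl g1.
have mv := LipC_measurable vl.
have ms : measurable_fun setT (fun x : V => sin (N * x ord0 e)).
  exact: (BLip_measurable (BLip_sin N e)).
pose F x := sin (N * x ord0 e) * v x.
have Fl : LipC F by apply: LipCMr => //; exact: BLip_sin.
pose G (p : V * V) := sin (N * (p.1 + p.2) ord0 e) *
   (kern i p.2 * (v (p.1 + p.2) - v p.1)).
have mG : measurable_fun setT G.
  apply: measurable_funM; first exact: (measurable_add_of ms).
  exact: measurable_kern_diff.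
have GC x z : `|G (x, z)| <= C * km z * (ib r x + ib r (x + z)).
  by rewrite normrM -[leRHS]mul1r ler_pM//= sin_max.
have [iG1 iGx _ _ GM] := kern_fubini halpha C0 r0 mG GC.
have DkF x : Dk i F x = cos (N * x ord0 e) * v x * sine_moment i N +
    \int[leb]_z G (x, z).
  have is_ := kern_sin_integrable i N; have ic := kern_cos_integrable i N.
  transitivity (\int[leb]_z (F x * (kern i z * (cos (N * z ord0 e) - 1)) +
      (cos (N * x ord0 e) * v x * (kern i z * sin (N * z ord0 e)) + G (x, z)))).
    apply: eq_Rintegral => z _; rewrite /F /G /=.
    rewrite (_ : sin (N * (x + z) ord0 e) = sin (N * x ord0 e) * cos (N * z ord0 e)
      + cos (N * x ord0 e) * sin (N * z ord0 e)); first lra.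
    by rewrite mxE mulrDr sinD.
  rewrite RintegralD//; last 2 first.
  - exact: integrable_scale.
  - by apply: integrable_add => //; exact: integrable_scale.
  rewrite RintegralD//; last exact: integrable_scale.
  by rewrite !RintegralZl// kern_cos_eq0 mulr0 add0r.
rewrite frac_partial_by_parts//.
have mg := LipC_measurable gl.
have icv : leb.-integrable setT (EFin \o (fun x => cos (N * x ord0 e) * v x * g x)).
  apply: LipC_integrable; apply: LipCMl; last by case: gl.
  by apply: LipCMr => //; exact: BLip_cos.
have iGg : leb.-integrable setT (EFin \o (fun x => g x * \int[leb]_z G (x, z))).
  exact: (bounded_integrableM mg g1).
rewrite (_ : \int[leb]_x (g x * Dk i F x) =
  sine_moment i N * \int[leb]_x (cos (N * x ord0 e) * v x * g x) +
  \int[leb]_x (g x * \int[leb]_z G (x, z))); last first.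
  rewrite -RintegralZl// -RintegralD//; last exact: integrable_scale.
  by apply: eq_Rintegral => x _; rewrite DkF; lra.
rewrite opprD addrAC addNr add0r normrN.
rewrite (le_trans _ GM)//.
apply: le_Rintegral_dom => [||x].
- by apply/measurable_EFinP; exact: (measurable_int _ iGg).
- exact: integrable_norm.
- by rewrite normrM ler_piMl.
Qed.

(* Translating by [pi / N] changes the sign of the cosine. *)
Lemma cos_integral_small v : LipC v -> exists2 C, 0 <= C & forall N, 0 < N ->
  `|\int[leb]_x (cos (N * x ord0 e) * v x)| <= C / N.
Proof.
move=> vl; have [C [r [C0 r0 vC]]] := LipC_diff vl.
exists (C * pi * (2 * r) ^+ n); first by rewrite !mulr_ge0 ?exprn_ge0 ?mulr_ge0// pi_ge0.
move=> N N0; pose h : V := (pi / N) *: delta_mx ord0 e.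
have ib0 := @integrable_ind_ball R n _ r0; have ibh := integrable_shift h ib0.
have hN : Num.min 1 `|h| <= pi / N.
  rewrite (@le_trans _ _ `|h|)//; first by rewrite ge_min lexx orbT.
  have pN : 0 <= pi / N by rewrite divr_ge0 ?pi_ge0 ?ltW.
  apply: rV_norm_ler => // i; rewrite !mxE eqxx /= normrM (ger0_norm pN).
  by case: (i == e); rewrite ?normr1 ?normr0 ?mulr1 ?mulr0.
pose u x := cos (N * x ord0 e) * v x.
have ul : LipC u by apply: LipCMr => //; exact: BLip_cos.
have mu := LipC_measurable ul; have mv := LipC_measurable vl.
have uh x : u (x + h) = - (cos (N * x ord0 e) * v (x + h)).
  rewrite /u !mxE !eqxx mulr1 mulrDr (mulrC N (_ / _)) divfK ?gt_eqF//.
  by rewrite cosDpi mulNr.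
have iu : leb.-integrable setT (EFin \o u) by exact: LipC_integrable.
have iuh := integrable_shift h iu.
have : 2 * \int[leb]_x u x = - \int[leb]_x (cos (N * x ord0 e) * (v (x + h) - v x)).
  rewrite mulr2n mulrDl mul1r -{2}(Rintegral_shift h mu) -RintegralD//.
  rewrite -mulN1r -RintegralZl//.
    by apply: eq_Rintegral => x _; rewrite uh /u; lra.
  rewrite (_ : (fun x => _) = (fun x => - u (x + h) - u x)).
    apply: integrable_sub => //.
    rewrite (_ : (fun x => - _) = (fun x => -1 * u (x + h))).
      exact: integrable_scale.
    by apply/funext => x; rewrite mulN1r.
  by apply/funext => x; rewrite uh /u; lra.
have : `|\int[leb]_x (cos (N * x ord0 e) * (v (x + h) - v x))| <=
    2 * (C * pi * (2 * r) ^+ n / N).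
  apply: (@le_trans _ _ (\int[leb]_x (C * (pi / N) * (ib r x + ib r (x + h))))).
    apply: le_Rintegral_dom.
    - apply: measurable_funM; first exact: (BLip_measurable (BLip_cos N e)).
      by apply: measurable_funB => //; exact: measurable_shift_of.
    - by apply: integrable_scale; exact: integrable_add.
    - move=> x; rewrite normrM (le_trans (ler_piMl _ (cos_max _)))//.
      rewrite (le_trans (vC x h))// ler_wpM2r ?addr_ge0 ?ind_ball_ge0//.
      by rewrite ler_wpM2l.
  rewrite RintegralZl//; last exact: integrable_add.
  rewrite RintegralD// (Rintegral_shift h (@measurable_ind_ball R n r)).
  by rewrite /Rintegral integral_ind_ball//=; lra.
rewrite !ler_norml => /andP[h1 h2] h3; apply/andP; split; rewrite -/u; lra.
Qed.

End oscillation.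

(** * Unboundedness of the multiplier *)

Section gamma_unbounded.
Variables (R : realType) (n : nat) (alpha : R).
Hypothesis halpha : 0 < alpha < 1.
Local Notation leb := (lebesgue_rV R n).
Local Notation V := ('rV[R]_n).
Local Notation km := (@kmaj R n alpha).
Local Notation kern := (frac_kern alpha).
Variable e : 'I_n.
Local Notation gam := (sine_moment alpha e e).
Local Notation kmass := (kmass n alpha).
Implicit Types (z : V).

Let sin_sum (J : nat) (t : R) := \sum_(j < J) sin ((j.*2.+1)%:R * t).

(* No cancellation near the origin when the odd frequencies are summed:
   [t * sin_sum J t] is nonnegative for [`|t| < 2], and on the box at scale
   [1 / J] the sum is of order [J]. *)
Lemma sin_sumE J t : sin t * sin_sum J t = sin (J%:R * t) ^+ 2.
Proof.
elim: J => [|J IH]; first by rewrite /sin_sum big_ord0 mulr0 mul0r sin0 expr0n.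
rewrite /sin_sum big_ord_recr/= mulrDr -/(sin_sum J t) IH.
have -> : J.*2.+1%:R * t = J%:R * t + (J%:R * t + t) :> R.
  by rewrite -addnn -addSn natrD -natr1; lra.
have -> : J.+1%:R * t = J%:R * t + t :> R by rewrite -natr1; lra.
move: (J%:R * t) => a; rewrite !sinD cosD.
have h := cos2Dsin2 t.
have : sin a ^+ 2 * (cos t ^+ 2 + sin t ^+ 2) = sin a ^+ 2 by rewrite h mulr1.
lra.
Qed.

(** After multiplication by sin(t)^2 > 0, the product t * [sin_sum J t] becomes (t sin t) sin(J
    t)^2, and t sin t > 0 for 0 < |t| < 2. *)
Lemma kern_sin_sum_ge0 J z : `|z ord0 e| < 2 -> 0 <= kern e z * sin_sum J (z ord0 e).
Proof.
set t := z ord0 e; move=> t2.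
rewrite /frac_kern -/t mulrAC mulr_ge0 ?invr_ge0 ?powR_ge0//.
have [->|t0] := eqVneq t 0; first by rewrite mul0r.
have tst : 0 < t * sin t.
  move: t0; rewrite neq_lt => /orP[tn|tp].
    rewrite -mulrNN -sinN mulr_gt0 ?oppr_gt0// sin2_gt0// oppr_gt0 tn/=.
    by rewrite ltr0_norm in t2.
  by rewrite mulr_gt0// sin2_gt0// tp/=; rewrite gtr0_norm in t2.
have st : 0 < sin t ^+ 2.
  by rewrite exprn_even_gt0//; apply/eqP => s0; rewrite s0 mulr0 ltxx in tst.
rewrite -(pmulr_rge0 _ st).
have -> : sin t ^+ 2 * (t * sin_sum J t) = (t * sin t) * (sin t * sin_sum J t) by lra.
by rewrite sin_sumE mulr_ge0 ?sqr_ge0// ltW.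
Qed.

(** Only the region |z_e| >= 2 can contribute negatively; there the kernel is below [kmaj] and the
    sum has [J] terms of modulus at most 1. *)
Lemma kern_sin_sum_lb J z : - (J%:R * km z) <= kern e z * sin_sum J (z ord0 e).
Proof.
have [z2|z2] := ltP `|z ord0 e| 2.
  by rewrite (le_trans _ (kern_sin_sum_ge0 J z2))// oppr_le0 mulr_ge0// kmaj_ge0.
have z1 : 1 <= `|z|.
  by rewrite (le_trans _ (ler_coord_norm z e))// (le_trans _ z2)// ler1n.
have kk : `|kern e z| <= km z.
  rewrite (le_trans (kern_le_powR halpha e z))// /kmaj (min_idPl z1) mul1r//.
rewrite lerNl (le_trans (ler_norm _))// normrN normrM mulrC ler_pM//.
rewrite /sin_sum (le_trans (ler_norm_sum _ _ _))//.
rewrite (@le_trans _ _ (\sum_(j < J) 1))//.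
  by apply: ler_sum => j _; exact: sin_max.
by rewrite sumr_const card_ord.
Qed.

Definition scale_box (J : nat) : set V :=
  [set z | forall i, z ord0 i \in `[(2 * J%:R)^-1, J%:R^-1]].

Lemma sin_half_le (y : R) : 2^-1 <= y <= 1 -> sin 2^-1 <= sin y.
Proof.
move=> /andP[y1 y2]; have p1 := @pihalf_ge1 R.
move: y1; rewrite le_eqVlt => /orP[/eqP->//|y1].
by rewrite ltW// ltr_sin// in_itv/=; apply/andP; split; lra.
Qed.

Lemma sin_le_id (t : R) : 0 <= t -> sin t <= t.
Proof.
move=> t0; have := sin_lipschitz t 0; rewrite sin0 !subr0 (ger0_norm t0).
exact/le_trans/ler_norm.
Qed.

(** On [scale_box J], z_e >= 1/(2J) and |z| <= n/J bound the kernel from below. The last factor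
    bounds the sum of sines: it equals sin(J t)^2 / sin t, with J t in [1/2, 1] and sin t <= t <=
    1/J. *)
Definition box_lb (J : nat) : R :=
  (2 * J%:R)^-1 / (n%:R / J%:R) `^ (n%:R + alpha + 1) * (sin 2^-1 ^+ 2 * J%:R).

Lemma kern_sin_sum_box J z : (0 < J)%N -> scale_box J z ->
  box_lb J <= kern e z * sin_sum J (z ord0 e).
Proof.
move=> J0 zJ; have Jp : 0 < J%:R :> R by rewrite ltr0n.
have J1 : 1 <= J%:R :> R by rewrite ler1n.
have zc i : (2 * J%:R)^-1 <= z ord0 i <= J%:R^-1 by have := zJ i; rewrite in_itv.
have J2 : 0 < (2 * J%:R)^-1 :> R by rewrite invr_gt0 mulr_gt0.
have zi0 i : 0 < z ord0 i by case/andP: (zc i) => h _; exact: lt_le_trans h.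
set t := z ord0 e.
have [t1 t2] : (2 * J%:R)^-1 <= t /\ t <= J%:R^-1 by exact/andP/zc.
have tp : 0 < t := zi0 e.
have tl1 : t <= 1 by rewrite (le_trans t2)// invf_le1.
have s0 : 0 < sin t by rewrite sin2_gt0// tp/= (le_lt_trans tl1)// ltr1n.
have sh0 : 0 < sin 2^-1 :> R by rewrite sin2_gt0//; apply/andP; split; lra.
have zn : `|z| <= J%:R^-1.
  apply: rV_norm_ler => [|i]; first by rewrite invr_ge0 ltW.
  by rewrite gtr0_norm//; case/andP: (zc i).
have ep : 0 < enorm z.
  by rewrite (lt_le_trans _ (norm_le_enorm z))// (lt_le_trans _ (ler_coord_norm z e))// gtr0_norm.
have en : enorm z <= n%:R / J%:R.
  by rewrite (le_trans (enorm_le_norm z))// ler_wpM2l.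
have pp : 0 <= n%:R + alpha + 1.
  by case/andP: halpha => ? ?; rewrite !addr_ge0// ltW.
have nJ : 0 < n%:R / J%:R :> R by exact: lt_le_trans en.
rewrite /box_lb ler_pM//.
- by rewrite mulr_ge0 ?sqr_ge0.
- rewrite /frac_kern ler_pM ?invr_ge0 ?powR_ge0 ?(ltW J2)//.
  by rewrite lef_pV2 ?posrE ?powR_gt0// ge0_ler_powR ?nnegrE ?(ltW ep) ?(ltW nJ).
- have : sin (J%:R * t) ^+ 2 <= t * sin_sum J t.
    rewrite -sin_sumE ler_wpM2r ?sin_le_id ?(ltW tp)//.
    by rewrite -(pmulr_rge0 _ s0) sin_sumE sqr_ge0.
  have : sin 2^-1 ^+ 2 <= sin (J%:R * t) ^+ 2.
    rewrite lerXn2r ?nnegrE ?(ltW sh0)//.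
      rewrite ltW// sin2_gt0// mulr_gt0//= (@le_lt_trans _ _ 1) ?ltr1n//.
      by rewrite mulrC -ler_pdivlMr// mul1r.
    apply: sin_half_le; apply/andP; split.
      by rewrite mulrC -ler_pdivrMr// -invfM.
    by rewrite mulrC -ler_pdivlMr// mul1r.
  move=> h1 h2; have := le_trans h1 h2; rewrite -ler_pdivrMl// => /(le_trans _); apply.
  by rewrite mulrC ler_wpM2r ?sqr_ge0// -[leLHS]invrK lef_pV2 ?posrE ?invr_gt0.
Qed.

Lemma scale_box_measure J : (0 < J)%N -> leb (scale_box J) = ((2 * J%:R)^-1 ^+ n)%:E.
Proof.
move=> J0; have Jp : 0 < J%:R :> R by rewrite ltr0n.
rewrite lebesgue_rV_box (eq_bigr (fun=> ((2 * J%:R)^-1)%:E)).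
  by rewrite prodEFin prodr_const card_ord.
move=> i _; have h : (2 * J%:R)^-1 = J%:R^-1 - (2 * J%:R)^-1 :> R.
  by rewrite invfM; lra.
rewrite lebesgue_measure_itv/= lte_fin ifT; first by rewrite -EFinB -h.
by rewrite -subr_gt0 -h invr_gt0 mulr_gt0.
Qed.

Lemma measurable_scale_box J : measurable (scale_box J).
Proof.
rewrite (_ : scale_box J = \bigcap_(i in [set: 'I_n])
    ((fun x : V => x ord0 i) @^-1` `[(2 * J%:R)^-1, J%:R^-1]%classic)).
  apply: fin_bigcap_measurable => [|i _]; first exact: finite_finset.
  rewrite -[X in measurable X]setTI.
  exact: (measurable_rV_coordr i measurableT (measurable_itv _)).
by apply/seteqP; split=> x /= xp i; [move=> _|]; exact: xp.
Qed.

(** The integrand is at least [box_lb J] on the box and at least - J * [kmaj] everywhere else. *)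
Lemma sine_moment_sum_lb J : (0 < J)%N ->
  box_lb J * (2 * J%:R)^-1 ^+ n - J%:R * kmass <=
  \sum_(j < J) gam (j.*2.+1)%:R.
Proof.
move=> J0; have mB := measurable_scale_box J.
have ki j := kern_sin_integrable halpha e e (j.*2.+1)%:R.
have -> : \sum_(j < J) gam (j.*2.+1)%:R =
    \int[leb]_z (kern e z * sin_sum J (z ord0 e)).
  rewrite /sine_moment -Rintegral_big_sum//.
  by apply: eq_Rintegral => z _; rewrite /sin_sum mulr_sumr.
have iE : (\int[leb]_z (\1_(scale_box J) z)%:E = ((2 * J%:R)^-1 ^+ n)%:E)%E.
  by rewrite integral_indic// setIT -(scale_box_measure J0).
have iB : leb.-integrable setT (EFin \o (\1_(scale_box J) : V -> R)).
  apply/integrableP; split.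
    by apply/measurable_EFinP; exact: measurable_indic.
  rewrite (eq_integral (fun z => (\1_(scale_box J) z)%:E)).
    by rewrite iE ltry.
  by move=> z _; rewrite /= ger0_norm// indicE.
have iK := integrable_kmaj n halpha.
have -> : box_lb J * (2 * J%:R)^-1 ^+ n - J%:R * kmass =
    \int[leb]_z (box_lb J * \1_(scale_box J) z - J%:R * km z).
  rewrite RintegralB//; try exact: integrable_scale.
  rewrite !RintegralZl//; congr (_ * _ - _).
  by rewrite /Rintegral iE.
apply: le_Rintegral => //.
- by apply: integrable_sub; exact: integrable_scale.
- have := @integrable_big_sum _ _ _ leb _ (index_enum 'I_J) _ (fun j => ki j).
  apply: eq_integrable => // z _ /=.
  by rewrite /sin_sum mulr_sumr.
- move=> z _; rewrite indicE; case: (boolP (z \in _)) => zB.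
    rewrite mulr1 (le_trans _ (kern_sin_sum_box J0 (set_mem zB)))//.
    by rewrite lerBlDr lerDl mulr_ge0// kmaj_ge0.
  by rewrite mulr0 sub0r kern_sin_sum_lb.
Qed.

Lemma kmass_ge0 : 0 <= kmass.
Proof. by apply: Rintegral_ge0 => z _; exact: kmaj_ge0. Qed.

(** If gamma stayed below [M], the sum over the first J odd frequencies would be at most J M. The
    box contributes c J^(1 + alpha), namely J^(n + alpha + 1) from the kernel (up to its numerator
    1/(2J)), J from the sines and J^(-n) from the volume. Division by J gives c J^alpha <= M +
    [kmass] for all J, which is absurd. *)
Lemma sine_moment_unbounded (M : R) : exists2 N, 0 < N & M <= gam N.
Proof.
apply/not_exists2P => H.
have {}H N : 0 < N -> gam N < M.
  by move=> N0; rewrite ltNge; apply/negP => MN; case: (H N).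
have [a0 a1] := andP halpha.
have n0 : 0 < n%:R :> R by rewrite ltr0n; case: (n) e => [[]|].
pose p := n%:R + alpha + 1.
pose c := sin 2^-1 ^+ 2 * 2^-1 ^+ n.+1 / n%:R `^ p.
have sh0 : 0 < sin 2^-1 :> R by rewrite sin2_gt0//; apply/andP; split; lra.
have c0 : 0 < c by rewrite !mulr_gt0 ?exprn_gt0 ?invr_gt0// powR_gt0.
have bound J : (0 < J)%N -> c * J%:R `^ alpha <= M + kmass.
  move=> J0; have Jp : 0 < J%:R :> R by rewrite ltr0n.
  have := sine_moment_sum_lb J0.
  have -> : box_lb J * (2 * J%:R)^-1 ^+ n = J%:R * (c * J%:R `^ alpha).
    have JV : J%:R^-1 `^ p = (J%:R `^ p)^-1 :> R.
      by rewrite -(powR_inv1 (ltW Jp)) -powRrM mulN1r powRN.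
    have Jpow : J%:R `^ p = J%:R ^+ n * J%:R `^ alpha * J%:R :> R.
      have Jn0 (b : bool) : b ==> (J%:R != 0 :> R) by rewrite gt_eqF// implybT.
      by rewrite /p !powRD// powRr1 ?(ltW Jp)// powR_mulrn// ltW.
    rewrite /box_lb -/p powRM ?invr_ge0 ?(ltW Jp) ?(ltW n0)// JV Jpow /c.
    have h1 : J%:R ^+ n * J%:R^-1 ^+ n = 1 :> R.
      by rewrite -exprMn divff ?gt_eqF// expr1n.
    have h2 : J%:R * J%:R^-1 = 1 :> R by rewrite divff ?gt_eqF.
    rewrite invf_div invfM exprMn [2^-1 ^+ n.+1]exprS.
    move: (J%:R^-1) (J%:R `^ alpha) (J%:R ^+ n) (2^-1 ^+ n) ((n%:R `^ p)^-1) h1 h2.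
    move=> a b l d g; move: (J%:R) (a ^+ n) => k al h1 h2.
    transitivity ((k * a) * (l * al) * (k * (sin 2^-1 ^+ 2 * (2^-1 * d) * g * b))).
      lra.
    by rewrite h1 h2 !mul1r.
  rewrite -mulrBr => /le_trans -/(_ (J%:R * M)) h.
  rewrite -lerBlDr -(ler_pM2l Jp) h//.
  rewrite (@le_trans _ _ (\sum_(j < J) M))//.
    by apply: ler_sum => j _; rewrite ltW// H// ltr0n.
  by rewrite sumr_const card_ord mulr_natl.
pose T := (M + kmass) / c + 1.
have T0 : 0 < T.
  have := bound 1%N isT; rewrite powR1 mulr1 => /(lt_le_trans c0) h.
  by rewrite addr_gt0// divr_gt0.
(* This J satisfies J^alpha >= T > (M + kmass) / c. *)
pose J := (Num.bound (T `^ alpha^-1)).+1.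
have := bound J isT; rewrite mulrC -ler_pdivlMr//; apply/negP; rewrite -ltNge.
apply: (@lt_le_trans _ _ T); first by rewrite ltrDl.
have TE : T = (T `^ alpha^-1) `^ alpha.
  by rewrite -powRrM mulVf ?gt_eqF// powRr1 ?(ltW T0).
rewrite [leLHS]TE.
rewrite ge0_ler_powR ?nnegrE ?powR_ge0 ?(ltW a0)//.
rewrite (le_trans (ltW (archi_boundP (powR_ge0 _ _))))// /J ler_nat.
exact: leqnSn.
Qed.

Lemma sine_moment_le N : 0 <= N -> `|gam N| <= (2 + N) * kmass.
Proof.
move=> N0; have iK := integrable_kmaj n halpha.
rewrite /kmass -RintegralZl//; apply: le_Rintegral_dom.
- by apply/measurable_EFinP; exact: (measurable_int _ (kern_sin_integrable halpha e e N)).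
- exact: integrable_scale.
- move=> z; rewrite normrM.
  have hz : `|sin (N * z ord0 e)| <= (2 + N) * Num.min 1 `|z|.
    have [z1|z1] := leP `|z| 1.
      have := sin_lipschitz (N * z ord0 e) 0; rewrite sin0 !subr0 => /le_trans; apply.
      by rewrite normrM (ger0_norm N0) ler_pM ?ler_coord_norm// lerDr.
    by rewrite mulr1 (le_trans (sin_max _))// (@le_trans _ _ 2) ?ler1n// lerDl.
  rewrite (le_trans (ler_wpM2l (normr_ge0 _) hz))// mulrCA ler_wpM2l ?addr_ge0//.
  by rewrite mulrC; exact: kern_kmaj.
Qed.

(** Large values occur at large frequencies because gamma is bounded on bounded sets of frequencies:
    the second entry of the maximum exceeds every value that [sine_moment_le] allows below [N0]. *)
Lemma sine_moment_large (M N0 : R) : exists N, [/\ 0 < N, N0 <= N & M <= gam N].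
Proof.
have [N N_gt0 hN] := sine_moment_unbounded (Num.max M ((2 + Num.max 0 N0) * kmass + 1)).
exists N; move: hN; rewrite ge_max => /andP[MN KN]; split => //.
rewrite leNgt; apply/negP => NN0.
have := sine_moment_le (ltW N_gt0); have N00 : 0 <= Num.max 0 N0 by rewrite le_max lexx.
have : (2 + N) * kmass <= (2 + Num.max 0 N0) * kmass.
  by rewrite ler_wpM2r ?kmass_ge0// lerD2l le_max (ltW NN0) orbT.
have := ler_norm (gam N); lra.
Qed.

End gamma_unbounded.

(** * Smooth compactly supported fields *)

Section directional.
Variables (R : realType).

Lemma is_derive_cvg (V W : normedModType R) (f : V -> W) a v df :
  is_derive a v f df ->
  h^-1 *: (f (h *: v + a) - f a) @[h --> 0^'] --> df.
Proof. by move=> fd; rewrite -(@derive_val _ _ _ _ _ _ _ fd); exact: (@ex_derive _ _ _ _ _ _ _ fd). Qed.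

Lemma cvg_is_derive (V W : normedModType R) (f : V -> W) a v df :
  h^-1 *: (f (h *: v + a) - f a) @[h --> 0^'] --> df ->
  is_derive a v f df.
Proof. by move=> fd; apply: DeriveDef; [exact: cvgP fd|exact: cvg_lim fd]. Qed.

Lemma is_derive_coord (V : normedModType R) n (f : V -> 'rV[R]_n) a v df (c : 'I_n) :
  is_derive a v f df -> is_derive a v (fun x => f x ord0 c) (df ord0 c).
Proof.
move=> /is_derive_cvg fd; apply: cvg_is_derive.
have := cvg_comp _ _ fd (@coord_continuous R 1 n ord0 c df).
by apply: cvg_trans; apply: near_eq_cvg; near=> h; rewrite /= !mxE.
Unshelve. all: by end_near. Qed.

Lemma is_derive_line (V : normedModType R) (f : V -> R) (x v : V) (df : V -> R) :
  (forall y, is_derive y v f (df y)) ->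
  forall t : R, is_derive t (1 : R) (fun t => f (x + t *: v)) (df (x + t *: v)).
Proof.
move=> fd t; have /is_derive_cvg h := fd (x + t *: v); apply: cvg_is_derive.
apply: cvg_trans h; apply: near_eq_cvg; near=> h.
by rewrite scalerDl [h%:A]mulr1 addrCA.
Unshelve. all: by end_near. Qed.

End directional.

Section smooth_lipschitz.
Variables (R : realType) (n : nat).
Local Notation V := ('rV[R]_n).
Implicit Types (x y : V) (phi : V -> V).

(** Going from [y] to [x] one coordinate at a time, each of the [n] steps costs at most M |x - y| in
    the sup norm. *)
Lemma lipschitz_of_partials (f : V -> R) (df : 'I_n -> V -> R) (M : R) :
  (forall i x, is_derive x (basis_vec R i) f (df i x)) ->
  0 <= M -> (forall i x, `|df i x| <= M) ->
  forall x y, `|f x - f y| <= M * n%:R * `|x - y|.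
Proof.
move=> fd M0 dM x y.
have step (s : seq 'I_n) : `|f (y + \sum_(i <- s) (x - y) ord0 i *: basis_vec R i) - f y| <=
    M * (size s)%:R * `|x - y|.
  elim: s => [|i s IH]; first by rewrite big_nil addr0 subrr normr0 mulr0 mul0r.
  rewrite big_cons /= -natr1 mulrDr mulrDl mulr1.
  set z := y + \sum_(j <- s) _ in IH *.
  have -> : y + ((x - y) ord0 i *: basis_vec R i + \sum_(j <- s) (x - y) ord0 j *: basis_vec R j)
    = z + (x - y) ord0 i *: basis_vec R i by rewrite /z addrCA addrC.
  rewrite (le_trans (ler_distD (f z) _ _))// addrC lerD//.
  have := @lipschitz_of_derive R _ _ M (is_derive_line z (fd i)) (fun t => dM i _)
    ((x - y) ord0 i) 0.
  rewrite scale0r addr0 subr0 => /le_trans; apply.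
  by rewrite ler_wpM2l// ler_coord_norm.
have := step (index_enum 'I_n).
have -> : y + \sum_(i <- index_enum 'I_n) (x - y) ord0 i *: basis_vec R i = x.
  by rewrite -[X in _ + X](row_sum_delta (x - y)) addrC subrK.
by rewrite -[X in size X]enumT size_enum_ord.
Qed.

Lemma bounded_of_csupp (f : V -> R) (K : set V) : compact K -> continuous f ->
  (forall x, ~ K x -> f x = 0) -> exists2 M, 0 <= M & forall x, `|f x| <= M.
Proof.
move=> cK cf fK.
have /compact_bounded[M [_ MK]] : compact (f @` K).
  by apply: continuous_compact => //; exact: continuous_subspaceT.
exists (Num.max 0 M + 1) => [|x]; first by rewrite addr_ge0// le_max lexx.
have [Kx|/fK->] := pselect (K x); last by rewrite normr0 addr_ge0// le_max lexx.
apply: MK; last by exists x.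
by rewrite (@le_lt_trans _ _ (Num.max 0 M)) ?ltrDl// le_max lexx orbT.
Qed.

Lemma continuous_coord phi c : continuous phi ->
  continuous (fun x => phi x ord0 c : R).
Proof. by move=> cphi x; exact: (cvg_comp _ _ (cphi x) (@coord_continuous R 1 n ord0 c _)). Qed.

(** This is how the estimates for [LipC] functions reach the test fields. Outside the closed support
    the field vanishes in a neighbourhood, so its partial derivatives do too; being continuous, they
    are bounded by compactness. *)
Lemma Cc_smooth_LipC phi c : Cc_smooth phi -> LipC (fun x => phi x ord0 c).
Proof.
move=> [sphi]; rewrite /compact_support; set K := closure _ => cphi.
have phiK x : ~ K x -> phi x = 0.
  by move=> nK; apply: contrapT => /eqP px; apply: nK; exact: subset_closure.
have oK : open (~` K) by apply: closed_openC; exact: closed_closure.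
have dK i x : ~ K x -> 'D_(basis_vec R i) phi x = 0.
  move=> nK; rewrite (@near_eq_derive _ _ _ phi (cst 0)) ?derive_cst//.
  by apply: filterS (open_nbhs_nbhs (conj oK nK)) => y /phiK ->.
have [cph dph] := sphi [::].
have bd (i : 'I_n) : exists2 M, 0 <= M & forall x, `|'D_(basis_vec R i) phi x ord0 c| <= M.
  apply: (@bounded_of_csupp (fun x => 'D_(basis_vec R i) phi x ord0 c) K) => //.
    have [ci _] := sphi [:: i].
    exact: (continuous_coord (c := c) ci).
  by move=> x /dK ->; rewrite mxE.
have [M M0 dM] : exists2 M, 0 <= M & forall i x, `|'D_(basis_vec R i) phi x ord0 c| <= M.
  have /choice[F FP] : forall i : 'I_n, exists M, 0 <= M /\
      forall x, `|'D_(basis_vec R i) phi x ord0 c| <= M.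
    by move=> i; have [M ? ?] := bd i; exists M.
  exists (\sum_i F i); first by apply: sumr_ge0 => i _; case: (FP i).
  move=> i x; have [Fi0 /(_ x)/le_trans] := FP i; apply.
  by rewrite (bigD1 i)//= lerDl sumr_ge0// => j _; case: (FP j).
have [B B0 fB] : exists2 B, 0 <= B & forall x, `|phi x ord0 c| <= B.
  apply: (@bounded_of_csupp _ K) => //.
    exact: (continuous_coord (c := c) cph).
  by move=> x /phiK ->; rewrite mxE.
split.
  exists (M * n%:R), B; split => //; first by rewrite mulr_ge0.
  apply: (@lipschitz_of_partials _ (fun i x => 'D_(basis_vec R i) phi x ord0 c) M) => //.
  by move=> i x; apply: is_derive_coord; apply: derivableP; exact: dph.
have /compact_bounded[r [_ rK]] := cphi.
exists (Num.max 0 r + 1) => [|x rx]; first by rewrite addr_ge0// le_max lexx.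
rewrite phiK ?mxE// => Kx.
have r1 : r < Num.max 0 r + 1.
  by rewrite (@le_lt_trans _ _ (Num.max 0 r)) ?ltrDl// le_max lexx orbT.
by have := rK _ r1 x Kx; rewrite /= leNgt rx.
Qed.

Lemma lebesgue_rV_cube (x0 : V) (d : R) : 0 < d ->
  lebesgue_rV R n [set x | `|x - x0| <= d] = ((2 * d) ^+ n)%:E.
Proof.
move=> d0.
rewrite (_ : [set x | `|x - x0| <= d] =
    [set x : V | forall i, x ord0 i \in `[x0 ord0 i - d, x0 ord0 i + d]]).
  rewrite lebesgue_rV_box (eq_bigr (fun=> (2 * d)%:E)).
    by rewrite prodEFin prodr_const card_ord.
  move=> i _; rewrite lebesgue_measure_itv/= lte_fin ifT; last lra.
  by rewrite -EFinB; congr EFin; lra.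
apply/seteqP; split => x /= xr.
  move=> i; rewrite in_itv/= -ler_distl (le_trans _ xr)//.
  by have := ler_coord_norm (x - x0) i; rewrite !mxE.
apply: rV_norm_ler => [|i]; first exact: ltW.
by have := xr i; rewrite in_itv/= -ler_distl !mxE.
Qed.

(** An essential bound on a continuous field is a pointwise bound: a coordinate exceeding 1 at [x]
    would still exceed 1 on a cube around [x], which has positive measure. *)
Lemma Linfty_le1 phi : Cc_smooth phi -> (Linfty_norm phi <= 1)%E ->
  forall x i, `|phi x ord0 i| <= 1.
Proof.
move=> sphi; rewrite /Linfty_norm unlock /=.
(* The essential supremum norm is set to 0 on a space of measure 0, so the total measure is shown to
   be positive first. *)
have T0 : (0 < lebesgue_rV R n [set: V])%E.
  apply: (@lt_le_trans _ _ (((2 * 1) ^+ n)%:E)).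
    by rewrite lte_fin exprn_gt0.
  rewrite -(@lebesgue_rV_ball R n 1 ler01); apply: le_measure; rewrite ?inE//.
  exact: measurable_normball.
rewrite T0 => /ess_supP [N [mN N0 HN]] x i.
rewrite leNgt; apply/negP => px.
have [[L [B [L0 _ fL _]]] _] := Cc_smooth_LipC i sphi.
(* Over a distance [d] the coordinate loses at most half of its excess over 1; [L + 1] avoids a
   division by 0. *)
pose d := (`|phi x ord0 i| - 1) / (L + 1) / 2.
have d0 : 0 < d by rewrite !divr_gt0 ?subr_gt0 ?ltr_wpDl.
have : (lebesgue_rV R n [set y | (`|y - x| <= d)%R] <= 0)%E.
  rewrite -N0; apply: le_measure; rewrite ?inE//.
    have := @measurable_normball R n d => /(measurable_shift (- x) measurableT).
    by rewrite setTI.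
  move=> y /= yd; apply: HN => /=; apply/negP; rewrite -ltNge lte_fin.
  rewrite ger0_norm ?sqrtr_ge0// (lt_le_trans _ (norm_le_enorm _))//.
  rewrite (lt_le_trans _ (ler_coord_norm _ i))//.
  have h := fL x y; have h2 := ler_dist_dist (phi x ord0 i) (phi y ord0 i).
  have h3 : L * `|x - y| <= L * d by rewrite ler_wpM2l// distrC.
  have h4 : L * d <= (`|phi x ord0 i| - 1) / 2.
    rewrite /d mulrA ler_wpM2r// mulrCA ler_piMr ?subr_ge0 ?ltW//.
    by rewrite ltr_pdivrMr ?ltr_wpDl// mul1r ltrDl.
  have h5 : `|phi x ord0 i| - `|phi y ord0 i| <= `| `|phi x ord0 i| - `|phi y ord0 i| | by exact: ler_norm.
  lra.
by rewrite lebesgue_rV_cube// lee_fin leNgt exprn_gt0// mulr_gt0.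
Qed.

End smooth_lipschitz.

(** * Flat functions and smooth bumps *)

Section flat.
Variable R : realType.

(** The powers of 1/t make the family stable under differentiation, so smoothness follows from first
    derivatives alone. *)
Definition flat (m : nat) (t : R) : R :=
  if 0 < t then t^-1 ^+ m * expR (- t^-1) else 0.

Lemma flat_ge0 m t : 0 <= flat m t.
Proof.
rewrite /flat; case: ifP => // t0.
by rewrite mulr_ge0 ?expR_ge0// exprn_ge0// invr_ge0 ltW.
Qed.

Lemma flat_bounded m : exists2 C, 0 <= C & forall t, flat m t <= C.
Proof.
exists (m.+1%:R ^+ m.+1) => [|t]; first by rewrite exprn_ge0.
rewrite /flat; case: ifP => [t0|_]; last by rewrite exprn_ge0.
rewrite expRN ler_pdivrMr ?expR_gt0//.
have ti : 0 < t^-1 by rewrite invr_gt0.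
have M1 : 1 <= m.+1%:R ^+ m.+1 :> R by rewrite exprn_ege1// ler1n.
have [t1|t1] := leP t^-1 1.
  rewrite (@le_trans _ _ 1)//; first by rewrite exprn_ile1// ltW.
  rewrite -[leLHS]mulr1 ler_pM// -expR0 ler_expR ltW//.
have := expR_ge_pow m (ltW ti).
rewrite expr_div_n ler_pdivrMr ?exprn_gt0// mulrC => /(le_trans _); apply.
by rewrite exprS ler_peMl ?exprn_ge0 ?ltW.
Qed.

Lemma flatS m t : 0 < t -> t^-1 * flat m t = flat m.+1 t.
Proof. by move=> t0; rewrite /flat t0 mulrA -exprS. Qed.

Lemma is_derive_flat m (t : R) :
  is_derive t (1 : R) (flat m) (flat m.+2 t - m%:R * flat m.+1 t).
Proof.
have [t0|t0|t0] := ltgtP t 0.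
- have z k : flat k t = 0 by rewrite /flat ltNge (ltW t0).
  rewrite !z mulr0 subrr.
  apply: (@near_eq_is_derive _ _ _ (cst 0)).
  near=> s; rewrite /flat ltNge ltW//=.
  by near: s; exact: lt_nbhsl.
- pose g (s : R) := s^-1 ^+ m * expR (- s^-1).
  apply: (@near_eq_is_derive _ _ _ g).
    near=> s; rewrite /flat ifT//.
    by near: s; exact: lt_nbhsr.
  have dV : is_derive t (1 : R) (fun s => s^-1) (- t^-1 ^+ 2).
    apply: DeriveDef; first by apply: (@derivableV _ _ id); rewrite ?gt_eqF.
    rewrite (@deriveV _ _ id) ?gt_eqF// derive_id.
    by rewrite [_%:A]mulr1 exprVn.
  have dX : is_derive t (1 : R) (fun s => s^-1 ^+ m) (m%:R * t^-1 ^+ m.-1 * - t^-1 ^+ 2).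
    have := @is_deriveX R R _ m t 1 _ dV.
    rewrite (_ : (fun s => s^-1) ^+ m = (fun s => s^-1 ^+ m))//.
    by apply/funext => s; elim: (m) => // k; rewrite !exprS => <-.
  have dE : is_derive t (1 : R) (fun s => expR (- s^-1)) (expR (- t^-1) * t^-1 ^+ 2).
    have dN : is_derive t (1 : R) (fun s => - s^-1) (t^-1 ^+ 2).
      by rewrite -[X in is_derive _ _ _ X]opprK; exact: is_deriveN.
    exact: (@is_derive1_comp R expR (fun s => - s^-1) t _ _ (is_derive_expR _) dN).
  have := is_deriveM dX dE => /is_derive_eq; apply.
  rewrite /flat t0; move: (t^-1) (expR (- t^-1)) => a E.
  rewrite /GRing.scale/= !exprS expr0; case: (m) => [|k] /=; first lra.
  by rewrite !exprS; lra.
- subst t; have z k : flat k 0 = 0 by rewrite /flat ltxx.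
  rewrite !z mulr0 subrr.
  apply: cvg_is_derive.
  have [C C0 fC] := flat_bounded m.+2.
  apply/cvgrPdist_le => e e0.
  near=> h; rewrite sub0r normrN z subr0 addr0 [h%:A]mulr1.
  have hC : `|h| * C <= e.
    rewrite (@le_trans _ _ (`|h| * (C + 1)))//; first by rewrite ler_wpM2l// lerDl.
    rewrite -ler_pdivlMr ?ltr_wpDl//; near: h.
    apply: dnbhs0_le; by rewrite divr_gt0// ltr_wpDl.
  have [h0|h0] := ltP 0 h; last by rewrite /flat ltNge h0 scaler0 normr0 ltW.
  (* The difference quotient at 0 is flat m h / h = h * flat (m + 2) h, a bounded function times
     h. *)
  rewrite /GRing.scale/= flatS// -[flat _ _]mul1r -(@mulfV _ h) ?gt_eqF// -mulrA.
  rewrite flatS// normrM (le_trans _ hC)// ler_wpM2l//.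
  by rewrite ger0_norm ?flat_ge0.
Unshelve. all: by end_near. Qed.

End flat.

Section test_functions.
Variable R : realType.

(* Functions stable under differentiation that contain the bumps
   [flat 0 (1 + t) * flat 0 (1 - t)] and [cos (N * t)]. *)
Inductive elementary : (R -> R) -> Prop :=
| elementary_cst c : elementary (fun=> c)
| elementary_flatD m : elementary (fun t => flat m (1 + t))
| elementary_flatB m : elementary (fun t => flat m (1 - t))
| elementary_cos N : elementary (fun t => cos (N * t))
| elementary_sin N : elementary (fun t => sin (N * t))
| elementary_add f g : elementary f -> elementary g ->
    elementary (fun t => f t + g t)
| elementary_mul f g : elementary f -> elementary g ->
    elementary (fun t => f t * g t).

Lemma is_derive_affine (f : R -> R) (a b t df : R) :
  is_derive (a * t + b) (1 : R) f df ->
  is_derive t (1 : R) (fun t => f (a * t + b)) (df * a).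
Proof.
move=> fd; have ab : is_derive t (1 : R) (fun s => a * s + b) a.
  apply: cvg_is_derive; have : (fun=> a) h @[h --> (0 : R)^'] --> a by exact: cvg_cst.
  apply: cvg_trans; apply: near_eq_cvg; near=> h; have h0 : h != 0 by near: h; exact: nbhs_dnbhs_neq.
  rewrite [h%:A]mulr1 /GRing.scale/= (_ : _ - _ = h * a); last lra.
  by rewrite mulrA mulVf// mul1r.
exact: (@is_derive1_comp R f (fun s => a * s + b) t _ _ fd ab).
Unshelve. all: by end_near. Qed.

Lemma elementary_derive f : elementary f ->
  exists2 df, elementary df & forall t, is_derive t (1 : R) f (df t).
Proof.
elim => {f} [c|m|m|N|N|f g ef [df edf fd] eg [dg edg gd]|f g ef [df edf fd] eg [dg edg gd]].
- by exists (fun=> 0) => [|t]; [exact: elementary_cst|exact: is_derive_cst].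
- exists (fun t => flat m.+2 (1 + t) + - m%:R * flat m.+1 (1 + t)) => [|t].
    apply: elementary_add; first exact: elementary_flatD.
    by apply: elementary_mul; [exact: elementary_cst|exact: elementary_flatD].
  have E (s : R) : 1 + s = 1 * s + 1 by rewrite mul1r addrC.
  rewrite E (_ : (fun t => flat m (1 + t)) = (fun t => flat m (1 * t + 1))).
    by apply: is_derive_eq; [apply: is_derive_affine; exact: is_derive_flat|lra].
  by apply/funext => s; rewrite E.
- exists (fun t => - 1 * flat m.+2 (1 - t) + m%:R * flat m.+1 (1 - t)) => [|t].
    by apply: elementary_add; apply: elementary_mul;
      [exact: elementary_cst|exact: elementary_flatB|
       exact: elementary_cst|exact: elementary_flatB].
  have E (s : R) : 1 - s = - 1 * s + 1 by rewrite mulN1r addrC.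
  rewrite E (_ : (fun t => flat m (1 - t)) = (fun t => flat m (- 1 * t + 1))).
    by apply: is_derive_eq; [apply: is_derive_affine; exact: is_derive_flat|lra].
  by apply/funext => s; rewrite E.
- exists (fun t => - N * sin (N * t)) => [|t].
    by apply: elementary_mul; [exact: elementary_cst|exact: elementary_sin].
  have E (s : R) : N * s = N * s + 0 by rewrite addr0.
  rewrite (E t) (_ : (fun t => cos (N * t)) = (fun t => cos (N * t + 0))).
    by have /is_derive_eq := is_derive_affine (is_derive_cos (N * t + 0)); apply; lra.
  by apply/funext => s; rewrite -E.
- exists (fun t => N * cos (N * t)) => [|t].
    by apply: elementary_mul; [exact: elementary_cst|exact: elementary_cos].
  have E (s : R) : N * s = N * s + 0 by rewrite addr0.
  rewrite (E t) (_ : (fun t => sin (N * t)) = (fun t => sin (N * t + 0))).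
    by have /is_derive_eq := is_derive_affine (is_derive_sin (N * t + 0)); apply; lra.
  by apply/funext => s; rewrite -E.
- exists (fun t => df t + dg t) => [|t]; first exact: elementary_add.
  by have := is_deriveD (fd t) (gd t).
- exists (fun t => f t * dg t + df t * g t) => [|t].
    by apply: elementary_add; exact: elementary_mul.
  have := is_deriveM (fd t) (gd t) => /is_derive_eq; apply.
  by rewrite /GRing.scale/=; lra.
Qed.

Lemma elementary_continuous f : elementary f -> continuous f.
Proof.
move=> /elementary_derive[df _ fd] t.
by apply/differentiable_continuous/derivable1_diffP; exact: ex_derive.
Qed.

Variable n : nat.
Local Notation V := ('rV[R]_n).

Definition tens (b : 'I_n -> R -> R) (d : V) (x : V) : V :=
  (\prod_i b i (x ord0 i)) *: d.

Definition upd (b : 'I_n -> R -> R) (j : 'I_n) (f : R -> R) (i : 'I_n) : R -> R :=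
  if i == j then f else b i.

Lemma is_derive_tens b d j f' x : (forall t, is_derive t (1 : R) (b j) (f' t)) ->
  is_derive x (basis_vec R j) (tens b d) (tens (upd b j f') d x).
Proof.
move=> bd; apply: cvg_is_derive.
pose c := \prod_(i < n | i != j) b i (x ord0 i).
have tE h : tens b d (h *: basis_vec R j + x) = (b j (h + x ord0 j) * c) *: d.
  rewrite /tens (bigD1 j)//= !mxE !eqxx mulr1; congr (_ * _ *: _).
  apply: eq_bigr => i ij; rewrite !mxE eqxx /=.
  by rewrite (negbTE ij) mulr0 add0r.
have t0 : tens b d x = (b j (x ord0 j) * c) *: d.
  by have := tE 0; rewrite scale0r !add0r.
have -> : tens (upd b j f') d x = (f' (x ord0 j) * c) *: d.
  rewrite /tens (bigD1 j)//= /upd eqxx; congr (_ * _ *: _).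
  by apply: eq_bigr => i /negbTE ->.
have /is_derive_cvg := bd (x ord0 j) => bc.
rewrite (_ : (fun h => _) = (fun h : R =>
    (h^-1 *: (b j (h%:A + x ord0 j) - b j (x ord0 j)) * c) *: d)).
  exact: (cvgZ (cvgMr_tmp (b := c) bc) (cvg_cst d)).
apply/funext => h; rewrite tE t0 -scalerBl -mulrBl scalerA [h%:A]mulr1.
by congr (_ *: _); rewrite /GRing.scale/= mulrA.
Qed.

Lemma continuous_tens b d : (forall i, continuous (b i)) -> continuous (tens b d).
Proof.
move=> cb x.
have pc (s : seq 'I_n) : continuous (fun y : V => \prod_(i <- s) b i (y ord0 i)).
  elim: s => [|i s IH].
    have -> : (fun y : V => \prod_(i <- [::]) b i (y ord0 i)) = fun=> 1.
      by apply/funext => y; rewrite big_nil.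
    exact: cst_continuous.
  have -> : (fun y : V => \prod_(i <- i :: s) b i (y ord0 i)) =
      (fun y : V => b i (y ord0 i) * \prod_(i <- s) b i (y ord0 i)).
    by apply/funext => y; rewrite big_cons.
  move=> y; have h := cvg_comp _ _ (@coord_continuous R 1 n ord0 i y) (cb i _).
  by apply: (@cvgM _ _ (nbhs y)); [exact: h|exact: IH].
by apply: (@cvgZ _ _ _ (nbhs x)); [exact: pc|exact: cst_continuous].
Qed.

(** A partial derivative in direction j only replaces the factor [b j] by its derivative, so all
    iterated partial derivatives stay tensor products of elementary functions. *)
Lemma iter_partial_tens b d s : (forall i, elementary (b i)) ->
  exists b', (forall i, elementary (b' i)) /\ iter_partial s (tens b d) = tens b' d.
Proof.
move=> eb; elim: s => [|j s [b' [eb' IH]]]; first by exists b.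
have [f' ef' fd] := elementary_derive (eb' j).
exists (upd b' j f'); split.
  by move=> i; rewrite /upd; case: ifP.
apply/funext => x /=; rewrite -/(iter_partial s (tens b d)) IH.
by have := is_derive_tens d x fd => ?; exact: derive_val.
Qed.

Lemma tens_smooth b d : (forall i, elementary (b i)) -> smooth (tens b d).
Proof.
move=> eb s; have [b' [eb' ->]] := iter_partial_tens d s eb; split.
  by apply: continuous_tens => i; exact: elementary_continuous.
move=> i x; have [f' _ fd] := elementary_derive (eb' i).
by have := is_derive_tens d x fd => ?; exact: ex_derive.
Qed.

Definition mollifier (t : R) : R := flat 0 (1 + t) * flat 0 (1 - t).

Lemma elementary_mollifier : elementary mollifier.
Proof.
by apply: elementary_mul; [exact: elementary_flatD|exact: elementary_flatB].
Qed.

Lemma flat0_le1 (t : R) : flat 0 t <= 1.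
Proof.
rewrite /flat; case: ifP => // t0.
by rewrite expr0 mul1r -expR0 ler_expR oppr_le0 invr_ge0 ltW.
Qed.

Lemma mollifier_ge0 t : 0 <= mollifier t.
Proof. by rewrite mulr_ge0 ?flat_ge0. Qed.

Lemma mollifier_le1 t : mollifier t <= 1.
Proof. by rewrite -[leRHS]mulr1 ler_pM ?flat_ge0 ?flat0_le1. Qed.

Lemma mollifier_out t : 1 < `|t| -> mollifier t = 0.
Proof.
rewrite /mollifier ltr_normr => /orP[t1|t1].
  by rewrite {2}/flat ltNge (_ : 1 - t <= 0) ?mulr0// subr_le0 ltW.
by rewrite {1}/flat ltNge (_ : 1 + t <= 0) ?mul0r//; lra.
Qed.

(** Both 1 + t and 1 - t are at least 1/2, and e^(-1/s) >= e^(-2) for s >= 1/2. *)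
Lemma mollifier_lb t : `|t| <= 2^-1 -> expR (- 2) ^+ 2 <= mollifier t.
Proof.
have h (s : R) : 2^-1 <= s -> expR (- 2) <= flat 0 s.
  move=> s2; have s0 : 0 < s by exact: lt_le_trans s2.
  rewrite /flat s0 expr0 mul1r ler_expR lerN2.
  by rewrite -[leRHS]invrK lef_pV2 ?posrE.
rewrite ler_norml => /andP[t1 t2]; rewrite expr2 ler_pM ?expR_ge0//; apply: h; lra.
Qed.

Definition wbump (x : V) : R := \prod_i mollifier (x ord0 i).

Lemma wbump_ge0 x : 0 <= wbump x.
Proof. by apply: prodr_ge0 => i _; exact: mollifier_ge0. Qed.

Lemma wbump_le1 x : wbump x <= 1.
Proof.
by apply: prodr_ile1 => i _; rewrite mollifier_ge0 mollifier_le1.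
Qed.

Lemma wbump_out x : 1 < `|x| -> wbump x = 0.
Proof.
move=> x1; have [i xi] : exists i, 1 < `|x ord0 i|.
  apply: contrapT => /forallNP H; move: x1; apply/negP; rewrite -leNgt.
  by apply: rV_norm_ler => // i; rewrite leNgt; apply/negP; exact: H.
by apply/eqP; apply/prodf_eq0; exists i => //; rewrite mollifier_out.
Qed.

Lemma wbump_lb x : `|x| <= 2^-1 -> (expR (- 2) ^+ 2) ^+ n <= wbump x.
Proof.
move=> x2; rewrite -[X in _ ^+ X]card_ord -prodr_const; apply: ler_prod => i _.
rewrite exprn_ge0 ?expR_ge0//= mollifier_lb// (le_trans (ler_coord_norm _ _))//.
Qed.

Variable e : 'I_n.

Definition test_fun (N : R) (x : V) : V :=
  (cos (N * x ord0 e) * wbump x) *: basis_vec R e.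

Lemma test_funE N : test_fun N =
  tens (fun i => if i == e then (fun t => cos (N * t) * mollifier t) else mollifier) (basis_vec R e).
Proof.
apply/funext => x; rewrite /test_fun /tens /wbump; congr (_ *: _).
rewrite (bigD1 e)//= [RHS](bigD1 e)//= eqxx mulrA; congr (_ * _).
by apply: eq_bigr => i /negbTE ->.
Qed.

Lemma test_fun_Cc N : Cc_smooth (test_fun N).
Proof.
split.
  rewrite test_funE; apply: tens_smooth => i; case: ifP => _; last exact: elementary_mollifier.
  by apply: elementary_mul; [exact: elementary_cos|exact: elementary_mollifier].
rewrite /compact_support; apply: bounded_closed_compact; last exact: closed_closure.
have sub : closure [set x | test_fun N x != 0] `<=` [set x | `|x| <= 1].
  rewrite closureE; apply: smallest_sub.
    rewrite (_ : mkset _ = (fun x : V => `|x|) @^-1` [set r | r <= 1])//.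
    apply: preimage_closed => //.
    by move=> x _; exact: norm_continuous.
  move=> x /=; apply: contraNT; rewrite -ltNge => x1.
  by rewrite /test_fun wbump_out// mulr0 scale0r.
exists 1; split => // r r1 x /sub /= /le_trans; apply; exact: ltW.
Qed.

Lemma test_fun_coord N x i :
  test_fun N x ord0 i = if i == e then cos (N * x ord0 e) * wbump x else 0.
Proof.
by rewrite /test_fun !mxE eqxx /=; case: (i == e); rewrite ?mulr1 ?mulr0.
Qed.

Lemma wbump_LipC : LipC wbump.
Proof.
(* The bump is the coordinate [e] of the test field of frequency 0. *)
have := Cc_smooth_LipC e (test_fun_Cc 0).
rewrite (_ : (fun x => _) = wbump)//; apply/funext => x.
by rewrite test_fun_coord eqxx mul0r cos0 mul1r.
Qed.

Lemma wbump_sqr_gt0 : 0 < \int[lebesgue_rV R n]_x (wbump x * wbump x).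
Proof.
have wL := wbump_LipC; set c := (expR (- 2) ^+ 2) ^+ n : R.
have c0 : 0 < c by rewrite !exprn_gt0// expR_gt0.
have h0 : 0 <= 2^-1 :> R by [].
have ii := @integrable_ind_ball R n _ h0.
apply: (@lt_le_trans _ _ (\int[lebesgue_rV R n]_x (c ^+ 2 * ind_ball 2^-1 x))).
  rewrite RintegralZl// mulr_gt0 ?exprn_gt0//.
  by rewrite /Rintegral integral_ind_ball//= divff// expr1n.
apply: le_Rintegral => //; first exact: integrable_scale.
  by apply: LipC_integrable; apply: LipCMl => //; case: wL.
move=> x _; rewrite /ind_ball; case: ifPn => xh.
  by rewrite mulr1 expr2 ler_pM ?(ltW c0)// wbump_lb.
by rewrite mulr0 mulr_ge0 ?wbump_ge0.
Qed.

End test_functions.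

(** * The Riesz product *)

Section riesz.
Variables (R : realType) (n : nat) (alpha : R).
Hypothesis halpha : 0 < alpha < 1.
Variable e : 'I_n.
Local Notation leb := (lebesgue_rV R n).
Local Notation V := ('rV[R]_n).
Local Notation w := (@wbump R n).
Local Notation Dk := (frac_partial alpha).
Local Notation gam := (sine_moment alpha e).
Implicit Types (x : V) (f g v : V -> R) (s : seq R) (N : R).

Definition cos_wave N x : R := cos (N * x ord0 e).

Lemma cos_wave_le1 N x : `|cos_wave N x| <= 1. Proof. exact: cos_max. Qed.

Lemma BLip_cos_wave N : BLip (cos_wave N). Proof. exact: BLip_cos. Qed.

Lemma LipC_cos_wave N v : LipC v -> LipC (fun x => cos_wave N x * v x).
Proof. by move=> vL; apply: LipCMr => //; exact: BLip_cos_wave. Qed.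

Lemma LipCD f g : LipC f -> LipC g -> LipC (fun x => f x + g x).
Proof.
move=> [fL [r r0 freq]] [gL [q q0 gq]]; split; first exact: BLipD.
exists (r + q) => [|x rx]; first by rewrite addr_ge0.
by rewrite freq ?gq ?addr0// (le_lt_trans _ rx)// ?lerDl ?lerDr.
Qed.

Lemma RintegralLD f g : LipC f -> LipC g ->
  \int[leb]_x (f x + g x) = \int[leb]_x f x + \int[leb]_x g x.
Proof. by move=> fL gL; rewrite RintegralD//; exact: LipC_integrable. Qed.

(** The most recent frequency is at the head of the list, so adding a stage multiplies the product
    by one factor. *)
Fixpoint riesz s x : R := if s is N :: s' then riesz s' x * (1 + cos_wave N x) else w x.

Lemma riesz_LipC s : LipC (riesz s).
Proof.
elim: s => [|N s IH]; first exact: wbump_LipC.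
apply: LipCMl => //; apply: BLipD; [exact: BLip_cst|exact: BLip_cos_wave].
Qed.

Lemma riesz_ge0 s x : 0 <= riesz s x.
Proof.
elim: s => [|N s IH] /=; first exact: wbump_ge0.
by rewrite mulr_ge0// -lerBlDl sub0r cos_geN1.
Qed.

Lemma riesz_le s x : riesz s x <= 2 ^+ size s.
Proof.
elim: s => [|N s IH] /=; first by rewrite expr0 wbump_le1.
rewrite exprSr ler_pM// ?riesz_ge0//; first by rewrite -lerBlDl sub0r cos_geN1.
by rewrite [leRHS](_ : 2 = 1 + 1)// lerD2l cos_le1.
Qed.

Lemma riesz_cons N s x : riesz (N :: s) x = riesz s x + cos_wave N x * riesz s x.
Proof. by rewrite /= mulrDr mulr1 mulrC. Qed.

Definition cos_sum s x : R := \sum_(a <- s) cos_wave a x.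

Lemma cos_sum_cons N s x : cos_sum (N :: s) x = cos_wave N x + cos_sum s x.
Proof. by rewrite /cos_sum big_cons. Qed.

Lemma BLip_cos_sum s : BLip (cos_sum s).
Proof.
elim: s => [|N s IH].
  rewrite (_ : cos_sum [::] = fun=> 0); first exact: BLip_cst.
  by apply/funext => x; rewrite /cos_sum big_nil.
rewrite (_ : cos_sum (N :: s) = fun x => cos_wave N x + cos_sum s x).
  by apply: BLipD => //; exact: BLip_cos_wave.
by apply/funext => x; rewrite cos_sum_cons.
Qed.

(** The doubled frequency is included because of cos^2(t) = 1/2 + cos(2t)/2. *)
Definition small_modes (d N : R) v : Prop :=
  `|\int[leb]_x (cos_wave N x * v x)| <= d /\ `|\int[leb]_x (cos_wave (2 * N) x * v x)| <= d.

Lemma small_large_freq v d : LipC v -> 0 < d ->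
  exists N0, forall N, 0 < N -> N0 <= N -> small_modes d N v.
Proof.
move=> vL d0; have [C C0 vC] := cos_integral_small e vL.
exists (C / d) => N N0 CN.
have Cd : C / N <= d by rewrite ler_pdivrMr// mulrC -ler_pdivrMr.
split; first exact: le_trans (vC N N0) Cd.
apply: (le_trans (vC (2 * N) _)); first by rewrite mulr_gt0.
rewrite (le_trans _ Cd)// ler_wpM2l// lef_pV2 ?posrE ?mulr_gt0//.
by rewrite ler_peMl ?ltW// ltr1n.
Qed.

Lemma small_large_freq_seq (u : R -> V -> R) (t : seq R) d : (forall a, LipC (u a)) ->
  0 < d -> exists N0, forall N, 0 < N -> N0 <= N -> forall a, a \in t -> small_modes d N (u a).
Proof.
move=> uL d0; elim: t => [|b t [N1 IH]]; first by exists 0.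
have [N2 H2] := small_large_freq (uL b) d0.
exists (Num.max N1 N2) => N N0; rewrite ge_max => /andP[h1 h2] a.
by rewrite inE => /orP[/eqP->|]; [exact: H2|exact: IH].
Qed.

Variable eps : R.
Hypothesis eps0 : 0 < eps.

Definition geo_err (k : nat) : R := eps / 2 ^+ k.

Lemma geo_err_gt0 k : 0 < geo_err k. Proof. by rewrite divr_gt0// exprn_gt0. Qed.

Lemma geo_errS k : geo_err k = geo_err k.+1 *+ 2.
Proof.
rewrite /geo_err exprS invfM; move: ((2 ^+ k)^-1) => y; lra.
Qed.

Lemma geo_err_le k : geo_err k <= eps.
Proof. by rewrite ler_pdivrMr ?exprn_gt0// ler_peMr ?(ltW eps0)// exprn_ege1// ler1n. Qed.

(** The bound 4^k on gamma is for the convergence of the potential; the next clause is the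
    oscillation estimate with an error that becomes [geo_err] after division by gamma. Among the
    small modes, that of the product controls the mass, those of the products with [w] control the
    correlations with the test functions, that of [w * cos_sum s] gives almost orthogonality, and
    the clause over [a] in [s] keeps a new factor from destroying the correlation with an earlier
    frequency. *)
Definition good_freq s N : Prop :=
  [/\ 0 < N, 4 ^+ size s <= gam e N,
    forall i g, LipC g -> (forall x, `|g x| <= 1) ->
      `|\int[leb]_x (sin (N * x ord0 e) * riesz s x * Dk i g x) +
        gam i N * \int[leb]_x (cos_wave N x * riesz s x * g x)| <=
      geo_err (size s) * gam e N &
    [/\ small_modes (geo_err (size s)) N (riesz s),
        small_modes (geo_err (size s)) N (fun x => riesz s x * w x),
        small_modes (geo_err (size s)) N (fun x => w x * w x),
        small_modes (geo_err (size s)) N (fun x => w x * cos_sum s x) &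
        small_modes (geo_err (size s)) N w] /\
        forall a, a \in s -> small_modes (geo_err (size s)) N (fun x => riesz s x * (cos_wave a x * w x))].

(** Every requirement is a lower bound either on N or on gamma(N): the oscillation error M does not
    depend on N, so gamma(N) >= M / [geo_err] suffices. All of them are met at once by
    [sine_moment_large]. *)
Lemma good_freq_exists s : exists N, good_freq s N.
Proof.
have wL := @wbump_LipC R n e; have rL := riesz_LipC s.
have wB := wL.1.
have d0 := geo_err_gt0 (size s).
have [N1 H1] := small_large_freq rL d0.
have [N2 H2] := small_large_freq (LipCMl rL wB) d0.
have [N3 H3] := small_large_freq (LipCMl wL wB) d0.
have [N4 H4] := small_large_freq (LipCMl wL (BLip_cos_sum s)) d0.
have [N6 H6] := small_large_freq wL d0.
have [N5 H5] := small_large_freq_seq s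
  (fun a => LipCMl rL (BLipM (BLip_cos_wave a) wB)) d0.
have /choice[F FP] : forall i, exists M, 0 <= M /\ forall N g, LipC g ->
  (forall x, `|g x| <= 1) ->
  `|\int[leb]_x (sin (N * x ord0 e) * riesz s x * Dk i g x) +
     gam i N * \int[leb]_x (cos (N * x ord0 e) * riesz s x * g x)| <= M.
  by move=> i; have [M M0 HM] := frac_partial_sin halpha e i rL; exists M.
pose M := \sum_i F i.
have FM i : F i <= M.
  by rewrite /M (bigD1 i)//= lerDl; apply: sumr_ge0 => j _; case: (FP j).
have [N [N0 NL gL]] := sine_moment_large halpha e (Num.max (4 ^+ size s) (M / geo_err (size s)))
  (Num.max (Num.max N1 N2) (Num.max (Num.max N3 N4) (Num.max N5 N6))).
exists N; move: NL gL; rewrite !ge_max.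
move=> /andP[/andP[n1 n2] /andP[/andP[n3 n4] /andP[n5 n6]]] /andP[g1 g2].
split => //.
  move=> i g gl g1'; have [_ /(_ N g gl g1') h] := FP i.
  apply: (le_trans h); rewrite (le_trans (FM i))//.
  by move: g2; rewrite ler_pdivrMr// mulrC.
split; last exact: H5.
by split; [exact: H1|exact: H2|exact: H3|exact: H4|exact: H6].
Qed.

Definition next_freq s : R := projT1 (cid (good_freq_exists s)).

Lemma next_freq_good s : good_freq s (next_freq s).
Proof. by rewrite /next_freq; case: cid. Qed.

Fixpoint freqs (k : nat) : seq R :=
  if k is k'.+1 then next_freq (freqs k') :: freqs k' else [::].

Definition freq k : R := next_freq (freqs k).

Lemma size_freqs k : size (freqs k) = k.
Proof. by elim: k => //= k ->. Qed.

Lemma freq_mem j k : (j < k)%N -> freq j \in freqs k.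
Proof.
elim: k => // k IH; rewrite ltnS leq_eqVlt => /orP[/eqP->|jk] /=.
  by rewrite inE eqxx.
by rewrite inE IH ?orbT.
Qed.

Definition riesz_stage k : V -> R := riesz (freqs k).

Lemma riesz_stage_LipC k : LipC (riesz_stage k). Proof. exact: riesz_LipC. Qed.

Lemma riesz_stageS k x : riesz_stage k.+1 x = riesz_stage k x + cos_wave (freq k) x * riesz_stage k x.
Proof. exact: riesz_cons. Qed.

Let gk k := gam e (freq k).

Let gk_gt0 k : 0 < gk k.
Proof.
have [_ h _ _] := next_freq_good (freqs k); apply: lt_le_trans h.
by rewrite exprn_gt0.
Qed.

Let gk_ge k : 4 ^+ k <= gk k.
Proof. by have [_ h _ _] := next_freq_good (freqs k); rewrite size_freqs in h. Qed.

Definition riesz_term k x : R := (gk k)^-1 * (sin (freq k * x ord0 e) * riesz_stage k x).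

Definition riesz_psum K x : R := \sum_(k < K) riesz_term k x.

Lemma riesz_term_LipC k : LipC (riesz_term k).
Proof.
apply: LipCMr; first exact: BLip_cst.
by apply: LipCMr; [exact: BLip_sin|exact: riesz_stage_LipC].
Qed.

(** The stage is at most 2^k and gamma at the k-th frequency is at least 4^k. *)
Lemma riesz_term_le k x : `|riesz_term k x| <= (2 ^+ k)^-1.
Proof.
rewrite normrM (ger0_norm (_ : 0 <= (gk k)^-1)) ?invr_ge0 ?(ltW (gk_gt0 k))//.
rewrite mulrC ler_pdivrMr//.
apply: (@le_trans _ _ (2 ^+ k)).
  rewrite normrM (le_trans (ler_piMl _ (sin_max _)))//.
  rewrite ger0_norm ?riesz_ge0// (le_trans (riesz_le _ _))//.
  by rewrite size_freqs.
rewrite mulrC ler_pdivlMr ?exprn_gt0// -exprMn (_ : 2 * 2 = 4) ?gk_ge//.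
by rewrite -natrM.
Qed.

Lemma riesz_term_integrable i g k : LipC g -> 
  leb.-integrable setT (EFin \o (fun x => riesz_term k x * Dk i g x)).
Proof.
move=> gl; have tl := riesz_term_LipC k.
apply: (bounded_integrableM (LipC_measurable tl) (riesz_term_le k)).
exact: frac_partial_integrable.
Qed.

(** The estimate of [good_freq] is divided by gamma; the factor (i == e) appears because the sine
    moments in the other directions vanish. *)
Lemma riesz_term_Dk i g k : LipC g -> (forall x, `|g x| <= 1) ->
  `|\int[leb]_x (riesz_term k x * Dk i g x) +
    (i == e)%:R * \int[leb]_x (cos_wave (freq k) x * riesz_stage k x * g x)| <= geo_err k.
Proof.
move=> gl g1; have [_ _ /(_ i g gl g1) h _] := next_freq_good (freqs k).
rewrite size_freqs -/(freq k) -/(gk k) -/(riesz_stage k) in h.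
have is_ : leb.-integrable setT
    (EFin \o (fun x => sin (freq k * x ord0 e) * riesz_stage k x * Dk i g x)).
  have sl : LipC (fun x => sin (freq k * x ord0 e) * riesz_stage k x).
    by apply: LipCMr; [exact: BLip_sin|exact: riesz_stage_LipC].
  have [_ [B [_ _ _ sB]]] := sl.1.
  apply: (bounded_integrableM (LipC_measurable sl) sB).
  exact: frac_partial_integrable.
rewrite (_ : \int[leb]_x (riesz_term k x * Dk i g x) =
  (gk k)^-1 * \int[leb]_x (sin (freq k * x ord0 e) * riesz_stage k x * Dk i g x)); last first.
  by rewrite -RintegralZl//; apply: eq_Rintegral => x _; rewrite /riesz_term mulrA.
rewrite (_ : (i == e)%:R = (gk k)^-1 * gam i (freq k)); last first.
  case: eqVneq => [->|ie]; first by rewrite mulVf// gt_eqF.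
  by rewrite sine_moment_neq// mulr0.
by rewrite -mulrA -mulrDr normrM gtr0_norm ?invr_gt0// mulrC ler_pdivrMr//.
Qed.

(* [2 * eps - geo_err K *+ 2] is the sum of the [geo_err k] for [k < K]. *)
Lemma riesz_psum_Dk i g K : LipC g -> (forall x, `|g x| <= 1) ->
  `|\int[leb]_x (riesz_psum K x * Dk i g x) +
    (i == e)%:R * (\int[leb]_x (riesz_stage K x * g x) - \int[leb]_x (w x * g x))| <=
  2 * eps - geo_err K *+ 2.
Proof.
move=> gl g1.
have -> : \int[leb]_x (riesz_psum K x * Dk i g x) =
    \sum_(k < K) \int[leb]_x (riesz_term k x * Dk i g x).
  rewrite -Rintegral_big_sum; last by move=> k; exact: riesz_term_integrable.
  by apply: eq_Rintegral => x _; rewrite /riesz_psum mulr_suml.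
elim: K => [|K IH].
  rewrite big_ord0 add0r subrr mulr0 normr0 /geo_err expr0 divr1; lra.
rewrite big_ord_recr/=.
have -> : \int[leb]_x (riesz_stage K.+1 x * g x) = \int[leb]_x (riesz_stage K x * g x) +
    \int[leb]_x (cos_wave (freq K) x * riesz_stage K x * g x).
  rewrite -RintegralLD.
  - by apply: eq_Rintegral => x _; rewrite riesz_stageS mulrDl.
  - by apply: LipCMl; [exact: riesz_stage_LipC|case: gl].
  - by apply: LipCMl; [apply: LipC_cos_wave; exact: riesz_stage_LipC|case: gl].
have h := riesz_term_Dk i K gl g1.
move: IH h; rewrite geo_errS; move: (\sum_(k < K) _) (\int[leb]_x (riesz_term K x * _)).
move: (\int[leb]_x (riesz_stage K x * g x)) (\int[leb]_x (w x * g x)) (\int[leb]_x _).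
move: (geo_err K.+1) ((i == e)%:R) => E b A B C D F.
rewrite !ler_norml => /andP[h1 h2] /andP[h3 h4].
by apply/andP; split; rewrite !mulrDr mulrN in h1 h2 h3 h4 *; lra.
Qed.

Lemma small_modes_cs k v : small_modes (geo_err k) (freq k) v -> `|\int[leb]_x (cos_wave (freq k) x * v x)| <= geo_err k.
Proof. by case. Qed.

Let goodk k : [/\ small_modes (geo_err k) (freq k) (riesz_stage k),
        small_modes (geo_err k) (freq k) (fun x => riesz_stage k x * w x),
        small_modes (geo_err k) (freq k) (fun x => w x * w x),
        small_modes (geo_err k) (freq k) (fun x => w x * cos_sum (freqs k) x) &
        small_modes (geo_err k) (freq k) w] /\
        forall a, a \in freqs k -> small_modes (geo_err k) (freq k) (fun x => riesz_stage k x * (cos_wave a x * w x)).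
Proof. by have [_ _ _] := next_freq_good (freqs k); rewrite size_freqs. Qed.

Let wL := @wbump_LipC R n e.
Let wB : BLip w := wL.1.

(** Stage K changes the integral by the cosine mode of [riesz_stage K], at most [geo_err K]. The
    stages being nonnegative, this bounds their L^1 norms. *)
Lemma riesz_stage_mass K : \int[leb]_x riesz_stage K x <= \int[leb]_x w x + (2 * eps - geo_err K *+ 2).
Proof.
elim: K => [|K IH].
  have -> : geo_err 0 = eps by rewrite /geo_err expr0 divr1.
  by rewrite mulr_natl subrr addr0.
have -> : \int[leb]_x riesz_stage K.+1 x = \int[leb]_x riesz_stage K x + \int[leb]_x (cos_wave (freq K) x * riesz_stage K x).
  rewrite -RintegralLD; [|exact: riesz_stage_LipC|by apply: LipC_cos_wave; exact: riesz_stage_LipC].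
  by apply: eq_Rintegral => x _; rewrite riesz_stageS.
have [[/small_modes_cs h _ _ _ _] _] := goodk K.
move: IH h; rewrite geo_errS ler_norml => h1 /andP[_ h2]; lra.
Qed.

Lemma riesz_stage_w K : \int[leb]_x (w x * w x) - (2 * eps - geo_err K *+ 2) <= \int[leb]_x (riesz_stage K x * w x).
Proof.
elim: K => [|K IH].
  have -> : geo_err 0 = eps by rewrite /geo_err expr0 divr1.
  by rewrite mulr_natl subrr subr0.
have mw : LipC (fun x => riesz_stage K x * w x) by apply: LipCMl => //; exact: riesz_stage_LipC.
have -> : \int[leb]_x (riesz_stage K.+1 x * w x) = \int[leb]_x (riesz_stage K x * w x) +
    \int[leb]_x (cos_wave (freq K) x * (riesz_stage K x * w x)).
  rewrite -RintegralLD//; last exact: LipC_cos_wave.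
  by apply: eq_Rintegral => x _; rewrite riesz_stageS mulrDl mulrA.
have [[_ /small_modes_cs h _ _ _] _] := goodk K.
move: IH h; rewrite geo_errS ler_norml => h1 /andP[h2 _]; lra.
Qed.

Lemma cos_wave_sqr N x : cos_wave N x * cos_wave N x = 2^-1 + 2^-1 * cos_wave (2 * N) x.
Proof.
have h := cos2Dsin2 (N * x ord0 e).
rewrite /cos_wave (_ : 2 * N * x ord0 e = N * x ord0 e + N * x ord0 e); last lra.
rewrite cosD; lra.
Qed.

(** At K = j + 1 the new factor supplies cos^2, whose mean 1/2 yields half of the integral of
    [riesz_stage j * w], itself close to that of w^2. A later stage K loses at most [geo_err K],
    which is exactly the decrease of [geo_err K *+ 2]; subtracting this reserve makes the right-hand
    side nondecreasing in K. *)
Lemma riesz_stage_cs j K : (j < K)%N ->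
  2^-1 * \int[leb]_x (w x * w x) - 5 * eps <=
  \int[leb]_x (riesz_stage K x * (cos_wave (freq j) x * w x)) + - (geo_err K *+ 2).
Proof.
elim: K => // K IH; rewrite ltnS leq_eqVlt => /orP[/eqP jK|jK]; last first.
  have mw : LipC (fun x => riesz_stage K x * (cos_wave (freq j) x * w x)).
    by apply: LipCMl; [exact: riesz_stage_LipC|apply: BLipM => //; exact: BLip_cos_wave].
  have -> : \int[leb]_x (riesz_stage K.+1 x * (cos_wave (freq j) x * w x)) =
      \int[leb]_x (riesz_stage K x * (cos_wave (freq j) x * w x)) +
      \int[leb]_x (cos_wave (freq K) x * (riesz_stage K x * (cos_wave (freq j) x * w x))).
    rewrite -RintegralLD//; last exact: LipC_cos_wave.
    by apply: eq_Rintegral => x _; rewrite riesz_stageS mulrDl -!mulrA.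
  have [_ /(_ _ (freq_mem jK))/small_modes_cs h] := goodk K.
  by have := IH jK; move: h; rewrite geo_errS ler_norml => /andP[h1 _] h2; lra.
rewrite {}jK.
have mw : LipC (fun x => riesz_stage K x * w x) by apply: LipCMl => //; exact: riesz_stage_LipC.
have mcw N : LipC (fun x => 2^-1 * (cos_wave N x * (riesz_stage K x * w x))).
  by apply: LipCMr; [exact: BLip_cst|exact: LipC_cos_wave].
have mw2 : LipC (fun x => 2^-1 * (riesz_stage K x * w x)).
  by apply: LipCMr => //; exact: BLip_cst.
have -> : \int[leb]_x (riesz_stage K.+1 x * (cos_wave (freq K) x * w x)) =
  \int[leb]_x (cos_wave (freq K) x * (riesz_stage K x * w x)) +
  (2^-1 * \int[leb]_x (riesz_stage K x * w x) +
   2^-1 * \int[leb]_x (cos_wave (2 * freq K) x * (riesz_stage K x * w x))).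
  rewrite -RintegralZl//; last exact: LipC_integrable.
  rewrite -RintegralZl//; last by apply: LipC_integrable; exact: LipC_cos_wave.
  rewrite -RintegralLD// -RintegralLD//; [|exact: LipC_cos_wave|exact: LipCD].
  apply: eq_Rintegral => x _; rewrite riesz_stageS.
  have h := cos_wave_sqr (freq K) x.
  have h2 : cos_wave (freq K) x * cos_wave (freq K) x * (riesz_stage K x * w x) =
    (2^-1 + 2^-1 * cos_wave (2 * freq K) x) * (riesz_stage K x * w x) by rewrite h.
  lra.
have [[_ [h1 h2] _ _ _] _] := goodk K.
have h3 := riesz_stage_w K; have := geo_err_le K; have := geo_err_gt0 K.
move: h1 h2 h3; rewrite !ler_norml geo_errS => /andP[h1 _] /andP[h2 _]; lra.
Qed.

(** Almost orthogonality: expanding the square, each new frequency adds a diagonal term of at most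
    the integral of [w] and twice a cross term of at most [geo_err], so the growth is linear in J
    instead of quadratic. *)
Lemma cos_sum_sqr J : \int[leb]_x (w x * cos_sum (freqs J) x * cos_sum (freqs J) x) <=
  J%:R * (\int[leb]_x w x + 2 * eps).
Proof.
elim: J => [|J IH].
  rewrite mul0r (_ : (fun x => _) = fun=> 0); first by rewrite /Rintegral integral0.
  by apply/funext => x; rewrite /cos_sum big_nil mulr0.
have sB := BLip_cos_sum (freqs J); have cB := BLip_cos_wave (freq J).
have ws : LipC (fun x => w x * cos_sum (freqs J) x) by exact: LipCMl.
have -> : \int[leb]_x (w x * cos_sum (freqs J.+1) x * cos_sum (freqs J.+1) x) =
  \int[leb]_x (w x * cos_sum (freqs J) x * cos_sum (freqs J) x) +
  (2 * \int[leb]_x (cos_wave (freq J) x * (w x * cos_sum (freqs J) x)) +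
   \int[leb]_x (w x * cos_wave (freq J) x * cos_wave (freq J) x)).
  rewrite -RintegralZl//; last by apply: LipC_integrable; exact: LipC_cos_wave.
  have l1 : LipC (fun x => 2 * (cos_wave (freq J) x * (w x * cos_sum (freqs J) x))).
    by apply: LipCMr; [exact: BLip_cst|exact: LipC_cos_wave].
  have l2 : LipC (fun x => w x * cos_wave (freq J) x * cos_wave (freq J) x).
    by apply: LipCMl => //; exact: LipCMl.
  rewrite -RintegralLD// -RintegralLD//; [|exact: LipCMl|exact: LipCD].
  by apply: eq_Rintegral => x _; rewrite /= cos_sum_cons -/(freq J); lra.
have [[_ _ _ [h _] _] _] := goodk J.
have hw : \int[leb]_x (w x * cos_wave (freq J) x * cos_wave (freq J) x) <= \int[leb]_x w x.
  apply: le_Rintegral => //; try exact: LipC_integrable.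
    by apply: LipC_integrable; apply: LipCMl => //; exact: LipCMl.
  move=> x _; rewrite -mulrA ler_piMr ?wbump_ge0//.
  by rewrite cos_wave_sqr; have := cos_le1 (2 * freq J * x ord0 e); rewrite /cos_wave; lra.
have h2 := geo_err_le J; move: h; rewrite ler_norml => /andP[_ h].
rewrite -natr1 mulrDl mul1r; lra.
Qed.

(** * The limit potential and its pairings *)

Definition riesz_potential x : R := limn (fun K => riesz_psum K x).

Lemma riesz_psum_tail K M x : `|riesz_psum (K + M) x - riesz_psum K x| <= 2 * (2 ^+ K)^-1 - 2 * (2 ^+ (K + M))^-1.
Proof.
elim: M => [|M IH]; first by rewrite addn0 !subrr normr0.
rewrite addnS {1}/riesz_psum big_ord_recr /= -/(riesz_psum (K + M) x).
rewrite (_ : _ - _ = (riesz_psum (K + M) x - riesz_psum K x) + riesz_term (K + M) x); last lra.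
rewrite (le_trans (ler_normD _ _))//.
have := riesz_term_le (K + M) x; move: IH.
have : (2 ^+ (K + M))^-1 = 2 * (2 ^+ (K + M).+1)^-1 :> R.
  by rewrite exprS invfM mulrA divff ?mul1r.
lra.
Qed.

Lemma pow2_small (d : R) : 0 < d -> exists K : nat, 2 * (2 ^+ K)^-1 <= d.
Proof.
move=> d0; exists (Num.bound (2 / d)).
have h := archi_boundP (_ : 0 <= 2 / d).
rewrite ler_pdivrMr ?exprn_gt0// mulrC -ler_pdivrMr//.
rewrite (le_trans (ltW (h _)))// ?divr_ge0 ?(ltW d0)// -natrX ler_nat ltnW//.
exact: ltn_expl.
Qed.

Lemma riesz_psum_cvg x : (fun K => riesz_psum K x) @ \oo --> riesz_potential x.
Proof.
apply/cauchy_cvgP; apply/cauchy_exP => d d0.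
have [K HK] := pow2_small (divr_gt0 d0 (ltr0n R 2)).
exists (riesz_psum K x); exists K => // M /= KM; rewrite -(subnKC KM).
rewrite /ball /= distrC (le_lt_trans (riesz_psum_tail K _ x))//.
have : 0 < (2 ^+ (K + (M - K)))^-1 :> R by rewrite invr_gt0 exprn_gt0.
lra.
Qed.

Lemma riesz_potential_tail K x : `|riesz_potential x - riesz_psum K x| <= 2 * (2 ^+ K)^-1.
Proof.
have h : (fun M => `|riesz_psum M x - riesz_psum K x|) @ \oo --> `|riesz_potential x - riesz_psum K x|.
  apply: cvg_norm; apply: cvgB; [exact: riesz_psum_cvg|exact: cvg_cst].
rewrite -(cvg_lim _ h)//; apply: limr_le; first exact: cvgP h.
exists K => // M /= KM; rewrite -(subnKC KM) (le_trans (riesz_psum_tail K _ x))//.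
by rewrite lerBlDr lerDl mulr_ge0// invr_ge0 exprn_ge0.
Qed.

Lemma riesz_psum_LipC K : LipC (riesz_psum K).
Proof.
elim: K => [|K IH].
  rewrite (_ : riesz_psum 0 = fun x => 0 * w x); last first.
    by apply/funext => x; rewrite /riesz_psum big_ord0 mul0r.
  by apply: LipCMr => //; exact: BLip_cst.
rewrite (_ : riesz_psum K.+1 = fun x => riesz_psum K x + riesz_term K x).
  by apply: LipCD => //; exact: riesz_term_LipC.
by apply/funext => x; rewrite /riesz_psum big_ord_recr.
Qed.

Lemma riesz_potential_measurable : measurable_fun setT riesz_potential.
Proof.
apply: (measurable_fun_cvg (h := riesz_psum)) => [K|x _]; last exact: riesz_psum_cvg.
by have := LipC_measurable (riesz_psum_LipC K).
Qed.

Lemma riesz_potential_bounded x : `|riesz_potential x| <= 2.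
Proof.
have := riesz_potential_tail 0 x; rewrite /riesz_psum big_ord0 subr0 expr0 invr1; lra.
Qed.

Lemma riesz_potential_csupp : csupp riesz_potential.
Proof.
exists 1 => // x x1; apply: (@cvg_unique _ _ ((fun K => riesz_psum K x) @ \oo)).
- exact: Rhausdorff.
- exact: riesz_psum_cvg.
rewrite (_ : (fun K => _) = fun=> 0); first exact: cvg_cst.
apply/funext => K; rewrite /riesz_psum big1// => k _; rewrite /riesz_term.
suff -> : riesz_stage k x = 0 by rewrite !mulr0.
rewrite /riesz_stage; elim: (freqs k) => [|N s IH] /=; first exact: wbump_out.
by rewrite IH mul0r.
Qed.

Lemma riesz_potential_L1 : L1 riesz_potential.
Proof. exact: (csupp_integrable riesz_potential_measurable riesz_potential_bounded riesz_potential_csupp). Qed.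

Lemma riesz_potential_integrableM i g : LipC g ->
  leb.-integrable setT (EFin \o (fun x => riesz_potential x * Dk i g x)).
Proof.
move=> gl; apply: (bounded_integrableM riesz_potential_measurable riesz_potential_bounded).
exact: frac_partial_integrable.
Qed.

(** The partial sums converge uniformly and [frac_partial] of a [LipC] function is integrable, so
    the pairings converge. *)
Lemma riesz_potential_Dk_approx i g (d : R) : LipC g -> 0 < d -> exists K0, forall K, (K0 <= K)%N ->
  `|\int[leb]_x (riesz_potential x * Dk i g x) - \int[leb]_x (riesz_psum K x * Dk i g x)| <= d.
Proof.
move=> gl d0; have iD := frac_partial_integrable halpha i gl.
have iDn := integrable_norm iD.
pose m := \int[leb]_x `|Dk i g x|.
have m0 : 0 <= m by apply: Rintegral_ge0.
have [K0 HK0] := pow2_small (divr_gt0 d0 (ltr_wpDl m0 ltr01)).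
exists K0 => K KK.
have pl := riesz_psum_LipC K; have [_ [B [_ _ _ pB]]] := pl.1.
have ip := bounded_integrableM (LipC_measurable pl) pB iD.
have il := riesz_potential_integrableM i gl.
rewrite -RintegralB//.
apply: (@le_trans _ _ (\int[leb]_x (2 * (2 ^+ K)^-1 * `|Dk i g x|))).
  apply: le_Rintegral_dom.
  - have := measurable_int _ (integrable_sub il ip).
    by move/measurable_EFinP.
  - exact: integrable_scale.
  - by move=> x; rewrite -mulrBl normrM ler_wpM2r// riesz_potential_tail.
rewrite RintegralZl// -/m.
have KK0 : 2 * (2 ^+ K)^-1 <= d / (m + 1).
  rewrite (le_trans _ HK0)// ler_wpM2l// lef_pV2 ?posrE ?exprn_gt0//.
  by rewrite ler_weXn2l// ler1n.
apply: (@le_trans _ _ (d / (m + 1) * (m + 1))); last by rewrite divfK// gt_eqF// ltr_wpDl.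
rewrite ler_pM// ?lerDl//; by rewrite mulr_ge0// invr_ge0 exprn_ge0.
Qed.

(** The 5 eps collect 2 eps from the partial sum, eps from passing to the limit and 2 eps from the
    mass of the stage; the mass of [w] occurs twice, for the stage and for the subtracted mu_0. *)
Lemma riesz_potential_Dk_bound i g : LipC g -> (forall x, `|g x| <= 1) ->
  `|\int[leb]_x (riesz_potential x * Dk i g x)| <= 2 * \int[leb]_x w x + 5 * eps.
Proof.
move=> gl g1; have [K0 /(_ K0 (leqnn _)) h] := riesz_potential_Dk_approx i gl eps0.
have h1 := riesz_psum_Dk i K0 gl g1.
have b (u : V -> R) : LipC u -> (forall x, 0 <= u x) ->
    `|\int[leb]_x (u x * g x)| <= \int[leb]_x u x.
  move=> ul u0; apply: le_Rintegral_dom.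
  - by apply: LipC_measurable; apply: LipCMl => //; case: gl.
  - exact: LipC_integrable.
  - by move=> x; rewrite normrM (ger0_norm (u0 x)) ler_piMr.
have h2 := b _ (riesz_stage_LipC K0) (riesz_ge0 _).
have h3 := b _ wL (@wbump_ge0 R n).
have h4 := riesz_stage_mass K0; have h5 := geo_err_gt0 K0.
have w0 : 0 <= \int[leb]_x w x by apply: Rintegral_ge0 => x _; exact: wbump_ge0.
move: h1 h h2 h3; rewrite !ler_norml.
case: (i == e); rewrite ?mul1r ?mul0r => /andP[a1 a2] /andP[a3 a4] /andP[a5 a6] /andP[a7 a8].
  by apply/andP; split; lra.
by apply/andP; split; lra.
Qed.

(** The main term comes from [riesz_stage_cs]. The 9 eps are its 5 eps, 2 eps from the partial sum,
    eps from the limit and eps from the pairing of mu_0 = w with the test function. *)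
Lemma riesz_potential_Dk_test j :
  \int[leb]_x (riesz_potential x * Dk e (fun x => cos_wave (freq j) x * w x) x) <=
  9 * eps - 2^-1 * \int[leb]_x (w x * w x).
Proof.
have gl : LipC (fun x => cos_wave (freq j) x * w x) by exact: LipC_cos_wave.
have g1 x : `|cos_wave (freq j) x * w x| <= 1.
  by rewrite normrM -[leRHS]mulr1 ler_pM// ?cos_wave_le1// ger0_norm ?wbump_ge0// wbump_le1.
have [K0 H] := riesz_potential_Dk_approx e gl eps0.
pose K := maxn K0 j.+1.
have jK : (j < K)%N by rewrite leq_max ltnSn orbT.
have h1 := H K (leq_maxl _ _).
have h2 := riesz_psum_Dk e K gl g1.
have h3 := riesz_stage_cs jK.
have [[_ _ [h4 _] _ _] _] := goodk j.
have h5 : \int[leb]_x (w x * (cos_wave (freq j) x * w x)) = \int[leb]_x (cos_wave (freq j) x * (w x * w x)).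
  by apply: eq_Rintegral => x _; rewrite mulrCA.
have h6 := geo_err_le j; have h7 := geo_err_gt0 K.
move: h1 h2 h4; rewrite h5 eqxx mul1r !ler_norml.
by move=> /andP[a1 a2] /andP[a3 a4] /andP[a5 a6]; lra.
Qed.

End riesz.

(** * Truncation of an integrable function *)

Section large_part.
Context d (T : measurableType d) (R : realType) (mu : {measure set T -> \bar R}).
Variable G : T -> R.
Hypothesis iG : mu.-integrable setT (EFin \o G).

Definition large_part (M : R) (x : T) : R := if M < `|G x| then `|G x| else 0.

Lemma large_part_le M x : `|large_part M x| <= `|G x|.
Proof. by rewrite /large_part; case: ifP; rewrite ?normr_id ?normr0. Qed.

Lemma measurable_large_part M : measurable_fun setT (large_part M).
Proof.
have mG : measurable_fun setT (fun x => `|G x|).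
  apply: (measurableT_comp (@normr_measurable R setT)).
  by apply/measurable_EFinP; case/integrableP: iG.
apply: measurable_fun_ifT => //.
exact: (measurable_fun_ltr (measurable_cst M) mG).
Qed.

Lemma large_part_integrable M : mu.-integrable setT (EFin \o large_part M).
Proof.
by apply: (integrable_dom (measurable_large_part M) (integrable_norm iG)) => x; exact: large_part_le.
Qed.

(** At each point the truncation is eventually 0, and |G| dominates it. *)
Lemma large_part_small (dl : R) : 0 < dl -> exists2 M, 0 < M & \int[mu]_x large_part M x <= dl.
Proof.
move=> dl0.
have h : (\int[mu]_x (large_part m.+1%:R x)%:E @[m --> \oo] --> \int[mu]_x (cst 0 x))%E.
  apply: (@dominated_cvg _ _ _ mu setT measurableT _ _ (EFin \o (fun x => `|G x|))) => //.
  - by move=> m; apply/measurable_EFinP; exact: measurable_large_part.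
  - move=> x _; apply: (cvg_trans _ (@cvg_cst _ 0%E nat \oo _)).
    apply: near_eq_cvg; exists (Num.bound `|G x|) => // m /= Gm.
    rewrite /large_part ltNge (_ : `|G x| <= m.+1%:R)//.
    rewrite (le_trans (ltW (archi_boundP (normr_ge0 _))))// ler_nat.
    exact: leq_trans Gm (leqnSn _).
  - exact: integrable_norm.
  - by move=> m x _; rewrite lee_fin large_part_le.
rewrite integral0 in h.
have hf : (fun m => \int[mu]_x large_part m.+1%:R x) @ \oo --> (0 : R).
  exact: fine_cvg h.
have /cvgrPdist_le /(_ dl dl0)[m _ /(_ m (leqnn _))] := hf.
rewrite /= sub0r normrN => hm; exists m.+1%:R => //.
exact: le_trans (ler_norm _) hm.
Qed.

End large_part.

(** * The strict inclusion *)

Section main.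
Variables (R : realType) (n : nat) (alpha : R).
Hypothesis halpha : 0 < alpha < 1.
Variable e : 'I_n.
Local Notation leb := (lebesgue_rV R n).
Local Notation V := ('rV[R]_n).
Local Notation w := (@wbump R n).
Local Notation Dk := (frac_partial alpha).
Implicit Types (x : V) (phi g : V -> V) (f : V -> R).

Lemma frac_const_gt0 : 0 < frac_const n alpha.
Proof.
have [a0 a1] := andP halpha.
rewrite /frac_const !mulr_gt0 ?invr_gt0 ?powR_gt0 ?pi_gt0 ?Gamma_gt0//.
  by rewrite divr_gt0// ltr_wpDl// addr_ge0// ltW.
by rewrite divr_gt0// subr_gt0.
Qed.

Lemma frac_divE phi x : Cc_smooth phi ->
  frac_div alpha phi x = frac_const n alpha * \sum_i Dk i (fun y => phi y ord0 i) x.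
Proof.
move=> cphi; rewrite /frac_div; congr (_ * _).
have pl i := Cc_smooth_LipC i cphi.
pose H i (y : V) := frac_kern alpha i (y - x) * (phi y ord0 i - phi x ord0 i).
have mH i : measurable_fun setT (H i).
  apply: measurable_funM.
    exact: (measurable_shift_of (- x) (@measurable_kern R n alpha i)).
  by apply: measurable_funB => //; exact: LipC_measurable.
transitivity (\int[leb]_y \sum_i H i y).
  apply: eq_Rintegral => y _; rewrite /dot mulr_suml; apply: eq_bigr => i _.
  by rewrite /H /frac_kern mulrAC !mxE.
have ms : measurable_fun setT (fun y => \sum_i H i y) by exact: measurable_sum.
rewrite -(Rintegral_shift x ms) /frac_partial -Rintegral_big_sum.
  apply: eq_Rintegral => z _; apply: eq_bigr => i _.
  by rewrite /H addrK (addrC z).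
by move=> i; exact: (frac_partial_integrand_integrable halpha i x (pl i)).
Qed.

Lemma frac_div_integral f phi : Cc_smooth phi ->
  (forall i, leb.-integrable setT
    (EFin \o (fun x => f x * Dk i (fun y => phi y ord0 i) x))) ->
  \int[leb]_x (f x * frac_div alpha phi x) =
  frac_const n alpha * \sum_i \int[leb]_x (f x * Dk i (fun y => phi y ord0 i) x).
Proof.
move=> cphi fi; rewrite -Rintegral_big_sum// -RintegralZl//.
  by apply: eq_Rintegral => x _; rewrite frac_divE// mulrCA mulr_sumr.
exact: integrable_big_sum.
Qed.

(** The pairing with an admissible field is at most the sum of the L^1 norms of the coordinates of
    the weak gradient. *)
Lemma S_frac_sub_BV : S_frac n alpha `<=` BV_frac n alpha.
Proof.
move=> f [f1 [g g1 fg]]; split => //.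
have ign i := integrable_norm (g1 i).
apply: (@le_lt_trans _ _ (\int[leb]_x \sum_i `|g x ord0 i|)%:E); last exact: ltry.
apply: ge_ereal_sup => _ [phi [cphi phi1] <-]; rewrite lee_fin fg//.
have p1 := Linfty_le1 cphi phi1.
rewrite (le_trans (ler_norm _))// normrN.
apply: le_Rintegral_dom.
- rewrite /dot; apply: measurable_sum => i; apply: measurable_funM.
    by apply/measurable_EFinP; case/integrableP: (g1 i).
  exact: LipC_measurable (Cc_smooth_LipC i cphi).
- exact: integrable_big_sum.
- move=> x; rewrite /dot (le_trans (ler_norm_sum _ _ _))//.
  by apply: ler_sum => i _; rewrite normrM ler_piMr.
Qed.

Lemma frac_partial_zero i x : Dk i (fun=> 0) x = 0.
Proof.
rewrite /frac_partial (_ : (fun z => _) = fun=> 0); first by rewrite /Rintegral integral0.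
by apply/funext => z; rewrite subrr mulr0.
Qed.

(** If [f] had an integrable weak gradient with [e]-coordinate [G], the pairing of [G] with w times
    a sum of J cosines would be at least J b. The part of [G] above a high level accounts for at
    most half of this, and the bounded part only for a multiple of sqrt J. *)
Lemma BV_not_S : exists f, BV_frac n alpha f /\ ~ S_frac n alpha f.
Proof.
pose A := \int[leb]_x (w x * w x).
have A0 : 0 < A := wbump_sqr_gt0 R e.
(* Then 9 eps = A / 4, half of the main term A / 2 in [riesz_potential_Dk_test]. *)
pose eps := A / 36.
have eps0 : 0 < eps by rewrite divr_gt0.
have wL := @wbump_LipC R n e.
pose f := riesz_potential halpha e eps0.
pose fr := @freq _ _ _ halpha e _ eps0.
pose freqs := @freqs _ _ _ halpha e _ eps0.
have c0 := frac_const_gt0.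
pose W := \int[leb]_x w x.
exists f; split.
  split; first exact: riesz_potential_L1.
  apply: (@le_lt_trans _ _
    (frac_const n alpha * \sum_(i < n) (2 * W + 5 * eps))%:E); last exact: ltry.
  apply: ge_ereal_sup => _ [phi [cphi phi1] <-]; rewrite lee_fin.
  have pl i := Cc_smooth_LipC i cphi.
  rewrite frac_div_integral//; last by move=> i; exact: riesz_potential_integrableM.
  rewrite ler_wpM2l ?(ltW c0)//; apply: ler_sum => i _.
  rewrite (le_trans (ler_norm _))//; apply: riesz_potential_Dk_bound => // x.
  exact: Linfty_le1.
move=> [_ [g g1 fg]].
pose G x := g x ord0 e.
have iG : leb.-integrable setT (EFin \o G) := g1 e.
have mG : measurable_fun setT G by apply/measurable_EFinP; case/integrableP: iG.
pose b := frac_const n alpha * (A / 4).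
have b0 : 0 < b by rewrite mulr_gt0// divr_gt0.
(* The pairing of [f] is at most - [b]; the minus sign in the definition of the weak gradient turns
   this into a lower bound for [G]. *)
have Gj j : b <= \int[leb]_x (G x * (cos_wave e (fr j) x * w x)).
  have cphi := test_fun_Cc e (fr j).
  have pl i := Cc_smooth_LipC i cphi.
  have := fg _ cphi.
  rewrite frac_div_integral//; last by move=> i; exact: riesz_potential_integrableM.
  rewrite (bigD1 e)//= big1 => [|i ie]; last first.
    have -> : (fun y => test_fun e (fr j) y ord0 i) = fun=> 0.
      by apply/funext => y; rewrite test_fun_coord (negbTE ie).
    rewrite (_ : (fun x => _) = fun=> 0); first by rewrite /Rintegral integral0.
    by apply/funext => x; rewrite frac_partial_zero mulr0.
  have -> : (fun y => test_fun e (fr j) y ord0 e) = fun y => cos_wave e (fr j) y * w y.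
    by apply/funext => y; rewrite test_fun_coord eqxx.
  rewrite addr0.
  have -> : \int[leb]_x dot (g x) (test_fun e (fr j) x) =
      \int[leb]_x (G x * (cos_wave e (fr j) x * w x)).
    apply: eq_Rintegral => x _; rewrite /dot (bigD1 e)//= big1 => [|i ie].
      by rewrite addr0 test_fun_coord eqxx.
    by rewrite test_fun_coord (negbTE ie) mulr0.
  have h := riesz_potential_Dk_test halpha e eps0 j.
  have h2 : frac_const n alpha * \int[leb]_x (f x * Dk e (fun x => cos_wave e (fr j) x * w x) x)
      <= frac_const n alpha * - (A / 4).
    rewrite ler_wpM2l ?(ltW c0)//; apply: (le_trans h).
    by rewrite -/A /eps; lra.
  move=> h3; rewrite h3 in h2; rewrite /b; lra.
have csB a : BLip (cos_wave e a) by exact: BLip_cos_wave.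
have sB J : BLip (cos_sum e (freqs J)) by exact: BLip_cos_sum.
have iM u : LipC u -> leb.-integrable setT (EFin \o (fun x => G x * u x)).
  move=> uL; have [[L [B [_ _ _ uB]]] _] := uL.
  rewrite (_ : (fun x => _) = fun x => u x * G x).
    exact: (bounded_integrableM (LipC_measurable uL) uB iG).
  by apply/funext => x; rewrite mulrC.
have lower J : J%:R * b <= \int[leb]_x (G x * (w x * cos_sum e (freqs J) x)).
  elim: J => [|J IH].
    rewrite mul0r (_ : (fun x => _) = fun=> 0); first by rewrite /Rintegral integral0.
    by apply/funext => x; rewrite /cos_sum big_nil !mulr0.
  have -> : \int[leb]_x (G x * (w x * cos_sum e (freqs J.+1) x)) =
      \int[leb]_x (G x * (w x * cos_sum e (freqs J) x)) +
      \int[leb]_x (G x * (cos_wave e (fr J) x * w x)).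
    rewrite -RintegralD//; last 2 first.
    - by apply: iM; exact: LipCMl.
    - by apply: iM; exact: LipC_cos_wave.
    by apply: eq_Rintegral => x _; rewrite cos_sum_cons; lra.
  by rewrite -natr1 mulrDl mul1r lerD.
have cosum_le J x : `|cos_sum e (freqs J) x| <= J%:R.
  elim: J => [|J IH]; first by rewrite /cos_sum big_nil normr0.
  rewrite cos_sum_cons (le_trans (ler_normD _ _))// addrC -natr1 lerD//.
  exact: cos_wave_le1.
(* The threshold b / 2 lets the large part of [G] absorb half of the lower bound J b. *)
have [M M0 HM] := large_part_small iG (divr_gt0 b0 (ltr0n R 2)).
(* With J = q^2 the bounded part contributes at most (M / 2) q W + (M / 2) q (W + 2 eps), linear in
   q, against the remaining q^2 b / 2. *)
have upper q : (0 < q)%N -> q%:R * b <= M * (2 * W + 2 * eps).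
  move=> q0; have qp : 0 < q%:R :> R by rewrite ltr0n.
  pose J := (q * q)%N.
  pose u x := w x * cos_sum e (freqs J) x * cos_sum e (freqs J) x.
  have uL : LipC u by apply: LipCMl => //; exact: LipCMl.
  have iw := LipC_integrable wL; have iu := LipC_integrable uL.
  (* The first term dominates where |G| > M, using |cos_sum| <= J; the other two dominate M w
     |cos_sum|. *)
  pose D x := J%:R * large_part G M x + (M / 2 * q%:R * w x + M / 2 / q%:R * u x).
  have iD : leb.-integrable setT (EFin \o D).
    apply: integrable_add; first by apply: integrable_scale; exact: large_part_integrable.
    by apply: integrable_add; exact: integrable_scale.
  have GD x : `|G x * (w x * cos_sum e (freqs J) x)| <= D x.
    have w0 := wbump_ge0 x; have w1 := wbump_le1 x.
    rewrite /D /u; have := cosum_le J x; move: (cos_sum e (freqs J) x) => S SJ.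
    (* AM-GM with the weight [q], the square root of [J] *)
    have Sq : w x * `|S| <= q%:R / 2 * w x + 2^-1 / q%:R * (w x * S * S).
      have : 0 <= w x * (2^-1 / q%:R) * (q%:R - `|S|) ^+ 2.
        by apply: mulr_ge0; rewrite ?sqr_ge0// mulr_ge0// divr_ge0// invr_ge0.
      have SS : `|S| ^+ 2 = S * S by rewrite -normrX ger0_norm ?sqr_ge0.
      have qi : q%:R * q%:R^-1 = 1 :> R by rewrite divff ?gt_eqF.
      rewrite sqrrB SS.
      have -> : w x * (2^-1 / q%:R) * (q%:R ^+ 2 - q%:R * `|S| *+ 2 + S * S) =
        q%:R / 2 * w x * (q%:R / q%:R) - w x * `|S| * (q%:R / q%:R) +
        2^-1 / q%:R * (w x * S * S) by lra.
      rewrite qi; lra.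
    have rest : 0 <= M / 2 * q%:R * w x + M / 2 / q%:R * (w x * S * S).
      have wSS : 0 <= w x * S * S by rewrite -mulrA mulr_ge0// -expr2 sqr_ge0.
      have M2 : 0 <= M / 2 by rewrite divr_ge0// ltW.
      by rewrite addr_ge0// mulr_ge0// mulr_ge0.
    rewrite normrM normrM (ger0_norm w0) /large_part; case: ltP => GM.
      rewrite (@le_trans _ _ (J%:R * `|G x|)) ?lerDl//.
      by rewrite mulrC ler_wpM2r// -[leRHS]mul1r ler_pM.
    rewrite mulr0 add0r (@le_trans _ _ (M * (w x * `|S|)))//.
      by rewrite ler_wpM2r// mulr_ge0.
    rewrite (le_trans (ler_wpM2l (ltW M0) Sq))// mulrDr le_eqVlt; apply/orP; left.
    by apply/eqP; lra.
  have mGs : measurable_fun setT (fun x => G x * (w x * cos_sum e (freqs J) x)).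
    by apply: measurable_funM => //; apply: LipC_measurable; exact: LipCMl.
  have h1 := le_trans (lower J) (le_trans (ler_norm _) (le_Rintegral_dom mGs iD GD)).
  have it := large_part_integrable iG M.
  move: h1; rewrite /D RintegralD//; last 2 first.
  - exact: integrable_scale.
  - by apply: integrable_add; exact: integrable_scale.
  rewrite RintegralD//; try exact: integrable_scale.
  rewrite !RintegralZl// -/W => h1.
  have h2 := cos_sum_sqr halpha e eps0 J; rewrite -/W -/u in h2.
  have h3 : M / 2 / q%:R * \int[leb]_x u x <= M / 2 * q%:R * (W + 2 * eps).
    rewrite (le_trans (ler_wpM2l _ h2))//.
      by rewrite !mulr_ge0 ?(ltW M0)// invr_ge0 ltW.
    rewrite /J natrM le_eqVlt; apply/orP; left; apply/eqP.
    have qi : q%:R^-1 * q%:R = 1 :> R by rewrite mulVf ?gt_eqF.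
    transitivity (q%:R^-1 * q%:R * (M / 2 * q%:R * (W + 2 * eps))); first lra.
    by rewrite qi mul1r.
  have h4 : J%:R * \int[leb]_x large_part G M x <= J%:R * (b / 2) by rewrite ler_wpM2l.
  have h5 : q%:R * (q%:R * b) <= q%:R * (M * (2 * W + 2 * eps)).
    by rewrite /J natrM in h1 h4; lra.
  by rewrite ler_pM2l in h5.
have [q] : exists q : nat, (0 < q)%N /\ M * (2 * W + 2 * eps) < q%:R * b.
  exists (Num.bound `|M * (2 * W + 2 * eps) / b|).+1; split => //.
  rewrite -ltr_pdivrMr// (le_lt_trans (ler_norm _))//.
  by rewrite (lt_le_trans (archi_boundP (normr_ge0 _)))// ler_nat.
by move=> [q0]; rewrite ltNge upper.
Qed.

End main.

Theorem theorem3p30 (R : realType) (n : nat) (alpha : R)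
  (hn : (1 <= n)%N) (halpha : 0 < alpha < 1) :
  S_frac n alpha `<=` BV_frac n alpha /\
  BV_frac n alpha `\` S_frac n alpha !=set0.
Proof.
split; first exact: S_frac_sub_BV.
by have [f fP] := BV_not_S halpha (Ordinal hn); exists f.
Qed.
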